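(* Let $k$ be a field of characteristic $0$, $\widetilde{W}$ a finite reflection group on a graded finite-dimensional $k$-vector space $\widetilde V$, $G$ a good normal subgroup of $\widetilde W$, $W=\widetilde W/G$, and $V$ the tangent space to $\widetilde V/G$ at $0$. Put $B=k[\widetilde V]$ and $A=k[V]$. Suppose that $G$ contains no reflection. Then: (i) $G$ is generated by double reflections. (ii) Every reflection of $\widetilde W$ has as image in $W$ a reflection (of $V$) of the same order. (iii) $G$ is contained in $SL(\widetilde V)$. (iv) The image in $B$ (i.e. the ideal of $B$ generated by the image under $A\to B^G\subset B$) of the Jacobian ideal of $A$ over $A^W$ is the Jacobian ideal of $B$ over $B^{\widetilde W}$.
   Context: A grading on a finite-dimensional $k$-vector space is an algebraic action of $k^\times$ with strictly positive weights; $GL_{grad}(\widetilde V)$ is the group of elements of $GL(\widetilde V)$ commuting with this action, and $\widetilde W\subset GL_{grad}(\widetilde V)$. A reflection (resp. double reflection) is an automorphism $g$ of finite order with $\ker(g-1)$ of codimension $1$ (resp. $2$); a finite linear group is a reflection group if generated by its reflections. For a vector space $V$, $k[V]$ is the symmetric algebra of $V^*$. $\widetilde V/G=\operatorname{Spec}B^G$, $B^G_+$ is the ideal of $B^G$ spanned by homogeneous elements of positive degree, and $V=(B^G_+/(B^G_+)^2)^*$. Let $N(G)$ be the normalizer of $G$ in $GL_{grad}(\widetilde V)$. Fix a graded $N(G)$-equivariant splitting $V^*\to B^G_+$; it induces a surjection $A=k[V]\to B^G$ with kernel $I$, i.e. a closed immersion $\widetilde V/G\hookrightarrow V$. $A_+$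 is the ideal of positive-degree elements of $A$. $G$ is called good in $\widetilde W$ if $G$ is of complete intersection (the minimal number of generators of $I$ is $\dim V-\dim\widetilde V$) and $W$ acts trivially on $I/A_+I$; in that case $W$ is a reflection group on $V$. The Jacobian ideal of $A$ over $A^W$ is the principal ideal of $A$ generated by the Jacobian determinant of a system of algebraically independent homogeneous generators of $A^W$ with respect to linear coordinates of $V$; similarly for $B$ over $B^{\widetilde W}$. *)

(* Defs.v *)
From HB Require Import structures.
From mathcomp Require Import all_boot all_order all_algebra all_fingroup.
From mathcomp Require Import all_solvable all_character.
From mathcomp Require Import mpoly.

Set Implicit Arguments.
Unset Strict Implicit.
Unset Printing Implicit Defensive.

Import GRing.Theory.
Local Open Scope ring_scope.

(* Conventions.  A graded k-vector space of dimension n is 'cV[k]_n, written   *)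
(* in a basis of weight vectors: a weight function d : 'I_n -> nat records     *)
(* that t in k^x acts by diag(t ^ d_0, ..., t ^ d_(n-1)).  Linear groups act   *)
(* on column vectors by v |-> rG g *m v, and k[V] is {mpoly k[n]}, 'X_i being  *)
(* the i-th coordinate function, of degree d i.                                *)

Section Span.
Variables (R : nzRingType) (M : lmodType R).

Definition span_of (S : M -> Prop) (x : M) : Prop :=
  exists (r : nat) (c : 'I_r -> R) (v : 'I_r -> M),
    (forall i, S (v i)) /\ x = \sum_i c i *: v i.

End Span.

Definition ideal_of (R : comNzRingType) (S : R -> Prop) (x : R) : Prop :=
  @span_of R (R^o) S x.

Definition is_min_ngens (R : comNzRingType) (I : R -> Prop) (c : nat) : Prop :=
  let generated_by r :=
    exists g : 'I_r -> R, forall x, I x <-> ideal_of (fun y => exists i, y = g i) x in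
  generated_by c /\ (forall r, generated_by r -> (c <= r)%N).

Section WeightedDegree.
Variables (n : nat) (d : 'I_n -> nat).

Definition wdeg (m : 'X_{1..n}) : nat := (\sum_(i < n) m i * d i)%N.

Lemma wdeg0 : wdeg 0%MM = 0%N.
Proof. by rewrite /wdeg big1 // => i _; rewrite mnm0E. Qed.

Lemma wdegD : {morph wdeg : m1 m2 / (m1 + m2)%MM >-> (m1 + m2)%N}.
Proof.
by move=> m1 m2; rewrite /wdeg -big_split; apply: eq_bigr => i _; rewrite mnmDE mulnDl.
Qed.

HB.instance Definition _ := isMeasure.Build n wdeg wdeg0 wdegD.

End WeightedDegree.

Section GradedLinearGroups.
Variables (k : fieldType) (n : nat) (d : 'I_n -> nat).
Implicit Types (p : {mpoly k[n]}) (M N : 'M[k]_n).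

Definition whomog (r : nat) p : Prop := p \is r.-homog for (wdeg d).

(* p \o (v |-> M *m v) *)
Definition pullback M p : {mpoly k[n]} :=
  p \mPo [tuple \sum_(j < n) M i j *: 'X_j | i < n].

Definition weight_action (t : k) : 'M[k]_n := diag_mx (\row_i t ^+ d i).

Definition GL_grad M : Prop :=
  M \in unitmx /\ forall t, t != 0 -> M *m weight_action t = weight_action t *m M.

(* For S stable under the weight action: the span of its homogeneous elements  *)
(* of positive degree.                                                         *)
Definition pos_part (S : {mpoly k[n]} -> Prop) : {mpoly k[n]} -> Prop :=
  span_of (fun p => S p /\ exists2 r, (0 < r)%N & whomog r p).

Definition prod_of (S T : {mpoly k[n]} -> Prop) : {mpoly k[n]} -> Prop :=
  span_of (fun p => exists a b, [/\ S a, T b & p = a * b]).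

(* Codimension of the kernel of g - 1 acting on column vectors (kermx is the   *)
(* kernel on row vectors, whence the transpose).                               *)
Definition fix_codim M : nat := (n - \rank (kermx (M - 1%:M)^T))%N.

Definition alg_indep (r : nat) (h : r.-tuple {mpoly k[n]}) : Prop :=
  forall P : {mpoly k[r]}, P \mPo h = 0 -> P = 0.

Definition is_polynomial_gens (S : {mpoly k[n]} -> Prop) (h : n.-tuple {mpoly k[n]}) : Prop :=
  [/\ forall i, S (tnth h i),
      forall i, exists r, whomog r (tnth h i),
      alg_indep h
    & forall p, S p -> exists P : {mpoly k[n]}, p = P \mPo h].

Definition jacobian (h : n.-tuple {mpoly k[n]}) : {mpoly k[n]} :=
  \det (\matrix_(i < n, j < n) (tnth h i)^`M(j)).

(* The Jacobian ideal of k[V] over a graded polynomial subalgebra S; it does   *)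
(* not depend on the generators h, and it is empty (not an ideal) if S has no  *)
(* such system of generators.                                                  *)
Definition jacobian_ideal (S : {mpoly k[n]} -> Prop) (p : {mpoly k[n]}) : Prop :=
  exists2 h, is_polynomial_gens S h & ideal_of (fun q => q = jacobian h) p.

Section Representation.
Variables (gT : finGroupType) (H : {group gT}) (rH : mx_representation k H n).

Definition invariant_poly (K : {set gT}) p : Prop :=
  forall g, g \in K -> pullback (rH g) p = p.

(* c = 1: reflections, c = 2: double reflections.  Finiteness of the order is  *)
(* automatic in a finite group.                                                *)
Definition reflections (c : nat) (K : {set gT}) : {set gT} :=
  [set g in K | fix_codim (rH g) == c].

Definition normalizes_grad (K : {set gT}) M : Prop :=
  let image N := exists2 g, g \in K & N = rH g in
  GL_grad M /\ forall N, image N <-> image (M *m N *m invmx M).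

Definition inv_pos (K : {set gT}) : {mpoly k[n]} -> Prop := pos_part (invariant_poly K).
Definition inv_pos2 (K : {set gT}) : {mpoly k[n]} -> Prop :=
  prod_of (inv_pos K) (inv_pos K).

(* f lists the images of a homogeneous basis of V^* = B^K_+ / (B^K_+)^2, of    *)
(* degrees e, under a graded N(K)-equivariant splitting V^* -> B^K_+; a        *)
(* section is equivariant exactly when its image is stable.  The induced map   *)
(* A = k[V] -> B^K is then p |-> p \mPo f, the i-th coordinate function of V   *)
(* being the class of f_i, of degree e i.                                      *)
Definition is_graded_splitting (K : {set gT}) (m : nat) (e : 'I_m -> nat)
    (f : m.-tuple {mpoly k[n]}) : Prop :=
  [/\ forall i, inv_pos K (tnth f i) /\ whomog (e i) (tnth f i),
      forall c : 'I_m -> k, inv_pos2 K (\sum_i c i *: tnth f i) -> forall i, c i = 0,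
      forall b, inv_pos K b ->
        exists c : 'I_m -> k, inv_pos2 K (b - \sum_i c i *: tnth f i)
    & forall M, normalizes_grad K M -> forall i,
        span_of (fun q => exists j, q = tnth f j) (pullback M (tnth f i))].

End Representation.
End GradedLinearGroups.

Section Good.
Variables (k : fieldType) (n : nat) (gT : finGroupType) (Wt G : {group gT}).
Variables (rWt : mx_representation k Wt n) (m : nat) (f : m.-tuple {mpoly k[n]}).
Variable (rV : mx_representation k (Wt / G)%G m).

(* rV is the action of Wt / G on V induced by that of Wt on B^G, i.e. the one  *)
(* making v |-> (f_i(v))_i equivariant.  It is determined by f.                *)
Definition is_tangent_repr : Prop :=
  forall w, w \in Wt -> forall i,
    pullback (rWt w) (tnth f i) = \sum_j rV (coset G w) i j *: tnth f j.

Definition relation_ideal (p : {mpoly k[m]}) : Prop := p \mPo f = 0.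

Definition is_good (e : 'I_m -> nat) : Prop :=
  (exists2 c, is_min_ngens relation_ideal c & m = (n + c)%N) /\
  (forall x, x \in (Wt / G)%g -> forall p, relation_ideal p ->
     prod_of (pos_part e (fun _ => True)) relation_ideal (pullback (rV x) p - p)).

End Good.

(* Main.v *)
(* Write B^G = A/I.  Since W acts trivially on I/A_+I, the ideal I has           *)
(* homogeneous W-invariant generators g_1, ..., g_c, and together with lifts h_i *)
(* of generators of the polynomial algebra B^Wt they generate A^W freely.        *)
(* As G contains no reflection, V~ -> V~/G is etale in codimension 1: for a      *)
(* linear form b and P(T) = prod_(x in G) (T - x b), everything is controlled by *)
(* P'(b) = prod_(x <> 1) (b - x b), a product of linear forms which can be made  *)
(* prime to any given linear form.  Up to such products, the differentials of    *)
(* the coordinates of V~/G span those of V~, and the conormal sequence           *)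
(* 0 -> I/I^2 -> Omega_V -> Omega_(V~/G) -> 0 splits; comparing determinants      *)
(* gives (iv).  The image of J_A being G-invariant while J_B is a det^-1         *)
(* semi-invariant, (iii) follows.  For (ii), evaluate the split sequence at a    *)
(* generic point of the hyperplane of a reflection.  For (i), let G' be the      *)
(* subgroup generated by the double reflections.  If s is a reflection and al    *)
(* the linear form of V defining the hyperplane of its image, then (s - 1) p is  *)
(* divisible by the image of al for all p in B^G', so an element of least degree *)
(* of B^G' with zero G-trace is invariant under Wt, hence zero.                  *)

Require Import Defs.
From HB Require Import structures.
From mathcomp Require Import all_boot all_order all_algebra all_fingroup.
From mathcomp Require Import all_solvable all_character.
From mathcomp Require Import fraction mpoly ring.
From Stdlib Require Import Classical.

Set Implicit Arguments.
Unset Strict Implicit.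
Unset Printing Implicit Defensive.

Import GRing.Theory.
Local Open Scope ring_scope.

(** The proof compares Jacobian matrices along [f]. [good_relations] turns goodness into [c]
    homogeneous [W]-invariant generators [g] of the ideal of relations, with [m = n + c]. Generators
    [F] of B^Wt come from [chevalley_polynomial], which rests on gradients: invariants that are
    independent modulo the ideal of lower-degree invariants have independent gradients
    ([low_independent_grad]), so there are at most [n] of them. Lifting [F] to invariants [h] on V,
    the family [h, g] generates A^W ([lifted_gens_polynomial_gens]).

    Two identities drive the comparison. Differentiating the Galois polynomial P of a linear form b
    at its root b writes P'(b) db through the df_l ([galois_disc_mx]). Next, [conormal_splitting]
    inverts the Jacobian matrix of [g] on the right, up to a power of P'(b). Taking determinants
    relates the two Jacobians up to discriminants ([jacobian_relations]). Without reflections in G,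
    1 - x has rank at least 2 for each x <> 1 in G, so the linear factors of P'(b) can be moved off
    any given line, and [dvdm_lin_coprime] removes them. Each Jacobian therefore divides the other,
    which is (iv), and [jacobian_pullback] then yields (iii).

    For (ii), the same identities are evaluated at a point fixed by the reflection with trivial
    stabilizer in G ([tangent_reflection], [coset_reflection_order]). For (i), the invariants of the
    group G' generated by double reflections contain no nonzero element of zero G-trace
    ([double_refl_invariants]). They are therefore those of G, and [galois_fixed] recovers the group
    from its invariants. *)

(** * Substitution and differentiation of polynomials *)

Section MpolyBasics.
Variable (R : comNzRingType).

Lemma mpoly_alg_ind n (P : {mpoly R[n]} -> Prop) :
  (forall c, P c%:MP) -> (forall i, P 'X_i) ->
  (forall p q, P p -> P q -> P (p + q)) -> (forall p q, P p -> P q -> P (p * q)) ->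
  forall p, P p.
Proof.
move=> PC PX PD PM; elim/mpolyind => [|c m p _ _ IH]; first exact: (PC 0).
apply: (PD) => //; rewrite -mul_mpolyC; apply: (PM); first exact: PC.
rewrite mpolyXE_id; apply: (big_ind P) => [||i _]; [exact: (PC 1) | exact: PM | ].
elim: (m i) => [|e IHe]; first exact: (PC 1).
by rewrite exprS; apply: PM => //; apply: PX.
Qed.

Lemma comp_mpolyXt n l (q : n.-tuple {mpoly R[l]}) i : 'X_i \mPo q = tnth q i.
Proof. by rewrite comp_mpolyXU -tnth_nth. Qed.

Lemma comp_mpolyA n l r (p : {mpoly R[n]}) (q : n.-tuple {mpoly R[l]}) (t : l.-tuple {mpoly R[r]}) :
  (p \mPo q) \mPo t = p \mPo [tuple tnth q i \mPo t | i < n].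
Proof.
elim/mpoly_alg_ind: p => [c|i|p1 p2 e1 e2|p1 p2 e1 e2].
- by rewrite !comp_mpolyC.
- by rewrite !comp_mpolyXt tnth_mktuple.
- by rewrite !comp_mpolyD e1 e2.
- by rewrite !rmorphM /= e1 e2.
Qed.

Lemma eq_comp_mpoly n l (p : {mpoly R[n]}) (q t : n.-tuple {mpoly R[l]}) :
  (forall i, tnth q i = tnth t i) -> p \mPo q = p \mPo t.
Proof. by move=> e; congr (_ \mPo _); apply: eq_from_tnth. Qed.

Lemma mderiv_comp n l (p : {mpoly R[n]}) (q : n.-tuple {mpoly R[l]}) j :
  (p \mPo q)^`M(j) = \sum_i (p^`M(i) \mPo q) * (tnth q i)^`M(j).
Proof.
elim/mpoly_alg_ind: p => [c|i|p1 p2 e1 e2|p1 p2 e1 e2].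
- rewrite comp_mpolyC mderivC big1 // => i _; by rewrite mderivC comp_mpoly0 mul0r.
- rewrite comp_mpolyXt (bigD1 i) //= big1 => [|i' ne].
    rewrite mderivX mnm1E eqxx scale1r.
    have -> : (U_(i) - U_(i))%MM = 0%MM :> 'X_{1..n}.
      by apply/mnmP => t; rewrite mnmBE subnn mnm0E.
    by rewrite mpolyX0 comp_mpoly1 mul1r addr0.
  by rewrite mderivX mnm1E eq_sym (negbTE ne) scale0r comp_mpoly0 mul0r.
- rewrite comp_mpolyD mderivD e1 e2 -big_split; apply: eq_bigr => i _ /=.
  by rewrite mderivD comp_mpolyD mulrDl.
- rewrite rmorphM /= mderivM e1 e2 mulr_suml mulr_sumr -big_split; apply: eq_bigr => i _ /=.
  rewrite mderivM comp_mpolyD !rmorphM /= mulrDl mulrA; congr (_ + _).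
  by rewrite mulrAC.
Qed.

Lemma mderivXU n (i j : 'I_n) : ('X_i : {mpoly R[n]})^`M(j) = (i == j)%:R.
Proof.
rewrite mderivX mnm1E; case: eqP => [->|_]; last by rewrite scale0r.
rewrite scale1r -mpolyX0; congr 'X_[_]; apply/mnmP => t; by rewrite mnmBE subnn mnm0E.
Qed.

(** The multivariate form of the divisibility of P(x) - P(y) by x - y; divisibility by a linear form
    is obtained from it. *)
Lemma comp_mpoly_sub n l (p : {mpoly R[n]}) (q t : n.-tuple {mpoly R[l]}) :
  exists c : 'I_n -> {mpoly R[l]},
    (p \mPo q) - (p \mPo t) = \sum_i c i * (tnth q i - tnth t i).
Proof.
elim/mpoly_alg_ind: p => [a|i|p1 p2 [c1 e1] [c2 e2]|p1 p2 [c1 e1] [c2 e2]].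
- by exists (fun _ => 0); rewrite !comp_mpolyC subrr big1 // => i _; rewrite mul0r.
- exists (fun j => (j == i)%:R); rewrite (bigD1 i) //= eqxx mul1r big1 ?addr0 ?comp_mpolyXt //.
  by move=> j /negbTE->; rewrite mul0r.
- exists (fun i => c1 i + c2 i); rewrite !comp_mpolyD.
  under eq_bigr do rewrite mulrDl.
  by rewrite big_split /= -e1 -e2 opprD addrACA.
- exists (fun i => (p2 \mPo q) * c1 i + (p1 \mPo t) * c2 i); rewrite !rmorphM /=.
  under eq_bigr do rewrite mulrDl -!mulrA.
  rewrite big_split /= -!mulr_sumr -e1 -e2 !mulrBr (mulrC (p1 \mPo q)) (mulrC (p1 \mPo t) (p2 \mPo q)).
  by rewrite addrA subrK.
Qed.

End MpolyBasics.

(** * Linear forms *)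

Definition dvdm (R : comNzRingType) (x y : R) : Prop := exists q, y = q * x.

Section Divisibility.
Variable R : comNzRingType.
Implicit Types x y z : R.

Lemma dvdm_refl x : dvdm x x. Proof. by exists 1; rewrite mul1r. Qed.
Lemma dvdm0 x : dvdm x 0. Proof. by exists 0; rewrite mul0r. Qed.
Lemma dvdm_trans y x z : dvdm x y -> dvdm y z -> dvdm x z.
Proof. by move=> [a ->] [b ->]; exists (b * a); rewrite mulrA. Qed.
Lemma dvdm_mull x y z : dvdm x y -> dvdm x (z * y).
Proof. by move=> [a ->]; exists (z * a); rewrite mulrA. Qed.
Lemma dvdm_mulr x y z : dvdm x y -> dvdm x (y * z).
Proof. by rewrite mulrC; apply: dvdm_mull. Qed.
Lemma dvdmD x y z : dvdm x y -> dvdm x z -> dvdm x (y + z).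
Proof. by move=> [a ->] [b ->]; exists (a + b); rewrite mulrDl. Qed.
Lemma dvdmN x y : dvdm x y -> dvdm x (- y).
Proof. by move=> [a ->]; exists (- a); rewrite mulNr. Qed.
Lemma dvdm_sum (I : Type) (r : seq I) (P : pred I) x (F : I -> R) :
  (forall i, P i -> dvdm x (F i)) -> dvdm x (\sum_(i <- r | P i) F i).
Proof. move=> dF; apply: (big_ind (dvdm x)) => //; [exact: dvdm0 | exact: dvdmD]. Qed.

Lemma ideal_of_principal (j p : R) : ideal_of (fun q => q = j) p <-> dvdm j p.
Proof.
split=> [[r [c [v [vj ->]]]]|[q ->]].
  by apply: dvdm_sum => i _; rewrite vj; exists (c i).
by exists 1%N, (fun=> q), (fun=> j); rewrite big_ord1.
Qed.

End Divisibility.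

Section LinearForms.
Variables (k : fieldType) (n : nat).
Implicit Types (a b : 'rV[k]_n) (p q : {mpoly k[n]}).

Definition lin a : {mpoly k[n]} := \sum_j a 0 j *: 'X_j.

Lemma lin_is_linear : linear lin.
Proof.
move=> c a b; rewrite /lin scaler_sumr -big_split; apply: eq_bigr => j _ /=.
by rewrite !mxE scalerDl scalerA.
Qed.
HB.instance Definition _ :=
  GRing.isLinear.Build k 'rV[k]_n {mpoly k[n]} _ lin lin_is_linear.

Lemma mcoeff_lin a j : (lin a)@_U_(j) = a 0 j.
Proof.
rewrite /lin raddf_sum (bigD1 j) //= mcoeffZ mcoeffXU eqxx mulr1 big1 ?addr0 // => i ne.
by rewrite mcoeffZ mcoeffXU (negbTE ne) mulr0.
Qed.

Lemma lin_eq0 a : (lin a == 0) = (a == 0).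
Proof.
apply/eqP/eqP => [e|->]; last by rewrite raddf0.
by apply/rowP => j; rewrite -mcoeff_lin e mcoeff0 mxE.
Qed.

Lemma lin_delta j : lin (delta_mx 0 j) = 'X_j.
Proof.
rewrite /lin (bigD1 j) //= mxE !eqxx scale1r big1 ?addr0 // => i ne.
by rewrite mxE (negbTE ne) andbF scale0r.
Qed.

Lemma mderiv_lin a j : (lin a)^`M(j) = (a 0 j)%:MP.
Proof.
rewrite /lin raddf_sum (bigD1 j) //= mderivZ mderivXU eqxx big1 => [|i ne].
  by rewrite addr0 -mul_mpolyC mulr1.
by rewrite mderivZ mderivXU (negbTE ne) scaler0.
Qed.

Lemma meval_lin a v : (lin a).@[v] = \sum_j a 0 j * v j.
Proof. by rewrite /lin raddf_sum; apply: eq_bigr => j _; rewrite /= mevalZ mevalXU. Qed.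

Lemma comp_lin r (q : n.-tuple {mpoly k[r]}) a :
  lin a \mPo q = \sum_j a 0 j *: tnth q j.
Proof. by rewrite /lin raddf_sum; apply: eq_bigr => j _; rewrite /= comp_mpolyZ comp_mpolyXt. Qed.

(* The hyperplane [lin a = 0], parametrized by solving for the i-th coordinate. *)
Definition kill a i : n.-tuple {mpoly k[n]} :=
  [tuple 'X_j - ((j == i)%:R * (a 0 i)^-1) *: lin a | j < n].

Lemma lin_kill a b i : lin b \mPo kill a i = lin (b - (b 0 i / a 0 i) *: a).
Proof.
rewrite comp_lin raddfB /= linearZ /= [X in X - _]/lin.
under eq_bigr do rewrite tnth_mktuple scalerBr.
rewrite sumrB; congr (_ - _); rewrite (bigD1 i) //= eqxx mul1r scalerA big1 ?addr0 // => j ne.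
by rewrite (negbTE ne) mul0r scale0r scaler0.
Qed.

(** [kill a i] differs from the identity substitution by multiples of [lin a], so restriction to the
    hyperplane has kernel generated by [lin a]. As restriction lands in a domain, [lin a] is
    prime. *)
Lemma lin_killP a i p : a 0 i != 0 -> dvdm (lin a) p <-> p \mPo kill a i = 0.
Proof.
move=> ai; split=> [[q ->]|p0].
  by rewrite rmorphM /= lin_kill divff // scale1r subrr raddf0 mulr0.
have [c e] := comp_mpoly_sub p [tuple 'X_j | j < n] (kill a i).
rewrite comp_mpoly_id p0 subr0 in e; rewrite e; apply: dvdm_sum => j _.
rewrite !tnth_mktuple opprB addrC subrK; apply: dvdm_mull.
by exists (((j == i)%:R / a 0 i)%:MP); rewrite mul_mpolyC.
Qed.

Lemma row_neq0_ex a : a != 0 -> exists i, a 0 i != 0.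
Proof. by case/rV0Pn => i ai; exists i. Qed.

Lemma lin_prime a p q : a != 0 -> dvdm (lin a) (p * q) -> dvdm (lin a) p \/ dvdm (lin a) q.
Proof.
case/row_neq0_ex => i ai /(lin_killP _ ai); rewrite rmorphM /= => /eqP.
by rewrite mulf_eq0 => /orP[] /eqP e; [left | right]; apply/(lin_killP _ ai).
Qed.

Lemma lin_dvd_lin a b : a != 0 -> dvdm (lin a) (lin b) -> (b <= a)%MS.
Proof.
case/row_neq0_ex => i ai /(lin_killP _ ai); rewrite lin_kill => /eqP.
by rewrite lin_eq0 subr_eq0 => /eqP->; rewrite scalemx_sub.
Qed.

Lemma sub_lin_dvd a b : (b <= a)%MS -> dvdm (lin a) (lin b).
Proof.
case/sub_rVP => c ->; exists c%:MP; by rewrite linearZ /= mul_mpolyC.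
Qed.

Lemma lin_ndvd1 a : a != 0 -> ~ dvdm (lin a) 1.
Proof.
case/row_neq0_ex => i ai /(lin_killP _ ai); rewrite comp_mpoly1 => /eqP.
by rewrite oner_eq0.
Qed.

(* The products of linear forms [F t] have no common factor; only the          *)
(* primality of linear forms is used, not the factoriality of [k[V]].          *)
Lemma dvdm_lin_coprime (J x : {mpoly k[n]}) (T : Type) (F : T -> seq 'rV[k]_n) :
  J != 0 -> (exists t, all (fun b => b != 0) (F t)) ->
  (forall t, dvdm J (x * \prod_(b <- F t) lin b)) ->
  (forall a, a != 0 -> exists t, all (fun b => ~~ (b <= a)%MS) (F t)) ->
  dvdm J x.
Proof.
move=> J0 [t0 nz] dF avoid; move: nz (dF t0); elim: (F t0) => [|a L IH] /=.
  by rewrite big_nil mulr1.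
case/andP=> a0 L0; rewrite big_cons => -[q e]; apply: IH => //.
(* To strip the factor [lin a], compare with a second product prime to it: [lin a] then divides the
   cofactor [q]. *)
have [t at_] := avoid a a0; have [q2 e2] := dF t.
have e3 : q * (\prod_(b <- F t) lin b) = q2 * (lin a * \prod_(b <- L) lin b).
  by apply: (mulIf J0); rewrite mulrAC -e mulrAC e2 mulrAC.
have : dvdm (lin a) (q * \prod_(b <- F t) lin b).
  by rewrite e3 mulrCA; exists (q2 * \prod_(b <- L) lin b); rewrite mulrC.
case/(lin_prime a0) => [[q' eq]|].
  exists q'; apply: (@mulIf _ (lin a)); first by rewrite lin_eq0.
  by rewrite -mulrA (mulrC _ (lin a)) e eq mulrAC.
move: at_; elim: (F t) => [|b M IHM] /=.
  by rewrite big_nil => _ /(lin_ndvd1 a0).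
case/andP=> ba aM; rewrite big_cons => /(lin_prime a0)[/(lin_dvd_lin a0)|]; last exact: IHM.
by rewrite (negbTE ba).
Qed.

(** The bad vectors form a proper subspace, so they lie in the kernel of one nonzero functional,
    namely a nonzero column of [M *m cokermx a]. *)
Lemma avoid_functional (M : 'M[k]_n) a : ~~ (M <= a)%MS ->
  exists2 l : 'cV[k]_n, l != 0 & forall b, (b *m M <= a)%MS -> b *m l = 0.
Proof.
rewrite submxE => /matrix0Pn[i [j nz]]; exists (col j (M *m cokermx a)).
  by apply/cV0Pn; exists i; rewrite mxE.
by move=> b; rewrite submxE => /eqP e; rewrite colE (mulmxA b) (mulmxA b M) e mul0mx.
Qed.

(** The basis is taken on the moment curve x |-> (1, x, x^2, ...): each [l t] restricts there to a
    nonzero polynomial in x, and a Vandermonde determinant gives independence. *)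
Lemma avoid_basis (T : finType) (l : T -> 'cV[k]_n) :
  [pchar k] =i pred0 -> (forall t, l t != 0) ->
  exists2 u : 'M[k]_n, u \in unitmx & forall i t, row i u *m l t != 0.
Proof.
move=> ch0 l0; have /pcharf0P natr0 := ch0.
have natr_inj : injective (fun s : nat => s%:R : k).
  move=> s t /eqP; wlog st : s t / (s <= t)%N.
    by move=> W; case/orP: (leq_total s t) => st e; [apply: W | apply/esym/W; rewrite // eq_sym].
  by rewrite eq_sym -subr_eq0 -natrB // natr0 subn_eq0 => ts; apply/eqP; rewrite eqn_leq st.
pose P t := \poly_(j < n) (if insub j is Some j' then l t j' 0 else 0).
have PE t x : (P t).[x] = \sum_(j < n) x ^+ j * l t j 0.
  rewrite horner_poly; apply: eq_bigr => j _; by rewrite valK mulrC.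
pose Q := \prod_t P t.
have Q0 : Q != 0.
  apply/prodf_neq0 => t _; case/cV0Pn: (l0 t) => i li; apply/eqP => /polyP/(_ i).
  by rewrite coef_poly ltn_ord valK coef0 => e; rewrite e eqxx in li.
(* Fewer than [size Q] of these values are roots of [Q], so at least [n] remain; they are distinct
   in characteristic 0. *)
pose s := [seq x%:R : k | x <- iota 0 (size Q + n)].
have us : uniq s by rewrite map_inj_uniq ?iota_uniq.
pose good := [seq x <- s | ~~ root Q x].
have sgood : (n <= size good)%N.
  have : (size [seq x <- s | root Q x] < size Q)%N.
    by apply: max_poly_roots => //; [apply: filter_all | apply: filter_uniq].
  have : (size [seq x <- s | root Q x] + size good = size Q + n)%N.
    by rewrite !size_filter count_predC /s size_map size_iota.
  move=> e1 e2; rewrite -(leq_add2l (size Q)) -e1 leq_add2r; exact: ltnW.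
pose x (i : 'I_n) := good`_i.
have xg i : x i \in good by apply: mem_nth; apply: leq_trans sgood.
exists (Vandermonde n (\row_i x i))^T.
  rewrite unitmx_tr unitmxE unitfE det_Vandermonde; apply/prodf_neq0 => i _.
  apply/prodf_neq0 => j ij; rewrite !mxE subr_eq0 nth_uniq ?(leq_trans _ sgood) //.
    by rewrite neq_ltn ij orbT.
  exact: filter_uniq.
move=> i t; apply/eqP => /matrixP/(_ 0 0); rewrite !mxE => e.
have := xg i; rewrite mem_filter => /andP[/negP nr _]; apply: nr.
rewrite /root horner_prod (bigD1 t) //= PE (_ : \sum_(j < n) _ = 0) ?mul0r // -[RHS]e.
by apply: eq_bigr => j _; rewrite !mxE.
Qed.

Lemma avoid_vector (T : finType) (l : T -> 'cV[k]_n) :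
  [pchar k] =i pred0 -> (forall t, l t != 0) ->
  exists u : 'rV[k]_n, forall t, u *m l t != 0.
Proof.
move=> ch0 l0; have [u _ uP] := avoid_basis ch0 l0.
case: (pickP 'I_n) => [i _|no]; first by exists (row i u).
by exists 0 => t; case/cV0Pn: (l0 t) => i; have := no i.
Qed.

End LinearForms.

(** * Weighted homogeneous components *)

Section Components.
Variables (n : nat) (R : comNzRingType) (mf : measure n).
Implicit Types p q a b : {mpoly R[n]}.

Lemma mcoeff_pihomog r p m : (pihomog mf r p)@_m = if mf m == r then p@_m else 0.
Proof.
elim/mpolyind: p => [|c m' p _ _ IH]; first by rewrite raddf0 mcoeff0 if_same.
rewrite !raddfD /= linearZ /= IH pihomogX !mcoeffZ mcoeffX.
case: (eqVneq m' m) => [->|ne].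
  by case: ifP => _; rewrite ?mcoeffX ?eqxx // mcoeff0 mulr0 addr0.
rewrite [X in c * X](_ : _ = 0) ?mulr0 ?add0r //.
by case: ifP => _; rewrite ?mcoeff0 // mcoeffX (negbTE ne).
Qed.

Lemma pihomogMhomog b D E a : b \is D.-homog for mf ->
  pihomog mf E (a * b) = (if (D <= E)%N then pihomog mf (E - D) a else 0) * b.
Proof.
move=> hb; elim/mpolyind: a => [|c m p _ _ IH].
  by rewrite mul0r !raddf0 if_same mul0r.
rewrite mulrDl raddfD /= IH -scalerAl linearZ /=.
have hm : 'X_[m] * b \is (mf m + D).-homog for mf.
  by apply: dhomogM hb; rewrite dhomogX.
case: leqP => DE; last first.
  rewrite mul0r addr0 (pihomog_ne0 _ hm) ?scaler0 //.
  by rewrite neq_ltn (leq_trans DE) ?orbT ?leq_addl.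
rewrite raddfD /= linearZ /= mulrDl; congr (_ + _).
rewrite -scalerAl pihomogX; case: eqP => [e|ne].
  by rewrite pihomog_dE //; move: hm; rewrite e subnK.
rewrite mul0r (pihomog_ne0 _ hm) //; apply/eqP => e; apply: ne.
by rewrite -e addnK.
Qed.

Lemma homog_split p N : (mmeasure mf p <= N)%N -> p = \sum_(r < N) pihomog mf r p.
Proof. exact: pihomog_partitionE. Qed.

Lemma pihomogM E a b :
  pihomog mf E (a * b) = \sum_(r < E.+1) pihomog mf (E - r) a * pihomog mf r b.
Proof.
rewrite {1}(homog_split (leqnn (mmeasure mf b))) mulr_sumr raddf_sum /=.
under eq_bigr => r _ do rewrite (pihomogMhomog _ _ (pihomogP mf r b)).
pose F r := (if (r <= E)%N then pihomog mf (E - r) a else 0) * pihomog mf r b.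
rewrite (_ : \sum_(r < E.+1) _ = \sum_(r < E.+1) F r); last first.
  by apply: eq_bigr => r _; rewrite /F -ltnS ltn_ord.
rewrite -[LHS](big_mkord xpredT F) -(big_mkord xpredT F).
have vF1 r : (mmeasure mf b <= r)%N -> F r = 0.
  move=> br; rewrite /F (_ : pihomog mf r b = 0) ?mulr0 //; apply/mpolyP => m.
  rewrite mcoeff_pihomog mcoeff0; case: eqP => // e; apply: memN_msupp_eq0.
  by apply: (mmeasure_mnm_ge (mf := mf)); rewrite e.
have vF2 r : (E < r)%N -> F r = 0 by rewrite /F ltnNge => /negbTE->; rewrite mul0r.
(* Both sums are padded by zeros up to the common bound [K]. *)
pose K := maxn (mmeasure mf b) E.+1.
transitivity (\sum_(0 <= r < K) F r).
  rewrite [RHS](big_cat_nat (n := mmeasure mf b)) ?leq_maxl //= -[LHS]addr0.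
  by congr (_ + _); rewrite big_nat big1 // => i /andP[/vF1].
rewrite (big_cat_nat (n := E.+1)) ?leq_maxr //= -[RHS]addr0.
by congr (_ + _); rewrite big_nat big1 // => i /andP[/vF2].
Qed.

(** The non-constant part of [b] only contributes in degrees above [e]. This reads off constant
    terms of the coefficients of a syzygy. *)
Lemma mcoeff_homogM a b e m : a \is e.-homog for mf -> (forall m, mf m = 0%N -> m = 0%MM) ->
  (mf m <= e)%N -> (b * a)@_m = b@_0 * a@_m.
Proof.
move=> ha mfz me; transitivity (pihomog mf (mf m) (b * a))@_m.
  by rewrite mcoeff_pihomog eqxx.
rewrite (pihomogMhomog _ _ ha); case: (ltngtP e (mf m)) me => // [lt|e'] _.
  by rewrite mul0r mcoeff0 (dhomog_nemf_coeff ha) ?mulr0 // neq_ltn lt.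
rewrite e' subnn (_ : pihomog mf 0 b = (b@_0)%:MP) ?mcoeffCM //.
apply/mpolyP => m'; rewrite mcoeff_pihomog mcoeffC; case: eqP => [/mfz->|ne].
  by rewrite eqxx mulr1.
by case: eqP => [e2|_]; [rewrite e2 mf0 in ne | rewrite mulr0].
Qed.

End Components.

Section CompHomog.
Variables (n l : nat) (R : comNzRingType) (mf : measure n) (mf' : measure l).
Variable q : n.-tuple {mpoly R[l]}.
Hypothesis q_homog : forall i, tnth q i \is (mf U_(i)%MM).-homog for mf'.

Lemma comp_homogX m : 'X_[R, m] \mPo q \is (mf m).-homog for mf'.
Proof.
rewrite comp_mpolyX mfE; elim/big_rec2: _ => [|i p e _ IH]; first exact: dhomog1.
by apply: dhomogM => //; rewrite mulnC; apply: dhomogMn.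
Qed.

Lemma comp_homog D p : p \is D.-homog for mf -> p \mPo q \is D.-homog for mf'.
Proof.
move/dhomogP => hp; rewrite {1}[p]mpolyE raddf_sum big_seq; apply: rpred_sum => m mp /=.
by rewrite comp_mpolyZ; apply: rpredZ; rewrite -(hp _ mp); apply: comp_homogX.
Qed.

Lemma pihomog_comp E p : pihomog mf' E (p \mPo q) = pihomog mf E p \mPo q.
Proof.
elim/mpolyind: p => [|c m p _ _ IH]; first by rewrite !raddf0.
rewrite !raddfD /= IH; congr (_ + _); rewrite !linearZ /= pihomogX; congr (_ *: _).
have hm := comp_homogX m.
case: eqP => [<-|/eqP ne]; first by rewrite pihomog_dE.
by rewrite comp_mpoly0 (pihomog_ne0 _ hm).
Qed.

End CompHomog.

Section Weights.
Variables (n : nat) (d : 'I_n -> nat) (R : comNzRingType).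
Implicit Types p q : {mpoly R[n]}.

Lemma wdegU i : wdeg d U_(i)%MM = d i.
Proof.
rewrite /wdeg (bigD1 i) //= mnm1E eqxx mul1n big1 ?addn0 // => j ne.
by rewrite mnm1E eq_sym (negbTE ne).
Qed.

Lemma homogX i : ('X_i : {mpoly R[n]}) \is (d i).-homog for (wdeg d).
Proof. by rewrite dhomogX; apply/eqP; apply: wdegU. Qed.

Hypothesis d_gt0 : forall i, (0 < d i)%N.

Lemma wdeg_eq0 m : wdeg d m = 0%N -> m = 0%MM.
Proof.
move=> /eqP; rewrite /wdeg sum_nat_eq0 => /forallP m0; apply/mnmP => i; rewrite mnm0E.
by have := m0 i; rewrite muln_eq0 -!leqn0 (leqNgt (d i)) d_gt0 orbF leqn0 => /eqP.
Qed.

Lemma homog0_const p : p \is 0.-homog for (wdeg d) -> p = (p@_0)%:MP.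
Proof.
move=> hp; apply/mpolyP => m; rewrite mcoeffC; case: eqP => [->|ne]; first by rewrite mulr1.
rewrite mulr0 (dhomog_nemf_coeff hp) //; apply/eqP => /wdeg_eq0; exact: ne.
Qed.

Lemma homog_mcoeff0 r p : (0 < r)%N -> p \is r.-homog for (wdeg d) -> p@_0 = 0.
Proof. by move=> r0 hp; rewrite (dhomog_nemf_coeff hp) // mf0 neq_ltn r0. Qed.

Lemma pihomog0_const p : pihomog (wdeg d) 0 p = (p@_0)%:MP.
Proof.
rewrite (homog0_const (pihomogP _ _ _)); congr (_%:MP).
by rewrite mcoeff_pihomog mf0.
Qed.

End Weights.

(** * Linear substitutions and the weight action *)

Section Pullback.
Variables (k : fieldType) (n : nat).
Implicit Types (M N : 'M[k]_n) (p q : {mpoly k[n]}) (a : 'rV[k]_n).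

HB.instance Definition _ M := GRing.LRMorphism.copy (pullback M)
  (comp_mpoly [tuple \sum_(j < n) M i j *: 'X_j | i < n]).

Lemma tnth_pullback M i : tnth [tuple \sum_(j < n) M i j *: 'X_j | i < n] i = lin (row i M).
Proof. by rewrite tnth_mktuple /lin; apply: eq_bigr => j _; rewrite mxE. Qed.

Lemma pullbackC M c : pullback M c%:MP = c%:MP.
Proof. exact: comp_mpolyC. Qed.

Lemma pullbackX M i : pullback M 'X_i = lin (row i M).
Proof. by rewrite /pullback comp_mpolyXt tnth_pullback. Qed.

Lemma pullback_lin M a : pullback M (lin a) = lin (a *m M).
Proof.
rewrite /pullback comp_lin (mulmx_sum_row a M) raddf_sum; apply: eq_bigr => j _.
by rewrite /= tnth_pullback linearZ.
Qed.

Lemma pullbackM M N p : pullback N (pullback M p) = pullback (M *m N) p.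
Proof.
elim/mpoly_alg_ind: p => [c|i|p q e1 e2|p q e1 e2].
- by rewrite !pullbackC.
- by rewrite !pullbackX pullback_lin row_mul.
- by rewrite !raddfD /= e1 e2.
- by rewrite !rmorphM /= e1 e2.
Qed.

Lemma pullback1 p : pullback 1%:M p = p.
Proof.
elim/mpoly_alg_ind: p => [c|i|p q e1 e2|p q e1 e2].
- by rewrite !pullbackC.
- by rewrite pullbackX row1 lin_delta.
- by rewrite raddfD /= e1 e2.
- by rewrite rmorphM /= e1 e2.
Qed.

Lemma pullback_comp r M (q : n.-tuple {mpoly k[r]}) p :
  (pullback M p) \mPo q = p \mPo [tuple \sum_j M i j *: tnth q j | i < n].
Proof.
elim/mpoly_alg_ind: p => [c|i|p1 p2 e1 e2|p1 p2 e1 e2].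
- by rewrite pullbackC !comp_mpolyC.
- rewrite pullbackX comp_lin comp_mpolyXt tnth_mktuple.
  by apply: eq_bigr => j _; rewrite mxE.
- by rewrite raddfD /= !comp_mpolyD e1 e2.
- by rewrite !rmorphM /= e1 e2.
Qed.

Lemma comp_pullback r M (q : r.-tuple {mpoly k[n]}) (p : {mpoly k[r]}) :
  pullback M (p \mPo q) = p \mPo [tuple pullback M (tnth q i) | i < r].
Proof. exact: comp_mpolyA. Qed.

Lemma mderiv_pullback M p j :
  (pullback M p)^`M(j) = \sum_i M i j *: pullback M p^`M(i).
Proof.
rewrite /pullback mderiv_comp; apply: eq_bigr => i _.
by rewrite tnth_pullback mderiv_lin mxE mulrC mul_mpolyC.
Qed.

Lemma meval_pullback M p (v : 'cV[k]_n) :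
  (pullback M p).@[fun i => v i 0] = p.@[fun i => (M *m v) i 0].
Proof.
rewrite /pullback comp_mpoly_meval; apply: meval_eq => i.
by rewrite tnth_pullback meval_lin mxE; apply: eq_bigr => j _; rewrite mxE.
Qed.

Lemma lin_mdeg_homog a : lin a \is 1.-homog for mdeg.
Proof. by apply: rpred_sum => j _; apply: rpredZ; rewrite dhomogX; apply/eqP; apply: mdeg1. Qed.

Lemma msize_pullback M p : (msize (pullback M p) <= msize p)%N.
Proof.
have h i : tnth [tuple \sum_(j < n) M i j *: 'X_j | i < n] i \is (mdeg U_(i)%MM).-homog for mdeg.
  by rewrite tnth_pullback mdeg1 lin_mdeg_homog.
rewrite {1}[p]mpolyE raddf_sum /=; apply: (leq_trans (mmeasure_sum _ _ _ _)).
apply/bigmax_leqP_seq => m mp _; rewrite linearZ /=; apply: (leq_trans (mmeasureZ_le _ _ _)).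
apply: leq_trans (msize_mdeg_lt mp); rewrite mmeasureE; apply/bigmax_leqP_seq => m' mp' _.
by rewrite ltnS; move/dhomogP: (comp_homogX (mf := mdeg) (mf' := mdeg) h m) => ->.
Qed.

Lemma lin_homog d D a : (forall j, a 0 j != 0 -> d j = D) -> lin a \is D.-homog for (wdeg d).
Proof.
move=> aD; apply: rpred_sum => j _; case: (eqVneq (a 0 j) 0) => [->|nz].
  by rewrite scale0r rpred0.
by apply: rpredZ; rewrite -(aD j nz); apply: homogX.
Qed.

(* Commuting with the weight action: the matrix is block diagonal. *)
Definition weight_blocks (d : 'I_n -> nat) M : Prop := forall i j, M i j != 0 -> d j = d i.

Lemma GL_grad_blocks d M : [pchar k] =i pred0 -> GL_grad d M -> weight_blocks d M.
Proof.
move=> ch0 [_ cM] i j nz; have /pcharf0P natr0 := ch0.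
(* One scalar of the torus suffices: distinct powers of 2 stay distinct in characteristic 0. *)
have two0 : (2%:R : k) != 0 by rewrite natr0.
have /matrixP/(_ i j) := cM _ two0; rewrite /weight_action.
rewrite mul_mx_diag mul_diag_mx !mxE mulrC => /(mulIf nz)/eqP.
rewrite -!natrX; wlog le : i j nz / (d i <= d j)%N.
  move=> W; case/orP: (leq_total (d i) (d j)) => le; first exact: W.
  move=> e; apply: esym.
  move: e; rewrite eq_sym -subr_eq0 -natrB ?leq_exp2l // natr0 subn_eq0 leq_exp2l // => ?.
  by apply/eqP; rewrite eqn_leq le andbT.
rewrite -subr_eq0 -natrB ?leq_exp2l // natr0 subn_eq0 leq_exp2l // => ?.
by apply/eqP; rewrite eqn_leq le andbT.
Qed.

Section Blocks.
Variables (d : 'I_n -> nat) (M : 'M[k]_n).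
Hypothesis Md : weight_blocks d M.

Lemma pullback_tuple_homog i :
  tnth [tuple \sum_(j < n) M i j *: 'X_j | i < n] i \is (wdeg d U_(i)%MM).-homog for (wdeg d).
Proof.
rewrite tnth_pullback wdegU; apply: lin_homog => j; rewrite mxE; exact: Md.
Qed.

Lemma pullback_homog D p : p \is D.-homog for (wdeg d) -> pullback M p \is D.-homog for (wdeg d).
Proof. exact: comp_homog pullback_tuple_homog _ _. Qed.

Lemma pihomog_pullback D p : pihomog (wdeg d) D (pullback M p) = pullback M (pihomog (wdeg d) D p).
Proof. exact: pihomog_comp pullback_tuple_homog _ _. Qed.
End Blocks.

End Pullback.

(** * Invariants and Galois polynomials *)

Lemma deriv_prod (R : comNzRingType) (I : eqType) (r : seq I) (F : I -> {poly R}) :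
  uniq r -> (\prod_(i <- r) F i)^`() = \sum_(i <- r) (F i)^`() * \prod_(j <- r | j != i) F j.
Proof.
elim: r => [|i r IH] /=; first by rewrite !big_nil derivC.
case/andP=> ir ur; rewrite !big_cons derivM IH // eqxx /=; congr (_ * _ + _).
  rewrite big_seq [RHS]big_seq_cond; apply: eq_bigl => j; case: eqP => [->|]; rewrite ?andbT //.
  by rewrite (negbTE ir).
rewrite mulr_sumr; apply: eq_big_seq => j jr.
rewrite big_cons (_ : i != j); last by apply: contraNneq ir => ->.
by rewrite mulrCA.
Qed.

Lemma reindex_group (T : Type) (idx : T) (op : Monoid.com_law idx)
    (gT : finGroupType) (K : {group gT}) (F : gT -> T) h :
  h \in K -> \big[op/idx]_(g in K) F (g * h)%g = \big[op/idx]_(g in K) F g.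
Proof.
move=> hK; rewrite [RHS](reindex_inj (mulIg h)) /=; apply: eq_bigl => g.
by rewrite groupMr.
Qed.

Section GaloisPolynomial.
Variables (S : comNzRingType) (gT : finGroupType) (K : {group gT}).
Variable act : gT -> {rmorphism S -> S}.
Hypothesis actM : {in K &, forall g h x, act h (act g x) = act (g * h)%g x}.
Hypothesis act1 : forall x, act 1%g x = x.
Implicit Types x b : S.

(* [lagrange b x] interpolates the conjugates of [x] at the conjugates of [b], *)
(* up to the factor [P'(T)] for [P = galois_poly b].                           *)
Definition galois_poly b := \prod_(g in K) ('X - (act g b)%:P).
Definition lagrange b x : {poly S} :=
  \sum_(g in K) (act g x)%:P * \prod_(h in K | h != g) ('X - (act h b)%:P).
(** This is P'(b) for P = [galois_poly b], by [deriv_eval]; it is nonzero when b has trivial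
    stabilizer in a domain. *)
Definition galois_disc b := \prod_(g in K | g != 1%g) (b - act g b).

Lemma galois_poly_coef_inv b i g : g \in K -> act g (galois_poly b)`_i = (galois_poly b)`_i.
Proof.
move=> gK; rewrite -coef_map; congr (polyseq _)`_i.
rewrite rmorph_prod /= -[RHS](reindex_group _ _ gK); apply: eq_bigr => h hK.
by rewrite rmorphB /= map_polyX map_polyC /= actM.
Qed.

Lemma lagrange_coef_inv b x i g : g \in K -> act g (lagrange b x)`_i = (lagrange b x)`_i.
Proof.
move=> gK; rewrite -coef_map; congr (polyseq _)`_i.
rewrite rmorph_sum /= -[RHS](reindex_group _ _ gK); apply: eq_bigr => h hK.
rewrite rmorphM /= map_polyC /= actM //; congr (_ * _).
rewrite rmorph_prod [RHS](reindex_inj (mulIg g)) /=.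
apply: eq_big => [y|y /andP[yK _]]; first by rewrite groupMr // (inj_eq (mulIg g)).
by rewrite rmorphB /= map_polyX map_polyC /= actM.
Qed.

Lemma lagrange1 b : lagrange b 1 = (galois_poly b)^`().
Proof.
rewrite /galois_poly -big_enum /= deriv_prod ?enum_uniq // big_enum /=.
apply: eq_bigr => g gK; rewrite rmorph1 polyC1 derivXsubC !mul1r.
by rewrite big_enum_cond.
Qed.

Lemma galois_poly_root b g : g \in K -> (galois_poly b).[act g b] = 0.
Proof.
move=> gK; rewrite /galois_poly horner_prod (bigD1 g) //=.
by rewrite hornerXsubC subrr mul0r.
Qed.

Lemma galois_poly_root1 b : (galois_poly b).[b] = 0.
Proof. by rewrite -{2}[b]act1 galois_poly_root. Qed.

Lemma lagrange_eval b x : (lagrange b x).[b] = x * galois_disc b.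
Proof.
rewrite /lagrange horner_sum (bigD1 1%g) ?group1 //= [X in _ + X]big1 ?addr0 => [|g /andP[gK g1]].
  rewrite act1 hornerM hornerC; congr (_ * _); rewrite horner_prod.
  by apply: eq_bigr => g _; rewrite hornerXsubC.
rewrite hornerM horner_prod (bigD1 1%g) /=; last by rewrite group1 eq_sym.
by rewrite act1 hornerXsubC subrr mul0r mulr0.
Qed.

Lemma deriv_eval b : (galois_poly b)^`().[b] = galois_disc b.
Proof. by rewrite -lagrange1 lagrange_eval mul1r. Qed.

Lemma monic_galois_poly b : galois_poly b \is monic.
Proof. by apply: monic_prod => g _; apply: monicXsubC. Qed.

Lemma size_galois_poly b : size (galois_poly b) = #|K|.+1.
Proof. by rewrite /galois_poly -big_enum /= size_prod_XsubC -cardE. Qed.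

End GaloisPolynomial.

Lemma derivation_horner (S : comNzRingType) (D : {additive S -> S}) (P : {poly S}) b :
  (forall x y, D (x * y) = D x * y + x * D y) ->
  D P.[b] = \sum_(i < size P) D P`_i * b ^+ i + P^`().[b] * D b.
Proof.
move=> DM; transitivity ((map_poly D P).[b] + P^`().[b] * D b); last first.
  rewrite (@horner_coef_wide _ (size P)) ?size_poly //; congr (_ + _).
  by apply: eq_bigr => i _; rewrite coef_map.
elim/poly_ind: P => [|p c IH]; first by rewrite raddf0 /= deriv0 !horner0 mul0r raddf0 addr0.
rewrite hornerMXaddC raddfD /= DM IH derivD derivC addr0 derivM derivX mulr1.
rewrite raddfD /= map_polyC /=.
have -> : map_poly D (p * 'X) = map_poly D p * 'X.
  by apply/polyP => i; rewrite coefMX !coef_map coefMX /=; case: (i == 0%N); rewrite ?raddf0.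
by rewrite !hornerE; ring.
Qed.

Section Invariants.
Variables (k : fieldType) (n : nat) (gT : finGroupType) (H : {group gT}).
Variables (rH : mx_representation k H n) (K : {group gT}).
Hypothesis sKH : K \subset H.
Implicit Types (p q : {mpoly k[n]}) (g h : gT).

Local Notation act g := (pullback (rH g)).
Local Notation inv := (invariant_poly rH K).

Lemma actM g h p : g \in H -> h \in H -> act h (act g p) = act (g * h)%g p.
Proof. by move=> gH hH; rewrite pullbackM repr_mxM. Qed.

Lemma act1 p : act 1%g p = p.
Proof. by rewrite repr_mx1 pullback1. Qed.

Lemma inv0 : inv 0. Proof. by move=> g _; rewrite raddf0. Qed.
Lemma invD p q : inv p -> inv q -> inv (p + q).
Proof. by move=> ip iq g gK; rewrite raddfD /= ip ?iq. Qed.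
Lemma invN p : inv p -> inv (- p).
Proof. by move=> ip g gK; rewrite raddfN /= ip. Qed.
Lemma invB p q : inv p -> inv q -> inv (p - q).
Proof. by move=> ip iq; apply: invD => //; apply: invN. Qed.
Lemma invZ c p : inv p -> inv (c *: p).
Proof. by move=> ip g gK; rewrite linearZ /= ip. Qed.
Lemma inv_sum (I : Type) (r : seq I) (P : pred I) (F : I -> {mpoly k[n]}) :
  (forall i, P i -> inv (F i)) -> inv (\sum_(i <- r | P i) F i).
Proof. move=> iF; apply: (big_ind inv) => //; [exact: inv0 | exact: invD]. Qed.

Definition gsum p := \sum_(g in K) act g p.

Lemma gsum_inv p : inv (gsum p).
Proof.
move=> h hK; rewrite raddf_sum /= -[RHS](reindex_group _ _ hK); apply: eq_bigr => g gK.
by rewrite actM // (subsetP sKH).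
Qed.

Lemma gprod_inv p : inv (\prod_(g in K) act g p).
Proof.
move=> h hK; rewrite rmorph_prod /= -[RHS](reindex_group _ _ hK); apply: eq_bigr => g gK.
by rewrite actM // (subsetP sKH).
Qed.

Lemma gsum_id p : inv p -> gsum p = #|K|%:R *: p.
Proof.
move=> ip; rewrite /gsum (eq_bigr (fun=> p)) => [|g gK]; last exact: ip.
by rewrite sumr_const scaler_nat.
Qed.

Lemma gsumMr p q : inv q -> gsum (p * q) = gsum p * q.
Proof.
by move=> iq; rewrite /gsum mulr_suml; apply: eq_bigr => g gK; rewrite rmorphM /= iq.
Qed.

Lemma gsumD p q : gsum (p + q) = gsum p + gsum q.
Proof. by rewrite /gsum -big_split; apply: eq_bigr => g _; rewrite raddfD. Qed.

(** The Reynolds operator: linear over the invariants ([reynMr]) and, in characteristic 0, the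
    identity on them ([reyn_id]). *)
Definition reyn p := #|K|%:R^-1 *: gsum p.

Lemma reyn_is_linear : linear reyn.
Proof.
move=> c p q; rewrite /reyn gsumD scalerDr; congr (_ + _).
rewrite scalerA mulrC -scalerA; congr (_ *: _); rewrite /gsum scaler_sumr.
by apply: eq_bigr => g _; rewrite linearZ.
Qed.
HB.instance Definition _ :=
  GRing.isLinear.Build k {mpoly k[n]} {mpoly k[n]} _ reyn reyn_is_linear.

Lemma reyn_inv p : inv (reyn p).
Proof. by apply: invZ; apply: gsum_inv. Qed.

Lemma reynMr p q : inv q -> reyn (p * q) = reyn p * q.
Proof. by move=> iq; rewrite /reyn gsumMr // scalerAl. Qed.

Hypothesis ch0 : [pchar k] =i pred0.

Lemma card_neq0 : #|K|%:R != 0 :> k.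
Proof. by have /pcharf0P-> := ch0; rewrite -lt0n cardG_gt0. Qed.

Lemma reyn_id p : inv p -> reyn p = p.
Proof. by move=> ip; rewrite /reyn gsum_id // scalerA mulVf ?card_neq0 // scale1r. Qed.

Section Graded.
Variable d : 'I_n -> nat.
Hypothesis rH_graded : forall g, g \in K -> weight_blocks d (rH g).

Lemma inv_pihomog r p : inv p -> inv (pihomog (wdeg d) r p).
Proof. by move=> ip g gK; rewrite -(pihomog_pullback (rH_graded gK)) ip. Qed.

Lemma reyn_homog r p : p \is r.-homog for (wdeg d) -> reyn p \is r.-homog for (wdeg d).
Proof.
move=> hp; apply: rpredZ; apply: rpred_sum => g gK.
exact: pullback_homog (rH_graded gK) _ _ hp.
Qed.

End Graded.

End Invariants.

Section GaloisDifferential.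
Variables (k : fieldType) (n : nat) (gT : finGroupType) (H : {group gT}).
Variables (rH : mx_representation k H n) (K : {group gT}).
Hypothesis sKH : K \subset H.

Definition ract g : {rmorphism {mpoly k[n]} -> {mpoly k[n]}} := pullback (rH g).

Lemma ractM : {in K &, forall g h p, ract h (ract g p) = ract (g * h)%g p}.
Proof. by move=> g h gK hK p; apply: actM; rewrite (subsetP sKH). Qed.

Lemma ract1 p : ract 1%g p = p. Proof. exact: act1. Qed.

Variables (m : nat) (f : m.-tuple {mpoly k[n]}).
Hypothesis f_gens : forall p, invariant_poly rH K p -> exists P, p = P \mPo f.

(* Differentiate [galois_poly b] evaluated at its root [b]. *)
Lemma galois_disc_diff b : exists u : 'I_m -> {mpoly k[n]}, forall j,
  galois_disc K ract b * b^`M(j) = \sum_l u l * (tnth f l)^`M(j).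
Proof.
pose P := galois_poly K ract b.
have cP (i : 'I_(size P)) : exists Q, P`_i = Q \mPo f.
  by apply: f_gens => g gK; apply: (galois_poly_coef_inv ractM).
have [Q QE] := fin_all_exists cP.
exists (fun l => - \sum_i ((Q i)^`M(l) \mPo f) * b ^+ i) => j.
have : mderiv j P.[b] = 0 by rewrite (galois_poly_root1 K ract1) mderiv0.
rewrite (derivation_horner (D := mderiv j)); last exact: mderivM.
rewrite (deriv_eval _ ract1) => /eqP; rewrite addrC addr_eq0 => /eqP->.
under [in RHS]eq_bigr do rewrite mulNr mulr_suml.
rewrite sumrN exchange_big /=; congr (- _); apply: eq_bigr => i _.
rewrite QE mderiv_comp mulr_suml; apply: eq_bigr => l _; by rewrite mulrAC.
Qed.

Definition jac_mx r (h : r.-tuple {mpoly k[n]}) : 'M[{mpoly k[n]}]_(r, n) :=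
  \matrix_(i < r, j < n) (tnth h i)^`M(j).

Definition lin_disc (b : 'rV[k]_n) : {mpoly k[n]} :=
  \prod_(g in K | g != 1%g) lin (b *m (1%:M - rH g)).

Lemma lin_discE b : galois_disc K ract (lin b) = lin_disc b.
Proof.
apply: eq_bigr => g _; by rewrite /= pullback_lin -raddfB mulmxBr mulmx1.
Qed.

(** The differentials of generators of the invariants span all differentials up to discriminants;
    row i treats the linear form [row i u]. *)
Lemma galois_disc_mx (u : 'M[k]_n) : exists U : 'M_(n, m),
  diag_mx (\row_i lin_disc (row i u)) *m map_mx (@mpolyC n k) u = U *m jac_mx f.
Proof.
have [U UE] := fin_all_exists (fun i => galois_disc_diff (lin (row i u))).
exists (\matrix_(i, l) U i l); apply/matrixP => i j.
rewrite mul_diag_mx !mxE -lin_discE; have := UE i j.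
rewrite mderiv_lin !mxE => ->; apply: eq_bigr => l _; by rewrite !mxE.
Qed.

End GaloisDifferential.

(** * Spans and ideals *)

Section Spans.
Variables (R : nzRingType) (M : lmodType R) (S : M -> Prop).

Lemma span_of0 : span_of S 0.
Proof. by exists 0%N, (fun=> 0), (fun=> 0); split; [case | rewrite big_ord0]. Qed.

Lemma span_of_gen x : S x -> span_of S x.
Proof. by move=> Sx; exists 1%N, (fun=> 1), (fun=> x); split=> //; rewrite big_ord1 scale1r. Qed.

Lemma span_ofD x y : span_of S x -> span_of S y -> span_of S (x + y).
Proof.
move=> [r [c [v [Sv ->]]]] [r' [c' [v' [Sv' ->]]]].
exists (r + r')%N, (fun i => match split i with inl j => c j | inr j => c' j end).
exists (fun i => match split i with inl j => v j | inr j => v' j end); split.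
  by move=> i; case: split.
rewrite big_split_ord; congr (_ + _); apply: eq_bigr => i _ /=.
  by rewrite (unsplitK (inl _ i)).
by rewrite (unsplitK (inr _ i)).
Qed.

Lemma span_ofZ a x : span_of S x -> span_of S (a *: x).
Proof.
move=> [r [c [v [Sv ->]]]]; exists r, (fun i => a * c i), v; split=> //.
by rewrite scaler_sumr; apply: eq_bigr => i _; rewrite scalerA.
Qed.

Lemma span_of_sum (I : Type) (r : seq I) (P : pred I) (F : I -> M) :
  (forall i, P i -> span_of S (F i)) -> span_of S (\sum_(i <- r | P i) F i).
Proof. move=> FS; apply: (big_ind (span_of S)) => //; [exact: span_of0 | exact: span_ofD]. Qed.

Lemma span_of_ind (Q : M -> Prop) :
  Q 0 -> (forall x y, Q x -> Q y -> Q (x + y)) -> (forall a x, S x -> Q (a *: x)) ->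
  forall x, span_of S x -> Q x.
Proof.
move=> Q0 QD QZ x [r [c [v [Sv ->]]]]; apply: (big_ind Q) => // i _; exact: QZ.
Qed.

End Spans.

Section Ideals.
Variables (R : comNzRingType) (S : R -> Prop).
Implicit Types x y a : R.

Lemma ideal_of0 : ideal_of S 0. Proof. exact: (@span_of0 R R^o). Qed.
Lemma ideal_of_gen x : S x -> ideal_of S x. Proof. exact: (@span_of_gen R R^o). Qed.
Lemma ideal_ofD x y : ideal_of S x -> ideal_of S y -> ideal_of S (x + y).
Proof. exact: (@span_ofD R R^o). Qed.
Lemma ideal_ofM a x : ideal_of S x -> ideal_of S (a * x).
Proof. exact: (@span_ofZ R R^o). Qed.
Lemma ideal_ofB x y : ideal_of S x -> ideal_of S y -> ideal_of S (x - y).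
Proof. by move=> xS yS; apply: ideal_ofD => //; rewrite -mulN1r; apply: ideal_ofM. Qed.
Lemma ideal_of_sum (I : Type) (r : seq I) (P : pred I) (F : I -> R) :
  (forall i, P i -> ideal_of S (F i)) -> ideal_of S (\sum_(i <- r | P i) F i).
Proof. exact: (@span_of_sum R R^o). Qed.
Lemma ideal_of_ind (Q : R -> Prop) :
  Q 0 -> (forall x y, Q x -> Q y -> Q (x + y)) -> (forall a x, S x -> Q (a * x)) ->
  forall x, ideal_of S x -> Q x.
Proof. exact: (@span_of_ind R R^o). Qed.

End Ideals.

Lemma ideal_of_sub (R : comNzRingType) (S T : R -> Prop) x :
  (forall y, S y -> ideal_of T y) -> ideal_of S x -> ideal_of T x.
Proof.
move=> ST; move: x; apply: (ideal_of_ind (Q := ideal_of T)) => [|y z|a y /ST]; [exact: ideal_of0 | exact: ideal_ofD | exact: ideal_ofM].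
Qed.

Lemma ideal_of_fin (R : comNzRingType) r (g : 'I_r -> R) x :
  ideal_of (fun y => exists i, y = g i) x -> exists c, x = \sum_i c i * g i.
Proof.
move: x; apply: (ideal_of_ind (Q := fun x => exists c, x = \sum_i c i * g i)) => [|y z [c ->] [c' ->]|a y [i ->]].
- by exists (fun=> 0); rewrite big1 // => i _; rewrite mul0r.
- exists (fun i => c i + c' i); rewrite -big_split; apply: eq_bigr => i _; by rewrite /= mulrDl.
- exists (fun j => a * (j == i)%:R); rewrite (bigD1 i) //= eqxx mulr1 big1 ?addr0 // => j ne.
  by rewrite (negbTE ne) mulr0 mul0r.
Qed.

(** * Matrices over a domain, avoidance of lines, and derivatives in characteristic 0 *)

Section DomainMatrices.
Variable R : idomainType.

(** If n < r, padding [A] by zero columns gives a square matrix of determinant 0, hence a nonzero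
    vector in the left kernel. *)
Lemma left_cancel_leq r n (A : 'M[R]_(r, n)) :
  (forall a : 'rV_r, a *m A = 0 -> a = 0) -> (r <= n)%N.
Proof.
move=> injA; rewrite leqNgt; apply/negP => nr.
pose B : 'M_r := \matrix_(i, j) (if insub (j : nat) is Some j' then A i j' else 0).
have zc i : B i (Ordinal nr) = 0 by rewrite mxE insubF // ltnn.
have : \det B == 0.
  rewrite (expand_det_col _ (Ordinal nr)) big1 // => i _; by rewrite zc mul0r.
case/det0P => v v0 vB; case/eqP: v0; apply: injA; apply/rowP => j.
have jr : (j < r)%N by apply: ltn_trans (ltn_ord j) nr.
have /rowP/(_ (Ordinal jr)) := vB; rewrite !mxE => e; rewrite -[RHS]e; apply: eq_bigr => i _.
by rewrite mxE insubT //= => lt; congr (_ * A _ _); apply: val_inj.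
Qed.

Lemma left_cancel_det n (A : 'M[R]_n) : \det A != 0 -> forall a : 'rV_n, a *m A = 0 -> a = 0.
Proof.
move=> dA a aA; apply/eqP/negPn/negP => a0; case/negP: dA; apply/det0P; by exists a.
Qed.

End DomainMatrices.

Lemma avoid_basis_sub (k : fieldType) n (T : finType) (M : T -> 'M[k]_n) (a : T -> 'rV[k]_n) :
  [pchar k] =i pred0 -> (forall t, ~~ (M t <= a t)%MS) ->
  exists2 u : 'M[k]_n, u \in unitmx & forall i t, ~~ (row i u *m M t <= a t)%MS.
Proof.
move=> ch0 Ma; have [l lP] := fin_all_exists (fun t => let: ex_intro2 l l0 lb := avoid_functional (Ma t) in ex_intro _ l (conj l0 lb)).
have [u uu uP] := avoid_basis ch0 (fun t => (lP t).1).
exists u => // i t; apply: contra (uP i t) => /(lP t).2 ->; exact: eqxx.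
Qed.

Lemma avoid_vector_sub (k : fieldType) n (T : finType) (M : T -> 'M[k]_n) (a : T -> 'rV[k]_n) :
  [pchar k] =i pred0 -> (forall t, ~~ (M t <= a t)%MS) ->
  exists u : 'rV[k]_n, forall t, ~~ (u *m M t <= a t)%MS.
Proof.
move=> ch0 Ma; have [l lP] := fin_all_exists (fun t => let: ex_intro2 l l0 lb := avoid_functional (Ma t) in ex_intro _ l (conj l0 lb)).
have [u uP] := avoid_vector ch0 (fun t => (lP t).1).
exists u => t; apply: contra (uP t) => /(lP t).2 ->; exact: eqxx.
Qed.

Section CharZeroDerivatives.
Variables (k : fieldType) (ch0 : [pchar k] =i pred0).

Lemma natr_eq0 (s : nat) : (s%:R == 0 :> k) = (s == 0%N).
Proof. by have /pcharf0P-> := ch0. Qed.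

Lemma mderiv_eq0 n (p : {mpoly k[n]}) : (forall j, p^`M(j) = 0) -> p = (p@_0)%:MP.
Proof.
move=> dp; apply/mpolyP => m; rewrite mcoeffC; case: eqP => [->|/eqP ne]; first by rewrite mulr1.
rewrite mulr0; have [j mj] : exists j, m j != 0%N.
  apply/existsP; rewrite -negb_forall; apply: contra ne => /forallP m0.
  by apply/eqP/mnmP => j; rewrite mnm0E; apply/eqP.
have := mcoeff_mderiv j p (m - U_(j))%MM; rewrite dp mcoeff0 submK; last by rewrite lep1mP.
by move/esym/eqP; rewrite -mulr_natr mulf_eq0 natr_eq0 orbF => /eqP.
Qed.

Lemma msize_mderiv n (p : {mpoly k[n]}) j : p != 0 -> (msize p^`M(j) < msize p)%N.
Proof.
move=> p0; have sp : (0 < msize p)%N by rewrite lt0n msize_poly_eq0.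
rewrite -(prednK sp) ltnS mmeasureE; apply/bigmax_leqP_seq => m mp _.
rewrite -ltnS (prednK sp); apply: leq_trans (msize_mdeg_lt (m := (m + U_(j))%MM) _).
  by rewrite mdegD mdeg1 addn1.
move: mp; rewrite !mcoeff_msupp mcoeff_mderiv; apply: contra => /eqP->.
by rewrite mul0rn.
Qed.

(** Jacobian criterion. Differentiating a relation and cancelling the Jacobian matrix makes every
    partial derivative a relation of smaller degree, so by induction the relation is constant. *)
Lemma jacobian_alg_indep n (h : n.-tuple {mpoly k[n]}) : jacobian h != 0 -> alg_indep h.
Proof.
move=> J0 P; have [N] := ubnP (msize P); elim: N P => // N IH P; rewrite ltnS => sP Ph.
have [->//|P0] := eqVneq P 0.
have dP i : P^`M(i) = 0.
  apply: IH; first exact: leq_trans (msize_mderiv _ P0) sP.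
  have /(left_cancel_det J0)/rowP/(_ i) : (\row_i (P^`M(i) \mPo h)) *m
      (\matrix_(i < n, j < n) (tnth h i)^`M(j)) = 0.
    apply/rowP => j; rewrite !mxE; have := mderiv_comp P h j; rewrite Ph mderiv0 => e.
    by rewrite [RHS]e; apply: eq_bigr => l _; rewrite !mxE.
  by rewrite !mxE.
move: Ph; rewrite (mderiv_eq0 dP) comp_mpolyC => /eqP; rewrite mpolyC_eq0 => /eqP->.
by rewrite mpolyC0.
Qed.

Lemma euler n (d : 'I_n -> nat) D (p : {mpoly k[n]}) : p \is D.-homog for (wdeg d) ->
  \sum_j (d j)%:R *: ('X_j * p^`M(j)) = D%:R *: p.
Proof.
move/dhomogP => hp; rewrite {2}[p]mpolyE scaler_sumr {1}[p]mpolyE.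
under eq_bigr do rewrite raddf_sum mulr_sumr scaler_sumr.
rewrite exchange_big /= big_seq [RHS]big_seq; apply: eq_bigr => m mp.
rewrite -(hp m mp) /= /wdeg natr_sum scaler_suml; apply: eq_bigr => j _.
rewrite mderivZ mderivX -!scalerAr !scalerA natrM.
have [e|ne] := eqVneq (m j) 0%N; first by rewrite e !(mulr0, mul0r, scale0r).
by rewrite -mpolyXD addmC submK ?lep1mP //; congr (_ *: _); ring.
Qed.

(** The factor ['X_j] restores the degree lost by differentiation and avoids the truncated
    difference [D - d j]. *)
Lemma homog_Xderiv n (d : 'I_n -> nat) D (p : {mpoly k[n]}) j :
  p \is D.-homog for (wdeg d) -> 'X_j * p^`M(j) \is D.-homog for (wdeg d).
Proof.
move/dhomogP => hp; rewrite [p]mpolyE raddf_sum mulr_sumr big_seq; apply: rpred_sum => m mp /=.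
rewrite mderivZ mderivX -!scalerAr; apply: rpredZ.
have [e|ne] := eqVneq (m j) 0%N; first by rewrite e scale0r rpred0.
by apply: rpredZ; rewrite -mpolyXD addmC submK ?lep1mP // dhomogX; apply/eqP/hp.
Qed.

End CharZeroDerivatives.

(** * The Chevalley-Shephard-Todd theorem *)

Lemma fix_codimE (k : fieldType) n (M : 'M[k]_n) : fix_codim M = \rank (M - 1%:M).
Proof. by rewrite /fix_codim mxrank_ker mxrank_tr subKn // rank_leq_row. Qed.

Lemma rank1_factor (k : fieldType) m n (A : 'M[k]_(m, n)) : \rank A = 1%N ->
  exists (u : 'cV_m) (a : 'rV_n), [/\ u != 0, a != 0 & A = u *m a].
Proof.
move=> rA; have A0 : A != 0 by rewrite -mxrank_eq0 rA.
have /matrix0Pn[i [j Aij]] := A0.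
have a0 : row i A != 0 by apply/rV0Pn; exists j; rewrite mxE.
have /submxP[u Au] : (A <= row i A)%MS.
  by rewrite -(geq_leqif (mxrank_leqif_sup (row_sub i A))) rA lt0n mxrank_eq0.
exists u, (row i A); split=> //; apply: contraNneq A0 => u0; by rewrite Au u0 mul0mx.
Qed.

Lemma submx_row0 (k : fieldType) m n (A : 'M[k]_(m, n)) : (A <= (0 : 'rV_n))%MS = (A == 0).
Proof. by apply/submxP/eqP => [[D ->]|->]; [rewrite mulmx0 | exists 0; rewrite mulmx0]. Qed.

(** [M] and [N] agree on the hyperplane of [a], so the two pullbacks have the same restriction to
    it. *)
Lemma pullback_sub_dvd (k : fieldType) n (M N : 'M[k]_n) (a : 'rV[k]_n) p :
  (M - N <= a)%MS -> dvdm (lin a) (pullback M p - pullback N p).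
Proof.
move=> Ma; have [c e] := comp_mpoly_sub p
  [tuple \sum_(j < n) M i j *: 'X_j | i < n] [tuple \sum_(j < n) N i j *: 'X_j | i < n].
rewrite /pullback e; apply: dvdm_sum => i _; apply: dvdm_mull.
rewrite !tnth_pullback -raddfB -[row i M - _]raddfB; apply: sub_lin_dvd.
exact: submx_trans (row_sub _ _) Ma.
Qed.

Lemma gen_ind (gT : finGroupType) (A : {set gT}) (P : gT -> Prop) :
  P 1%g -> (forall x a, x \in <<A>>%g -> a \in A -> P x -> P (x * a)%g) ->
  forall x, x \in <<A>>%g -> P x.
Proof.
move=> P1 PM x /gen_prodgP[r [c cA ->]]; elim: r c cA => [|r IH] c cA; first by rewrite big_ord0.
rewrite big_ord_recr /=; apply: PM => //; last exact: IH.
by apply: group_prod => i _; apply: mem_gen.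
Qed.

Section AlgebraGeneration.
Variables (k : fieldType) (n : nat) (d : 'I_n -> nat) (d_gt0 : forall i, (0 < d i)%N).
Variable (S : {mpoly k[n]} -> Prop).
Hypothesis S_pihomog : forall r p, S p -> S (pihomog (wdeg d) r p).
Variables (r : nat) (h : r.-tuple {mpoly k[n]}) (D : 'I_r -> nat).
Hypothesis D_gt0 : forall i, (0 < D i)%N.
Hypothesis h_homog : forall i, tnth h i \is (D i).-homog for (wdeg d).

Lemma polynomial_in_gens_homog :
  (forall E p, (0 < E)%N -> S p -> p \is E.-homog for (wdeg d) ->
     (forall E' q, (E' < E)%N -> S q -> q \is E'.-homog for (wdeg d) -> exists P, q = P \mPo h) ->
     exists P, p = P \mPo h) ->
  forall p, S p -> exists P, p = P \mPo h.
Proof.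
move=> step.
have hom E : forall p, S p -> p \is E.-homog for (wdeg d) -> exists P, p = P \mPo h.
  elim/ltn_ind: E => E IH p Sp hp; have [E0|E0] := posnP E.
    by rewrite E0 in hp; exists (p@_0)%:MP; rewrite comp_mpolyC; apply: homog0_const d_gt0 _ hp.
  by apply: (step E) => // E' q lt; apply: IH.
move=> p Sp; have [Q QE] := fin_all_exists (fun i : 'I_(mmeasure (wdeg d) p) =>
  hom i _ (S_pihomog i Sp) (pihomogP _ _ _)).
exists (\sum_i Q i); rewrite raddf_sum /= {1}(homog_split (leqnn (mmeasure (wdeg d) p))).
by apply: eq_bigr => i _; apply: QE.
Qed.

(** Generators of the ideal generate the algebra: in the component of degree E, each coefficient has
    degree E - D i < E, and induction applies to it. *)
Lemma polynomial_in_gens :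
  (forall E p, (0 < E)%N -> S p -> p \is E.-homog for (wdeg d) ->
     exists c : 'I_r -> {mpoly k[n]}, (forall i, S (c i)) /\ p = \sum_i c i * tnth h i) ->
  forall p, S p -> exists P, p = P \mPo h.
Proof.
move=> gens; apply: polynomial_in_gens_homog => E p E0 Sp hp IH.
have [c [Sc pE]] := gens E p E0 Sp hp.
have cP i : exists Q, (if (D i <= E)%N then pihomog (wdeg d) (E - D i) (c i) else 0) = Q \mPo h.
  case: leqP => DE; last by exists 0; rewrite comp_mpoly0.
  apply: (IH (E - D i)%N); [by rewrite ltn_subrL D_gt0 | exact: S_pihomog | exact: pihomogP].
have [Q QE] := fin_all_exists cP; exists (\sum_i Q i * 'X_i).
rewrite -(pihomog_dE hp) pE !raddf_sum /=; apply: eq_bigr => i _.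
by rewrite (pihomogMhomog _ _ (h_homog i)) QE rmorphM /= comp_mpolyXt.
Qed.

End AlgebraGeneration.

Section Chevalley.
Variables (k : fieldType) (ch0 : [pchar k] =i pred0).
Variables (n : nat) (d : 'I_n -> nat) (d_gt0 : forall i, (0 < d i)%N).
Variables (gT : finGroupType) (H : {group gT}) (rH : mx_representation k H n).
Hypothesis rH_faithful : mx_faithful rH.
Hypothesis rH_graded : forall g, g \in H -> weight_blocks d (rH g).
Local Notation act g := (pullback (rH g)).
Local Notation inv := (invariant_poly rH H).
Implicit Types p q : {mpoly k[n]}.
Let sHH : H \subset H := subxx H.

Lemma act_inj g : g \in H -> injective (act g).
Proof.
move=> gH; have actK p : act g^-1%g (act g p) = p.
  by rewrite (actM rH p gH) ?groupV // mulgV act1.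
exact: can_inj actK.
Qed.

Lemma faithful_neq g h : g \in H -> h \in H -> g != h -> rH g - rH h != 0.
Proof.
move=> gH hH; rewrite subr_eq0; apply: contraNneq => e.
have /(subsetP rH_faithful) : (g * h^-1)%g \in rker rH.
  rewrite inE groupM ?groupV //= repr_mxM ?groupV // e -repr_mxM ?groupV // mulgV repr_mx1.
  by rewrite mul1mx.
by rewrite inE -eq_mulgV1.
Qed.

Lemma lin_disc_avoid (K : {group gT}) : K \subset H ->
  exists2 u : 'M[k]_n, u \in unitmx & forall i, lin_disc rH K (row i u) != 0.
Proof.
move=> sKH; pose T := {g | (g \in K) && (g != 1%g)}.
have [|u uu uP] := @avoid_basis_sub k n T (fun t => 1%:M - rH (val t)) (fun=> 0) ch0.
  case=> g gP; have /andP[gK g1] := gP; rewrite submx_row0 /= -(repr_mx1 rH).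
  by apply: faithful_neq; rewrite ?(subsetP sKH) // eq_sym.
exists u => // i; apply/prodf_neq0 => g gP; rewrite lin_eq0 -submx_row0.
exact: (uP i (Sub g gP)).
Qed.

(** For a suitable basis [u], the Jacobian matrix of [h] is a right factor of a matrix with nonzero
    determinant, by [galois_disc_mx]. *)
Lemma polynomial_gens_jacobian (h : n.-tuple {mpoly k[n]}) :
  (forall p, inv p -> exists P, p = P \mPo h) -> jacobian h != 0.
Proof.
move=> gens; have [u uu u0] := lin_disc_avoid sHH.
have [U /(congr1 determinant)] := galois_disc_mx sHH gens u.
rewrite !det_mulmx det_diag det_map_mx /= => e; apply/eqP => J0.
move: e; rewrite (_ : \det (jac_mx h) = 0) // mulr0 => /eqP; rewrite mulf_eq0 mpolyC_eq0.
case/orP => [|/eqP d0]; last by move: uu; rewrite unitmxE unitfE d0 eqxx.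
by apply/negP/prodf_neq0 => i _; rewrite mxE.
Qed.

(** The Hilbert ideal of [H]; [low_ideal E] is the ideal generated by its homogeneous invariants of
    degree below E. *)
Definition inv_ideal := ideal_of (fun q => inv q /\ q@_0 = 0).
Definition low_ideal E := ideal_of (fun q => inv q /\
  exists2 r, (0 < r < E)%N & q \is r.-homog for (wdeg d)).

Lemma inv_ideal_act g p : g \in H -> inv_ideal p -> inv_ideal (act g p).
Proof.
move=> gH; move: p; apply: (ideal_of_ind (Q := fun p => inv_ideal (act g p))).
- by rewrite raddf0; apply: ideal_of0.
- by move=> p q; rewrite raddfD /=; apply: ideal_ofD.
- by move=> a q [iq q0]; rewrite rmorphM /= (iq g gH); apply/ideal_ofM/ideal_of_gen.
Qed.

(** The factor [b] contributes positive degree, so an invariant entering the component of degree E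
    has degree below E. *)
Lemma inv_ideal_low E p b : b@_0 = 0 -> inv_ideal p -> low_ideal E (pihomog (wdeg d) E (b * p)).
Proof.
move=> b0 Ip; move: p Ip b b0.
apply: (ideal_of_ind (Q := fun p => forall b, b@_0 = 0 -> low_ideal E (pihomog (wdeg d) E (b * p)))).
- by move=> b _; rewrite mulr0 raddf0; apply: ideal_of0.
- by move=> p q Ip Iq b b0; rewrite mulrDr raddfD /=; apply: ideal_ofD; [apply: Ip | apply: Iq].
move=> a q [iq q0] b b0; rewrite mulrA; set c := b * a.
have c0 : c@_0 = 0 by rewrite /c rmorphM /= b0 mul0r.
rewrite pihomogM; apply: ideal_of_sum => r _.
have [r0|r0] := posnP r.
  by rewrite r0 (pihomog0_const d_gt0) q0 mpolyC0 mulr0; apply: ideal_of0.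
have [rE|rE] := eqVneq (r : nat) E.
  by rewrite rE subnn (pihomog0_const d_gt0) c0 mpolyC0 mul0r; apply: ideal_of0.
apply/ideal_ofM/ideal_of_gen; split; first exact: inv_pihomog.
exists r; last exact: pihomogP.
by rewrite r0 ltn_neqAle rE -ltnS ltn_ord.
Qed.

Variable A : {set gT}.
Hypothesis A_refl : forall s, s \in A -> \rank (rH s - 1%:M) = 1%N.
Hypothesis A_gen : <<A>>%g = H.

Lemma A_sub s : s \in A -> s \in H.
Proof. by move=> sA; rewrite -A_gen mem_gen. Qed.

(** Chevalley's lemma. For a reflection s, dividing (s - 1) of the relation by the form of its
    hyperplane yields a relation of smaller degree. By induction [H] therefore fixes [u t0] modulo
    the Hilbert ideal, and [u t0] is congruent to its average, whose constant term vanishes by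
    hypothesis. *)
Lemma chevalley_syzygy N (T : finType) (t0 : T) (a u : T -> {mpoly k[n]}) :
  (forall t, inv (a t)) ->
  (forall b, (forall t, inv (b t)) -> \sum_t b t * a t = 0 -> (b t0)@_0 = 0) ->
  \sum_t u t * a t = 0 -> (msize (u t0) < N)%N -> inv_ideal (u t0).
Proof.
move=> ia indep; elim: N u => // N IH u rel; rewrite ltnS => su.
have refl s : s \in A -> inv_ideal (act s (u t0) - u t0).
  move=> sA; have sH := A_sub sA.
  have [v [l [_ l0 sE]]] := rank1_factor (A_refl sA).
  have dv t : exists q, act s (u t) - u t = q * lin l.
    rewrite -{2}(pullback1 (u t)); apply: pullback_sub_dvd.
    by rewrite sE submxMl.
  have [D DE] := fin_all_exists dv.
  rewrite DE mulrC; apply: ideal_ofM.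
  have [->|D0] := eqVneq (D t0) 0; first exact: ideal_of0.
  apply: IH.
    apply: (mulIf (x := lin l)); rewrite ?lin_eq0 // mul0r mulr_suml.
    transitivity (act s (\sum_t u t * a t) - \sum_t u t * a t); last by rewrite rel raddf0 subrr.
    rewrite raddf_sum -sumrB; apply: eq_bigr => t _ /=.
    by rewrite rmorphM /= (ia t s sH) -mulrBl DE mulrAC.
  apply: leq_trans su; have : (msize (D t0 * lin l) <= msize (u t0))%N.
    rewrite -DE; apply: leq_trans (mmeasureD_le _ _ _) _.
    by rewrite mmeasureN geq_max msize_pullback leqnn.
  have /dhomog_msize := lin_mdeg_homog l.
  have ls : msize (lin l) = 2%N.
    have /row_neq0_ex[j lj] := l0; apply/eqP; rewrite eqn_leq; apply/andP; split.
      rewrite mmeasureE; apply/bigmax_leqP_seq => m mp _.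
      by rewrite (dhomog_mf (lin_mdeg_homog l) mp).
    by have := @msize_mdeg_lt _ _ (lin l) U_(j)%MM; rewrite mcoeff_msupp mcoeff_lin mdeg1; apply.
  by rewrite msizeM ?lin_eq0 // ls addn2.
have grp g : g \in H -> inv_ideal (act g (u t0) - u t0).
  move=> gH; have : g \in <<A>>%g by rewrite A_gen.
  move: g {gH}; apply: gen_ind => [|x s xA sA IHx].
    by rewrite act1 subrr; apply: ideal_of0.
  have xH : x \in H by rewrite -A_gen.
  have sH := A_sub sA.
  rewrite -(actM rH (u t0) xH sH) -(subrK (act s (u t0)) (act s _)) -addrA -raddfB.
  by apply: ideal_ofD; [apply: inv_ideal_act | apply: refl].
have R : inv_ideal (reyn rH H (u t0) - u t0).
  have -> : reyn rH H (u t0) - u t0 = (#|H|%:R^-1)%:MP * \sum_(g in H) (act g (u t0) - u t0).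
    rewrite mul_mpolyC sumrB sumr_const scalerBr -scaler_nat scalerA.
    by rewrite mulVf ?card_neq0 // scale1r.
  by apply: ideal_ofM; apply: ideal_of_sum => g gH; apply: grp.
rewrite -[u t0](subKr (reyn rH H (u t0))); apply: ideal_ofB => //.
apply: ideal_of_gen; split; first exact: reyn_inv.
apply: (indep (fun t => reyn rH H (u t))) => [t|]; first exact: reyn_inv.
transitivity (reyn rH H (\sum_t u t * a t)); last by rewrite rel raddf0.
by rewrite raddf_sum; apply: eq_bigr => t _; rewrite /= reynMr.
Qed.

End Chevalley.

Section LowIndependence.
Variables (k : fieldType) (ch0 : [pchar k] =i pred0).
Variables (n : nat) (d : 'I_n -> nat) (d_gt0 : forall i, (0 < d i)%N).
Variables (gT : finGroupType) (H : {group gT}) (rH : mx_representation k H n).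
Hypothesis rH_faithful : mx_faithful rH.
Hypothesis rH_graded : forall g, g \in H -> weight_blocks d (rH g).
Local Notation act g := (pullback (rH g)).
Local Notation inv := (invariant_poly rH H).
Local Notation low_ideal := (low_ideal d rH).
Implicit Types p q : {mpoly k[n]}.

Variable A : {set gT}.
Hypothesis A_refl : forall s, s \in A -> \rank (rH s - 1%:M) = 1%N.
Hypothesis A_gen : <<A>>%g = H.

(** Degree by degree, the classes of the [h i] are linearly independent modulo the ideal of
    lower-degree invariants, as for part of a minimal system of homogeneous generators of the
    Hilbert ideal. *)
Definition low_independent r (h : 'I_r -> {mpoly k[n]}) (D : 'I_r -> nat) :=
  [/\ forall i, inv (h i),
  forall i, (0 < D i)%N, forall i, h i \is (D i).-homog for (wdeg d)
  & forall E (c : 'I_r -> k), low_ideal E (\sum_(i | D i == E) c i *: h i) ->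
      forall i, D i = E -> c i = 0].

Section Independence.
Variables (r : nat) (h : 'I_r -> {mpoly k[n]}) (D : 'I_r -> nat).
Hypothesis indep_h : low_independent h D.
Let inv_h : forall i, inv (h i). Proof. by case: indep_h. Qed.
Let D_gt0 : forall i, (0 < D i)%N. Proof. by case: indep_h. Qed.
Let h_homog : forall i, h i \is (D i).-homog for (wdeg d). Proof. by case: indep_h. Qed.

Let syz (a : 'I_r -> {mpoly k[n]}) := forall j, \sum_i a i * (h i)^`M(j) = 0.

Let syz_act g a : g \in H -> syz a -> syz (fun i => act g (a i)).
Proof.
move=> gH sa j; transitivity (\sum_l rH g l j *: act g (\sum_i a i * (h i)^`M(l))); last first.
  by rewrite big1 // => l _; rewrite sa raddf0 scaler0.
under [RHS]eq_bigr do rewrite (raddf_sum (act g)) /= scaler_sumr.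
rewrite exchange_big; apply: eq_bigr => i _ /=.
rewrite -{1}(inv_h i gH) mderiv_pullback mulr_sumr; apply: eq_bigr => l _.
by rewrite rmorphM /= scalerAr.
Qed.

Let syz_reyn x a : syz a -> syz (fun i => reyn rH H (x * a i)).
Proof.
move=> sa j; rewrite /reyn /gsum.
under eq_bigr do rewrite -scalerAl mulr_suml.
rewrite -scaler_sumr exchange_big /= big1 ?scaler0 // => g gH.
under eq_bigr do rewrite rmorphM /= -mulrA.
by rewrite -mulr_sumr (syz_act gH sa) mulr0.
Qed.

Let part E (b : 'I_r -> {mpoly k[n]}) i :=
  if (D i <= E)%N then pihomog (wdeg d) (E - D i) (b i) else 0.

Let syz_part E b : syz b -> syz (part E b).
Proof.
move=> sb j; apply: (mulfI (x := 'X_j)); first by rewrite -lin_delta lin_eq0; apply/rV0Pn; exists j; rewrite mxE !eqxx oner_eq0.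
rewrite mulr0 mulr_sumr; transitivity (pihomog (wdeg d) E ('X_j * \sum_i b i * (h i)^`M(j))).
  rewrite mulr_sumr raddf_sum; apply: eq_bigr => i _ /=.
  by rewrite mulrCA [in RHS]mulrCA (pihomogMhomog _ _ (homog_Xderiv j (h_homog i))).
by rewrite sb mulr0 raddf0.
Qed.

(* The top-degree members of the family carry the coefficients of least       *)
(* degree in a homogeneous syzygy; reading them off at one monomial [m0]      *)
(* turns the syzygy into one to which [chevalley_syzygy] applies.             *)
Let homog_syz E a : (forall i, inv (a i)) -> syz a ->
  (forall i, if (D i <= E)%N then a i \is (E - D i).-homog for (wdeg d) else a i == 0) ->
  forall i, a i = 0.
Proof.
move=> ia sa ha i0; apply/eqP/negPn/negP => ai0.
pose i1 := [arg max_(i > i0 | a i != 0) D i].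
have [ai1 max1] : a i1 != 0 /\ forall j, a j != 0 -> (D j <= D i1)%N.
  by rewrite /i1; case: arg_maxnP.
have D1E : (D i1 <= E)%N by have := ha i1; case: leqP ai1 => // _ /negbTE->.
pose m0 := mlead (a i1).
have m0a : (a i1)@_m0 != 0 by rewrite -mcoeff_msupp mlead_supp.
have wm0 : wdeg d m0 = (E - D i1)%N.
  by have := ha i1; rewrite D1E => /dhomogP; apply; rewrite mcoeff_msupp.
pose gam t := if D t == D i1 then (a t)@_m0 / (a i1)@_m0 else 0.
have gam1 : gam i1 = 1 by rewrite /gam eqxx divff.
pose al t := if t == i1 then a i1 else a t - gam t *: a i1.
have al_low t : exists2 e, (wdeg d m0 <= e)%N & al t \is e.-homog for (wdeg d).
  rewrite wm0 /al; have h1 : a i1 \is (E - D i1).-homog for (wdeg d) by have := ha i1; rewrite D1E.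
  case: eqP => _; first by exists (E - D i1)%N.
  have [at0|at0] := eqVneq (a t) 0.
    by exists (E - D i1)%N; rewrite // at0 sub0r rpredN rpredZ.
  have DtE : (D t <= E)%N by have := ha t; case: leqP at0 => // _ /negbTE->.
  have ht : a t \is (E - D t).-homog for (wdeg d) by have := ha t; rewrite DtE.
  exists (E - D t)%N; first by rewrite leq_sub2l // max1.
  rewrite /gam; case: eqP => [e|_]; last by rewrite scale0r subr0.
  by rewrite e in ht *; rewrite rpredB // rpredZ.
have al_m0 t : t != i1 -> (al t)@_m0 = 0.
  move=> ne; rewrite /al (negbTE ne) mcoeffB mcoeffZ /gam.
  case: eqP => [_|neD]; first by rewrite divfK ?subrr.
  rewrite mul0r subr0; have [->|at0] := eqVneq (a t) 0; first by rewrite mcoeff0.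
  have DtE : (D t <= E)%N by have := ha t; case: leqP at0 => // _ /negbTE->.
  have ht : a t \is (E - D t).-homog for (wdeg d) by have := ha t; rewrite DtE.
  rewrite (dhomog_nemf_coeff ht) //.
  apply/eqP => e; apply: neD; have : wdeg d m0 = (E - D t)%N := e.
  by rewrite wm0 => e2; rewrite -(subKn DtE) -e2 subKn.
(* The multiples of [a i1] subtracted in [al] are collected in the coefficient of index [i1], so the
   syzygy itself is unchanged. *)
pose u j t := if t == i1 then \sum_s gam s *: (h s)^`M(j) else (h t)^`M(j).
have rel j : \sum_t u j t * al t = 0.
  transitivity (\sum_i a i * (h i)^`M(j)); last exact: sa.
  rewrite (bigD1 i1) //= [RHS](bigD1 i1) //= /u /al !eqxx.
  rewrite [X in _ + X = _](eq_bigr (fun t => a t * (h t)^`M(j) - (gam t *: (h t)^`M(j)) * a i1)); last first.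
    by move=> t /negbTE->; rewrite mulrBr mulrC -scalerAr -scalerAl.
  rewrite sumrB -mulr_suml [X in X * _](bigD1 i1) //= gam1 scale1r.
  by set X := \sum_(i < r | _) _; set Y := \sum_(i < r | _) _; ring.
have ideal_u j : inv_ideal rH (u j i1).
  apply: (chevalley_syzygy (A := A) ch0 A_refl A_gen (a := al) _ _ (rel j) (ltnSn _)).
    by move=> t; rewrite /al; case: eqP => // _; apply: invB => //; apply: invZ.
  move=> b ib /(congr1 (mcoeff m0)); rewrite raddf_sum mcoeff0 (bigD1 i1) //= big1 => [|t ne].
    have [e le he] := al_low i1.
    rewrite addr0 (mcoeff_homogM (b i1) he (wdeg_eq0 d_gt0) le) /al eqxx => /eqP.
    by rewrite mulf_eq0 (negbTE m0a) orbF => /eqP.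
  have [e le he] := al_low t.
  by rewrite (mcoeff_homogM (b t) he (wdeg_eq0 d_gt0) le) al_m0 // mulr0.
(* Euler's formula turns the combination of gradients back into the invariants [h i] of degree
   [D i1]. The coefficient at [i1] is [D i1], nonzero in characteristic 0, which contradicts
   independence. *)
have : low_ideal (D i1) (\sum_(i | D i == D i1) (D i1)%:R * gam i *: h i).
  have -> : \sum_(i | D i == D i1) (D i1)%:R * gam i *: h i =
      pihomog (wdeg d) (D i1) (\sum_j ((d j)%:R *: 'X_j) * u j i1).
    rewrite /u eqxx; under [in RHS]eq_bigr do rewrite mulr_sumr.
    rewrite exchange_big raddf_sum big_mkcond; apply: eq_bigr => i _ /=.
    rewrite (eq_bigr (fun j => gam i *: ((d j)%:R *: ('X_j * (h i)^`M(j))))); last first.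
      by move=> j _; rewrite -scalerAl -scalerAr scalerA mulrC -scalerA.
    rewrite -scaler_sumr (euler (h_homog i)) /gam; case: eqP => [e|_]; last by rewrite scale0r raddf0.
    by rewrite scalerA pihomog_dE -?e ?rpredZ // mulrC.
  rewrite raddf_sum; apply: ideal_of_sum => j _ /=; apply: inv_ideal_low => //.
  rewrite mcoeffZ mcoeffX (negbTE (_ : U_(j)%MM != 0%MM)) ?mulr0 //.
  by rewrite -mdeg_eq0 mdeg1.
case: indep_h => _ _ _ /[apply] /(_ i1 erefl) /eqP.
by rewrite gam1 mulr1 natr_eq0 // -leqn0 leqNgt D_gt0.
Qed.

(** Reduction to a homogeneous invariant syzygy. Multiplying by the other conjugates of [a i0] makes
    its coefficient a norm, which survives averaging and is nonzero; then a nonzero homogeneous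
    component is selected. *)
Lemma low_independent_grad (a : 'I_r -> {mpoly k[n]}) :
  (forall j, \sum_i a i * (h i)^`M(j) = 0) -> forall i, a i = 0.
Proof.
move=> sa i0; apply/eqP/negPn/negP => ai0.
pose x := \prod_(g in H | g != 1%g) act g (a i0).
pose b i := reyn rH H (x * a i).
have bE : b i0 = \prod_(g in H) act g (a i0).
  have e : x * a i0 = \prod_(g in H) act g (a i0).
    by rewrite [RHS](bigD1 1%g) //= act1 mulrC.
  by rewrite /b e reyn_id //; apply: gprod_inv.
have b0 : b i0 != 0.
  rewrite bE; apply/prodf_neq0 => g gH; rewrite -(raddf0 (act g)).
  by rewrite (inj_eq (act_inj (rH := rH) gH)).
have [e be] : exists e, pihomog (wdeg d) e (b i0) != 0.
  have [e be] : exists e : 'I_(mmeasure (wdeg d) (b i0)), pihomog (wdeg d) e (b i0) != 0; last by exists e.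
  apply/existsP; rewrite -negb_forall; apply: contra b0 => /forallP z.
  rewrite (homog_split (leqnn (mmeasure (wdeg d) (b i0)))) big1 // => i _; exact/eqP.
pose E := (e + D i0)%N.
case/eqP: be; have <- : part E b i0 = pihomog (wdeg d) e (b i0) by rewrite /part leq_addl addnK.
apply: (homog_syz (E := E)) => [i||i].
- rewrite /part; case: ifP => _; last exact: inv0.
  by apply: inv_pihomog => //; apply: reyn_inv.
- exact/syz_part/syz_reyn.
- rewrite /part; case: leqP => _; last exact: eqxx.
  exact: pihomogP.
Qed.

Lemma low_independent_leq : (r <= n)%N.
Proof.
apply: (left_cancel_leq (A := \matrix_(i < r, j < n) (h i)^`M(j))) => a aA.
apply/rowP => i; rewrite mxE; apply: (low_independent_grad (a := fun i => a 0 i)) => j.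
by have /rowP/(_ j) := aA; rewrite !mxE => e; rewrite -[RHS]e; apply: eq_bigr => l _; rewrite mxE.
Qed.

End Independence.

End LowIndependence.

Section ChevalleyTheorem.
Variables (k : fieldType) (ch0 : [pchar k] =i pred0).
Variables (n : nat) (d : 'I_n -> nat) (d_gt0 : forall i, (0 < d i)%N).
Variables (gT : finGroupType) (H : {group gT}) (rH : mx_representation k H n).
Hypothesis rH_faithful : mx_faithful rH.
Hypothesis rH_graded : forall g, g \in H -> weight_blocks d (rH g).
Local Notation inv := (invariant_poly rH H).
Implicit Types p q : {mpoly k[n]}.
Let sHH : H \subset H := subxx H.

Variable A : {set gT}.
Hypothesis A_refl : forall s, s \in A -> \rank (rH s - 1%:M) = 1%N.
Hypothesis A_gen : <<A>>%g = H.

Local Notation indep := (low_independent d rH).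

Definition fcons (T : Type) r (h : 'I_r -> T) (x : T) (i : 'I_r.+1) : T := oapp h x (unlift ord0 i).
Lemma fcons0 (T : Type) r (h : 'I_r -> T) x : fcons h x ord0 = x.
Proof. by rewrite /fcons unlift_none. Qed.
Lemma fconsS (T : Type) r (h : 'I_r -> T) x i : fcons h x (lift ord0 i) = h i.
Proof. by rewrite /fcons liftK. Qed.

(** Extension of the family must stop because [low_independent_leq] bounds its length by [n]. *)
Lemma maximal_low_independent : exists r h D, @low_independent k n d gT H rH r h D /\
  forall p E, inv p -> (0 < E)%N -> p \is E.-homog for (wdeg d) -> ~ indep (fcons h p) (fcons D E).
Proof.
have H0 : indep (fun i : 'I_0 => 0) (fun=> 1%N) by split=> [[]|[]|[]|E c _ []].
suff ext_max t : forall r h D, (n - r <= t)%N -> @low_independent k n d gT H rH r h D ->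
    exists r h D, @low_independent k n d gT H rH r h D /\
    forall p E, inv p -> (0 < E)%N -> p \is E.-homog for (wdeg d) -> ~ indep (fcons h p) (fcons D E).
  exact: (ext_max n 0%N _ _ (leq_subr _ _) H0).
have stop r h D : @low_independent k n d gT H rH r h D ->
    (exists p E, [/\ inv p, (0 < E)%N, p \is E.-homog for (wdeg d) & indep (fcons h p) (fcons D E)]) \/
    exists r h D, @low_independent k n d gT H rH r h D /\
    forall p E, inv p -> (0 < E)%N -> p \is E.-homog for (wdeg d) -> ~ indep (fcons h p) (fcons D E).
  move=> ih; case: (classic (exists p E, [/\ inv p, (0 < E)%N, p \is E.-homog for (wdeg d) &
    indep (fcons h p) (fcons D E)])) => [|no]; [by left | right].
  by exists r, h, D; split=> // p E ip E0 hp ie; apply: no; exists p, E; split.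
elim: t => [|t IH] r h D rt ih; case: (stop r h D ih) => // -[p [E [ip E0 hp ie]]].
  have := low_independent_leq ch0 d_gt0 rH_graded A_refl A_gen ie.
  by rewrite -subn_gt0; rewrite leqn0 in rt; rewrite (eqP rt).
by apply: (IH _ _ _ _ ie); rewrite subnS; move: rt; case: (n - r)%N.
Qed.

(** By maximality the family generates the Hilbert ideal; after averaging coefficients it generates
    the algebra. Its length is exactly [n], and algebraic independence follows from the nonzero
    Jacobian. *)
Theorem chevalley_polynomial : exists h : n.-tuple {mpoly k[n]}, is_polynomial_gens d inv h.
Proof.
have [r [h [D [ih hmax]]]] := maximal_low_independent.
have [inv_h D_gt0 h_homog h_low] := ih.
have cover E : forall p, inv p -> (0 < E)%N -> p \is E.-homog for (wdeg d) ->
    ideal_of (fun y => exists i, y = h i) p.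
  elim/ltn_ind: E => E IH p ip E0 hp.
  have low_h x : low_ideal d rH E x -> ideal_of (fun y => exists i, y = h i) x.
    by apply: ideal_of_sub => y [iy [s /andP[s0 sE] hy]]; apply: (IH s).
  case: (classic (low_ideal d rH E (p - \sum_(i | D i == E) 0 *: h i))) => [|nlow].
    by rewrite big1 ?subr0 => [/low_h|i _]; rewrite ?scale0r.
  have [[c lowc]|nc] := classic (exists c : 'I_r -> k, low_ideal d rH E (p - \sum_(i | D i == E) c i *: h i)).
    rewrite -[p](subrK (\sum_(i | D i == E) c i *: h i)); apply: ideal_ofD; first exact: low_h.
    apply: ideal_of_sum => i _; rewrite -mul_mpolyC; apply/ideal_ofM/ideal_of_gen; by exists i.
  case: (hmax p E ip E0 hp); split.
  - by move=> i; rewrite /fcons; case: unlift.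
  - by move=> i; rewrite /fcons; case: unlift.
  - by move=> i; rewrite /fcons; case: unlift.
  move=> E' c; rewrite big_mkcond big_ord_recl !fcons0.
  under eq_bigr do rewrite !fconsS.
  rewrite -big_mkcond /=; case: eqP => [<-|neE]; last first.
    rewrite add0r => /h_low c0 i; rewrite /fcons; case: unliftP => [j ->|->] //=.
    exact: c0.
  have [c0|c0] := eqVneq (c ord0) 0.
    rewrite c0 scale0r add0r => /h_low cz i; rewrite /fcons; case: unliftP => [j ->|->] //=.
    exact: cz.
  (* Dividing the relation by the nonzero coefficient of [p] expresses [p] through the [h i] modulo
     [low_ideal E], which was excluded. *)
  move=> low; case: nc; exists (fun i => - (c ord0)^-1 * c (lift ord0 i)).
  have := ideal_ofM (c ord0)^-1%:MP low.
  rewrite mul_mpolyC scalerDr scalerA mulVf // scale1r scaler_sumr -sumrN.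
  by under [in X in _ -> X]eq_bigr do rewrite -scaleNr mulNr opprK -scalerA.
pose ht := [tuple h i | i < r].
have gens p : inv p -> exists P, p = P \mPo ht.
  apply: (polynomial_in_gens d_gt0 _ (D := D)) => // [s q iq|i|E q E0 iq hq].
  - exact: inv_pihomog.
  - by rewrite tnth_mktuple.
  have /ideal_of_fin[c qE] := cover E q iq E0 hq.
  exists (fun i => reyn rH H (c i)); split=> [i|]; first exact: reyn_inv.
  rewrite -(reyn_id ch0 iq) qE raddf_sum /=; apply: eq_bigr => i _.
  by rewrite tnth_mktuple reynMr.
have rn : (r <= n)%N := low_independent_leq ch0 d_gt0 rH_graded A_refl A_gen ih.
(* The left kernel of [U] is trivial, since [U] is a left factor of a matrix with nonzero
   determinant. *)
have nr : (n <= r)%N.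
  have [u uu u0] := lin_disc_avoid ch0 rH_faithful sHH.
  have [U UE] := galois_disc_mx sHH gens u.
  apply: (left_cancel_leq (A := U)) => a aU.
  apply: (@left_cancel_det _ _ (diag_mx (\row_i lin_disc rH H (row i u)) *m map_mx (@mpolyC n k) u)).
    rewrite det_mulmx det_diag det_map_mx mulf_neq0 //.
      by apply/prodf_neq0 => i _; rewrite mxE.
    by rewrite mpolyC_eq0 -unitfE -unitmxE.
  by rewrite UE mulmxA aU mul0mx.
have e : r = n by apply/eqP; rewrite eqn_leq rn.
have inv_ht i : inv (tnth ht i) by rewrite tnth_mktuple.
have homog_ht i : exists s, whomog d s (tnth ht i).
  by exists (D i); rewrite tnth_mktuple; apply: h_homog.
move: e (ht) gens inv_ht homog_ht; move=> {h ih hmax inv_h D_gt0 h_homog h_low cover ht rn nr} -> ht gens inv_ht homog_ht; exists ht; split=> //.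
by apply: jacobian_alg_indep => //; apply: (polynomial_gens_jacobian ch0 rH_faithful).
Qed.

End ChevalleyTheorem.

(** * The conormal sequence of the quotient *)

(* [E] plays the role of [A[T, S]], mapped to the fraction field of [B] by      *)
(* sending [T] to a simple root [b] of [P] and [S] to the inverse of [P'(b)].   *)
Section StandardEtale.
Variables (A E : comNzRingType) (B L : idomainType).
Variables (phi : {rmorphism A -> B}) (iota : {rmorphism A -> E}).
Variables (ev : {rmorphism E -> L}) (inj : {rmorphism B -> L}).
Hypothesis inj_inj : injective inj.
Hypothesis ev_iota : forall a, ev (iota a) = inj (phi a).
Variables (T S : E) (b : B) (P : {poly A}).
Hypothesis ev_T : ev T = inj b.
Hypothesis P_monic : P \is monic.
Hypothesis P_root : (map_poly phi P).[b] = 0.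
Hypothesis P_min : forall a : {poly A}, (size a < size P)%N -> (map_poly phi a).[b] = 0 ->
  map_poly phi a = 0.

Definition at_T (a : {poly A}) : E := (map_poly iota a).[T].
Let D := (map_poly phi P)^`().[b].
Hypothesis ev_S : ev S * inj D = 1.
Let delta := at_T P^`().

Lemma ev_at_T a : ev (at_T a) = inj (map_poly phi a).[b].
Proof.
rewrite /at_T -(horner_map ev) ev_T -(horner_map inj) -!map_poly_comp; congr (_.[_]).
by apply: eq_map_poly => x /=; rewrite ev_iota.
Qed.

Lemma at_TD a a' : at_T (a + a') = at_T a + at_T a'.
Proof. by rewrite /at_T rmorphD /= hornerD. Qed.
Lemma at_TM a a' : at_T (a * a') = at_T a * at_T a'.
Proof. by rewrite /at_T rmorphM hornerM. Qed.
Lemma at_TX M a : at_T (a ^+ M) = at_T a ^+ M.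
Proof. by rewrite /at_T rmorphXn horner_exp. Qed.
Lemma at_TC c : at_T c%:P = iota c.
Proof. by rewrite /at_T map_polyC hornerC. Qed.

Lemma ev_delta : ev delta = inj D.
Proof. by rewrite /delta ev_at_T -deriv_map. Qed.

(** Modulo S P'(T) - 1, the element [F] is a polynomial in [T] divided by a power of P'(T). *)
Definition fractional (F : E) := exists M a w, F * delta ^+ M = at_T a + (S * delta - 1) * w.

Lemma fractionalC c : fractional (iota c).
Proof. by exists 0%N, c%:P, 0; rewrite at_TC mulr0 addr0 expr0 mulr1. Qed.

Lemma fractionalT : fractional T.
Proof. by exists 0%N, 'X, 0; rewrite /at_T map_polyX hornerX mulr0 addr0 expr0 mulr1. Qed.

Lemma fractionalS : fractional S.
Proof. by exists 1%N, 1%:P, 1; rewrite at_TC rmorph1 mulr1 addrC subrK expr1. Qed.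

Lemma fractionalD F F' : fractional F -> fractional F' -> fractional (F + F').
Proof.
move=> [M [a [w e]]] [M' [a' [w' e']]].
exists (M + M')%N, (a * P^`() ^+ M' + a' * P^`() ^+ M), (w * delta ^+ M' + w' * delta ^+ M).
rewrite at_TD !at_TM !at_TX -/delta exprD mulrDl [F * _]mulrA e [delta ^+ M * _]mulrC [F' * _]mulrA e'.
by set x := at_T a; set y := at_T a'; set z := _ - 1; ring.
Qed.

Lemma fractionalM F F' : fractional F -> fractional F' -> fractional (F * F').
Proof.
move=> [M [a [w e]]] [M' [a' [w' e']]].
exists (M + M')%N, (a * a'), (w * at_T a' + w' * (F * delta ^+ M)).
rewrite at_TM exprD mulrACA e e'.
by set x := at_T a; set y := at_T a'; set z := _ - 1; ring.
Qed.

Variables (c : nat) (g : 'I_c -> A).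
Hypothesis ker_phi : forall x, phi x = 0 -> exists u, x = \sum_i u i * g i.
Hypothesis all_fractional : forall F, fractional F.

(** After clearing denominators, division by the monic [P] leaves a remainder of degree less than
    [P] that vanishes at [b]. By [P_min] its coefficients lie in the kernel of [phi], which is
    generated by the [g i]. *)
Lemma ker_ev F : ev F = 0 ->
  exists u v w, F = \sum_i u i * iota (g i) + v * at_T P + w * (S * delta - 1).
Proof.
move=> evF; have [M [a [w e]]] := all_fractional F.
have evS : ev (S * delta - 1) = 0 by rewrite rmorphB rmorphM rmorph1 /= ev_delta ev_S subrr.
have eva : (map_poly phi a).[b] = 0.
  apply: inj_inj; rewrite raddf0 -ev_at_T.
  have -> : at_T a = F * delta ^+ M - (S * delta - 1) * w by rewrite e addrK.
  by rewrite rmorphB !rmorphM /= evF evS !mul0r subrr.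
pose q := Pdiv.Ring.rdivp a P; pose r := Pdiv.Ring.rmodp a P.
have aE : a = q * P + r := Pdiv.RingMonic.rdivp_eq P_monic a.
have rP : (size r < size P)%N by rewrite Pdiv.Ring.ltn_rmodpN0 // monic_neq0.
have r0 : map_poly phi r = 0.
  by apply: P_min => //; rewrite -eva aE rmorphD rmorphM /= hornerD hornerM P_root mulr0 add0r.
have cr (i : 'I_(size r)) : exists u, r`_i = \sum_j u j * g j.
  by apply: ker_phi; rewrite -coef_map r0 coef0.
have [u uE] := fin_all_exists cr.
have rT : at_T r = \sum_j (\sum_i iota (u i j) * T ^+ i) * iota (g j).
  rewrite /at_T (@horner_coef_wide _ (size r)) ?size_poly //.
  under [RHS]eq_bigr do rewrite mulr_suml.
  rewrite exchange_big; apply: eq_bigr => i _ /=.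
  rewrite coef_map uE raddf_sum mulr_suml; apply: eq_bigr => j _ /=.
  by rewrite rmorphM /= mulrAC.
(* Multiplication by [S ^+ M] undoes that by [delta ^+ M] modulo [S * delta - 1]; the cofactor is a
   geometric sum. *)
have [s sE] : exists s, S ^+ M * delta ^+ M = 1 + (S * delta - 1) * s.
  by exists (\sum_(i < M) (S * delta) ^+ i); rewrite -subrX1 -exprMn addrC subrK.
exists (fun j => S ^+ M * \sum_i iota (u i j) * T ^+ i), (S ^+ M * at_T q), (S ^+ M * w - F * s).
under eq_bigr do rewrite -mulrA.
rewrite -mulr_sumr -rT -mulrA -mulrDr mulrBl addrA.
rewrite [X in _ = _ + X - _](_ : _ = S ^+ M * ((S * delta - 1) * w)); last by rewrite -mulrA [w * _]mulrC.
rewrite -mulrDr.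
have -> : at_T r + at_T q * at_T P = at_T a by rewrite aE at_TD at_TM addrC.
rewrite -e mulrCA sE.
by set z := _ - 1; ring.
Qed.

End StandardEtale.

Section RootsOfGaloisPolynomial.
Variables (S : idomainType) (gT : finGroupType) (K : {group gT}).
Variable act : gT -> {rmorphism S -> S}.
Hypothesis actM : {in K &, forall g h x, act h (act g x) = act (g * h)%g x}.
Hypothesis act1 : forall x, act 1%g x = x.

(** A polynomial with invariant coefficients vanishing at b vanishes at all its conjugates, and a
    nonzero discriminant makes these #|K| distinct roots. *)
Lemma galois_disc_min b (a : {poly S}) : galois_disc K act b != 0 ->
  (forall i g, g \in K -> act g a`_i = a`_i) -> (size a <= #|K|)%N -> a.[b] = 0 -> a = 0.
Proof.
move=> D0 ia sa ab; apply/eqP/negPn/negP => a0.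
pose rs := [seq act g b | g <- enum K].
have urs : uniq rs.
  rewrite map_inj_in_uniq ?enum_uniq // => g h; rewrite !mem_enum => gK hK e.
  apply/eqP; rewrite eq_mulgV1; apply/negPn/negP => ne.
  have ghK : (g * h^-1)%g \in K by rewrite groupM ?groupV.
  have /prodf_neq0/(_ (g * h^-1)%g) := D0; rewrite ghK ne subr_eq0 => /(_ isT)/eqP; apply.
  by rewrite -actM ?groupV // e actM ?groupV // mulgV act1.
have : (size rs < size a)%N.
  apply: max_poly_roots => //; apply/allP => x /mapP[g]; rewrite mem_enum => gK ->.
  apply/eqP; have <- : map_poly (act g) a = a.
    by apply/polyP => i; rewrite coef_map /= ia.
  by rewrite horner_map ab raddf0.
by rewrite size_map -cardE ltnNge sa.
Qed.

End RootsOfGaloisPolynomial.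

Lemma tofrac_inj (R : idomainType) : injective (@tofrac R).
Proof. by move=> x y /eqP; rewrite tofrac_eq => /eqP. Qed.

Section EtaleQuotient.
Variables (k : fieldType) (n : nat) (gT : finGroupType) (H : {group gT}).
Variables (rH : mx_representation k H n) (K : {group gT}).
Hypothesis sKH : K \subset H.
Variables (m : nat) (f : m.-tuple {mpoly k[n]}).
Hypothesis f_inv : forall i, invariant_poly rH K (tnth f i).
Hypothesis f_gens : forall p, invariant_poly rH K p -> exists P, p = P \mPo f.
Variables (c : nat) (g : 'I_c -> {mpoly k[m]}).
Hypothesis g_rel : forall i, g i \mPo f = 0.
Hypothesis g_gens : forall p, p \mPo f = 0 -> exists u, p = \sum_i u i * g i.
Variable b : {mpoly k[n]}.
Local Notation act := (ract rH).
Let D := galois_disc K act b.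
Hypothesis D0 : D != 0.

Local Notation A := {mpoly k[m]}.
Local Notation B := {mpoly k[n]}.
Local Notation E := {mpoly k[m + 2]}.
Local Notation L := {fraction {mpoly k[n]}}.

Let X l : E := 'X_(lshift 2 l).
Let T : E := 'X_(rshift m ord0).
Let S : E := 'X_(rshift m ord_max).
Let phi : {rmorphism A -> B} := comp_mpoly f.
Let iota : {rmorphism A -> E} := comp_mpoly [tuple X l | l < m].
Let inj : {rmorphism B -> L} := @tofrac B.
Let hev (i : 'I_(m + 2)) : L :=
  match split i with
  | inl l => inj (tnth f l)
  | inr t => if t == ord0 then inj b else (inj D)^-1
  end.
Let ev : {rmorphism E -> L} := mmap (inj \o @mpolyC n k) hev.

Let evC x : ev x%:MP = inj x%:MP.
Proof. by rewrite /ev /= mmapC. Qed.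

Let evX l : ev (X l) = inj (tnth f l).
Proof. by rewrite /ev /= mmapX mmap1U /hev (unsplitK (inl _ l)). Qed.

Let evT : ev T = inj b.
Proof. by rewrite /ev /= mmapX mmap1U /hev (unsplitK (inr _ ord0)). Qed.

Let evS : ev S = (inj D)^-1.
Proof. by rewrite /ev /= mmapX mmap1U /hev (unsplitK (inr _ ord_max)). Qed.

Let ev_comp r (p : {mpoly k[r]}) (q : r.-tuple E) (z : r.-tuple B) :
  (forall i, ev (tnth q i) = inj (tnth z i)) -> ev (p \mPo q) = inj (p \mPo z).
Proof.
move=> qz; elim/mpoly_alg_ind: p => [x|i|p1 p2 e1 e2|p1 p2 e1 e2].
- by rewrite !comp_mpolyC evC.
- by rewrite !comp_mpolyXt.
- by rewrite !comp_mpolyD !rmorphD /= e1 e2.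
- by rewrite !rmorphM /= e1 e2.
Qed.

Let ev_iota a : ev (iota a) = inj (phi a).
Proof. by apply: ev_comp => i; rewrite tnth_mktuple evX. Qed.

Let injD0 : inj D != 0.
Proof. by rewrite -(raddf0 inj) (inj_eq (@tofrac_inj _)). Qed.

Let lift_poly (p : {poly B}) : (forall i, invariant_poly rH K p`_i) ->
  exists a : {poly A}, map_poly phi a = p.
Proof.
move=> ip; have [a aE] := fin_all_exists (fun i : 'I_(size p) => f_gens (ip i)).
exists (\poly_(i < size p) (if insub i is Some i' then a i' else 0)).
apply/polyP => i; rewrite coef_map coef_poly; case: ltnP => [lt|ge]; last first.
  by rewrite raddf0 nth_default.
by rewrite insubT /= -aE.
Qed.

(** Only the coefficients below the leading one are lifted, so that the lift is monic over [A]
    itself. *)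
Let P_ex : exists P : {poly A}, P \is monic /\ map_poly phi P = galois_poly K act b.
Proof.
pose N := #|K|; pose p := galois_poly K act b.
have sp : size p = N.+1 := size_galois_poly K act b.
have [a aE] : exists a : {poly A}, map_poly phi a = \poly_(i < N) p`_i.
  apply: lift_poly => i; rewrite coef_poly; case: ifP => _; last exact: inv0.
  move=> h hK; exact: (galois_poly_coef_inv (ractM rH sKH) b i hK).
pose a' := \poly_(i < N) a`_i.
exists ('X^N + a'); split.
  rewrite monicE lead_coefDl ?lead_coefXn // size_polyXn ltnS; exact: size_poly.
apply/polyP => i; rewrite rmorphD /= map_polyXn coefD coefXn coef_map coef_poly.
have /polyP/(_ i) := aE; rewrite coef_map coef_poly /=.
case: (ltngtP i N) => [lt|gt|->] e.
- by rewrite e add0r.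
- by rewrite comp_mpoly0 addr0 nth_default // sp.
- rewrite comp_mpoly0 addr0; have /monicP := monic_galois_poly K act b.
  by rewrite lead_coefE -/p sp.
Qed.

Let fractional_all P : forall F, fractional iota T S P F.
Proof.
apply: mpoly_alg_ind => [x|i|F F'|F F'].
- have -> : x%:MP = iota x%:MP by rewrite /iota /= comp_mpolyC.
  exact: fractionalC.
- rewrite -(splitK i); case: split => [l|t] /=.
    have -> : 'X_(lshift 2 l) = iota 'X_l by rewrite /iota /= comp_mpolyXt tnth_mktuple.
    exact: fractionalC.
  case: t => -[|[|//]] lt.
    rewrite (_ : 'X_ _ = T); first exact: fractionalT.
    by congr 'X_(rshift m _); apply: val_inj.
  rewrite (_ : 'X_ _ = S); first exact: fractionalS.
  by congr 'X_(rshift m _); apply: val_inj.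
- exact: fractionalD.
- exact: fractionalM.
Qed.

Let ev_denom F : exists M z, ev F * inj D ^+ M = inj z.
Proof.
elim/mpoly_alg_ind: F => [x|i|F F' [M [z e]] [M' [z' e']]|F F' [M [z e]] [M' [z' e']]].
- by exists 0%N, x%:MP; rewrite expr0 mulr1 evC.
- rewrite -(splitK i); case: split => [l|t] /=.
    by exists 0%N, (tnth f l); rewrite expr0 mulr1 evX.
  case: t => -[|[|//]] lt.
    exists 0%N, b; rewrite expr0 mulr1 -evT; congr (ev 'X_(rshift m _)); exact: val_inj.
  have -> : 'X_(rshift m (Ordinal lt)) = S by congr 'X_(rshift m _); apply: val_inj.
  by exists 1%N, 1; rewrite evS expr1 mulVf // rmorph1.
- exists (M + M')%N, (z * D ^+ M' + z' * D ^+ M).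
  rewrite rmorphD mulrDl exprD mulrA e [X in _ + X]mulrCA e'.
  by rewrite [inj _ ^+ M * _]mulrC -!rmorphXn -!rmorphM -rmorphD.
- exists (M + M')%N, (z * z'); by rewrite !rmorphM exprD mulrACA e e'.
Qed.

(** The matrix of the conormal map from I/I^2 to the differentials of V restricted to the
    quotient. *)
Let C := \matrix_(i < c, l < m) ((g i)^`M(l) \mPo f).

Let iota_mderiv a e : ev (iota a)^`M(e) =
  \sum_l inj (a^`M(l) \mPo f) * (lshift 2 l == e)%:R.
Proof.
rewrite /iota /= mderiv_comp rmorph_sum; apply: eq_bigr => l _.
rewrite rmorphM /= tnth_mktuple mderivXU rmorph_nat; congr (_ * _).
exact: ev_iota.
Qed.

Let at_T_mderiv t a : (at_T iota T a)^`M(rshift m t) = at_T iota T a^`() * (ord0 == t)%:R.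
Proof.
rewrite /at_T (derivation_horner (D := mderiv (rshift m t))); last exact: mderivM.
rewrite big1 ?add0r => [|i _].
  by rewrite deriv_map /T /= mderivXU (inj_eq (@rshift_inj _ _)).
rewrite coef_map /= mderiv_comp big1 ?mul0r // => l _.
by rewrite tnth_mktuple mderivXU eq_lrshift mulr0.
Qed.

(* With [y_j = Q_j(b) / P'(b)], the elements [Phi_l = f_l(Q_j S)] satisfy        *)
(* [g_i(Phi) = 0] and differ from [x_l] by an element of the kernel of [ev],     *)
(* i.e. by [sum_i u_li g_i + v_l P + w_l (S P' - 1)].  Differentiating           *)
(* [g_i(Phi) = 0] along [S], [T] and the [x_l] gives successively [C w = 0],     *)
(* [C v = 0] and [(1 + C u) C = 0].                                              *)
Lemma conormal_splitting :
  (forall a : 'rV_c, a *m C = 0 -> a = 0) ->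
  exists M (R : 'M_(m, c)), C *m R = (D ^+ M)%:M.
Proof.
move=> C_cancel; have [P [P_monic PE]] := P_ex.
have rootP : (map_poly phi P).[b] = 0 by rewrite PE galois_poly_root1 //; apply: ract1.
have dP : (map_poly phi P)^`().[b] = D by rewrite PE deriv_eval //; apply: ract1.
have sP : size P = #|K|.+1.
  by rewrite -(size_galois_poly K act b) -PE size_map_poly_id0 // (monicP P_monic) rmorph1 oner_eq0.
have P_min (a : {poly A}) : (size a < size P)%N -> (map_poly phi a).[b] = 0 -> map_poly phi a = 0.
  rewrite sP ltnS => sa; apply: (galois_disc_min (ractM rH sKH) (@ract1 _ _ _ _ rH)) => //.
    move=> i h hK; rewrite coef_map /= /act comp_pullback; apply: eq_comp_mpoly => l.
    by rewrite tnth_mktuple f_inv.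
  exact: leq_trans (size_poly _ _) sa.
have evSD : ev S * inj (map_poly phi P)^`().[b] = 1 by rewrite evS dP mulVf.
have ker F := ker_ev (@tofrac_inj _) ev_iota evT P_monic rootP P_min evSD g_gens (fractional_all P) (F := F).
set delta := at_T iota T P^`() in ker.
have ev_d : ev delta = inj D by rewrite /delta (ev_delta ev_iota P evT) dP.
have liftQ j : exists Q : {poly A}, map_poly phi Q = lagrange K act b 'X_j.
  apply: lift_poly => i h hK; exact: (lagrange_coef_inv (ractM rH sKH) b 'X_j i hK).
have [Q QE] := fin_all_exists liftQ.
(* By Lagrange interpolation Q_j(b) = P'(b) times the j-th coordinate, so Q_j(T) S is mapped to that
   coordinate. *)
pose Phi l : E := tnth f l \mPo [tuple at_T iota T (Q j) * S | j < n].
have evPhi l : ev (Phi l) = inj (tnth f l).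
  rewrite (@ev_comp _ _ _ [tuple 'X_j | j < n]) ?comp_mpoly_id // => j.
  rewrite !tnth_mktuple rmorphM /= evS (ev_at_T ev_iota evT) QE lagrange_eval; last exact: ract1.
  by rewrite rmorphM mulfK.
have kerPhi l : exists uvw : ('I_c -> E) * E * E,
    Phi l = X l + (\sum_i uvw.1.1 i * iota (g i) + uvw.1.2 * at_T iota T P + uvw.2 * (S * delta - 1)).
  have [|u [v [w e]]] := ker (Phi l - X l); first by rewrite rmorphB evPhi evX subrr.
  by exists (u, v, w); rewrite -e addrC subrK.
have [uvw PhiE] := fin_all_exists kerPhi.
pose u l i := ev ((uvw l).1.1 i); pose v l := ev (uvw l).1.2; pose w l := ev (uvw l).2.
have CPhi i e : \sum_l inj (C i l) * ev (Phi l)^`M(e) = 0.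
  have gPhi : g i \mPo [tuple Phi l | l < m] = 0.
    transitivity ((g i \mPo f) \mPo [tuple at_T iota T (Q j) * S | j < n]).
      by rewrite comp_mpolyA.
    by rewrite g_rel comp_mpoly0.
  have := mderiv_comp (g i) [tuple Phi l | l < m] e.
  rewrite gPhi mderiv0 => /(congr1 ev); rewrite rmorph0 rmorph_sum => e0.
  rewrite [RHS]e0; apply: eq_bigr => l _; rewrite rmorphM /= tnth_mktuple; congr (_ * _).
  by rewrite mxE; apply/esym/ev_comp => l'; rewrite tnth_mktuple evPhi.
have evg i : ev (iota (g i)) = 0 by rewrite ev_iota /phi /= g_rel rmorph0.
have evP : ev (at_T iota T P) = 0 by rewrite (ev_at_T ev_iota evT) rootP rmorph0.
have evSd : ev (S * delta - 1) = 0 by rewrite rmorphB rmorphM /= evS ev_d mulVf // rmorph1 subrr.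
have evM0 F x e : ev x = 0 -> ev (F * x)^`M(e) = ev F * ev x^`M(e).
  by move=> x0; rewrite mderivM rmorphD !rmorphM /= x0 mulr0 add0r.
have dPhi l e : ev (Phi l)^`M(e) = (lshift 2 l == e)%:R +
    (\sum_i u l i * ev (iota (g i))^`M(e) + v l * ev (at_T iota T P)^`M(e)
     + w l * ev (S * delta - 1)^`M(e)).
  have split4 x y z t : ev (x + (y + z + t))^`M(e) =
      ev x^`M(e) + (ev y^`M(e) + ev z^`M(e) + ev t^`M(e)) by rewrite !mderivD !rmorphD.
  rewrite {1}PhiE split4 {1}/X mderivXU rmorph_nat; congr (_ + (_ + _ + _)).
  - rewrite (raddf_sum (mderiv e)) (raddf_sum ev); apply: eq_bigr => i _ /=.
    exact: (evM0 _ _ e (evg i)).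
  - exact: (evM0 _ _ e evP).
  - exact: (evM0 _ _ e evSd).
have dg_r i t : ev (iota (g i))^`M(rshift m t) = 0.
  by rewrite iota_mderiv big1 // => l _; rewrite eq_lrshift mulr0.
have Cw i : \sum_l inj (C i l) * w l = 0.
  apply: (mulIf injD0); rewrite mul0r mulr_suml -[RHS](CPhi i (rshift m ord_max)).
  apply: eq_bigr => l _; rewrite dPhi eq_lrshift add0r big1 ?add0r; last by move=> ? _; rewrite dg_r mulr0.
  rewrite at_T_mderiv mulr0 rmorph0 mulr0 add0r -mulrA; congr (_ * (_ * _)).
  rewrite mderivB mderivM {1}/S mderivXU eqxx mul1r at_T_mderiv mulr0 mulr0 addr0.
  by rewrite -mpolyC1 mderivC subr0 ev_d.
have Cv i : \sum_l inj (C i l) * v l = 0.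
  apply: (mulIf injD0); rewrite mul0r mulr_suml.
  pose kap := ev (S * delta - 1)^`M(rshift m ord0).
  transitivity (\sum_l inj (C i l) * ev (Phi l)^`M(rshift m ord0) - (\sum_l inj (C i l) * w l) * kap).
    rewrite mulr_suml -sumrB; apply: eq_bigr => l _.
    rewrite dPhi eq_lrshift add0r big1 ?add0r; last by move=> ? _; rewrite dg_r mulr0.
    rewrite at_T_mderiv eqxx mulr1 -/delta ev_d -/kap mulrDr !mulrA addrK //.
  by rewrite CPhi Cw mul0r subrr.
have Cu i l' : inj (C i l') + \sum_i' (\sum_l inj (C i l) * u l i') * inj (C i' l') = 0.
  pose k1 := ev (at_T iota T P)^`M(lshift 2 l'); pose k2 := ev (S * delta - 1)^`M(lshift 2 l').
  transitivity (\sum_l inj (C i l) * ev (Phi l)^`M(lshift 2 l') - (\sum_l inj (C i l) * v l) * k1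
     - (\sum_l inj (C i l) * w l) * k2); last by rewrite CPhi Cw Cv !mul0r !subr0.
  rewrite !mulr_suml -!sumrB.
  have -> : inj (C i l') = \sum_l inj (C i l) * (l == l')%:R.
    rewrite (bigD1 l') //= eqxx mulr1 big1 ?addr0 // => l /negbTE->; by rewrite mulr0.
  under [X in _ + X = _]eq_bigr do rewrite mulr_suml.
  rewrite exchange_big -big_split; apply: eq_bigr => l _ /=.
  rewrite dPhi (inj_eq (@lshift_inj _ _)) -/k1 -/k2 !mulrDr !mulrA.
  rewrite -!addrA; congr (_ + _).
  rewrite [X in _ + X](_ : _ = 0) ?addr0; last by ring.
  rewrite mulr_sumr; apply: eq_bigr => i' _; rewrite mulrA; congr (_ * _).
  rewrite iota_mderiv (bigD1 l') //= eqxx mulr1 big1 ?addr0 ?mxE // => l'' ne.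
  by rewrite (inj_eq (@lshift_inj _ _)) (negbTE ne) mulr0.
(* The finitely many entries [u l i] are fractions with denominator a power of [D]; the exponent [N]
   clears them all. *)
have [Mz zE] := fin_all_exists (fun li : 'I_m * 'I_c => let: ex_intro M (ex_intro z e) := ev_denom ((uvw li.1).1.1 li.2) in
  ex_intro (fun Mz : nat * B => u li.1 li.2 * inj D ^+ Mz.1 = inj Mz.2) (M, z) e).
pose N := (\sum_li (Mz li).1)%N.
pose U : 'M_(m, c) := \matrix_(l, i) ((Mz (l, i)).2 * D ^+ (N - (Mz (l, i)).1)).
have UE l i : inj (U l i) = u l i * inj D ^+ N.
  have le : ((Mz (l, i)).1 <= N)%N by rewrite /N (bigD1 (l, i)) //= leq_addr.
  by rewrite mxE rmorphM rmorphXn /= -(zE (l, i)) -mulrA -exprD subnKC.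
(* The matrix C U + D^N, multiplied by [C] on the right, is zero, and [C] cancels row by row. *)
exists N, (- U); apply/eqP; rewrite mulmxN eqr_oppLR -subr_eq0 opprK; apply/eqP/row_matrixP => i.
rewrite row0; apply: C_cancel; rewrite -row_mul -[RHS](row0 _ _ i); congr (row i _).
rewrite mulmxDl mul_scalar_mx; apply/matrixP => i1 l'; apply: (@tofrac_inj _).
rewrite !mxE tofracD rmorph0 -[X in _ = X](mulr0 (inj D ^+ N)) -(Cu i1 l') mulrDr.
rewrite addrC; congr (_ + _).
  by rewrite !mxE tofracM; congr (_ * _); rewrite -rmorphXn.
rewrite rmorph_sum mulr_sumr; apply: eq_bigr => i' _ /=.
rewrite !mxE tofracM mulrA; congr (_ * _); rewrite rmorph_sum mulr_sumr; apply: eq_bigr => l _ /=.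
rewrite tofracM !mxE; have := UE l i'; rewrite mxE /inj /= => ->.
by rewrite [RHS]mulrC mulrA.
Qed.

End EtaleQuotient.

(** If w is outside [K], some linear form b has w b distinct from g b for every g in [K]. But w
    fixes the coefficients of the Galois polynomial of b, so w b would be one of its roots. *)
Lemma galois_fixed (k : fieldType) (ch0 : [pchar k] =i pred0) n (gT : finGroupType)
    (H K : {group gT}) (rH : mx_representation k H n) w :
  mx_faithful rH -> K \subset H -> w \in H ->
  (forall p, invariant_poly rH K p -> pullback (rH w) p = p) -> w \in K.
Proof.
move=> ff sKH wH fixw; apply/negPn/negP => wK.
have [|b bP] := @avoid_vector_sub k n {g | g \in K} (fun g => rH w - rH (val g)) (fun=> 0) ch0.
  case=> g gK; rewrite submx_row0; apply: faithful_neq => //; first exact: (subsetP sKH).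
  by apply: contraNneq wK => ->.
pose P := galois_poly K (ract rH) (lin b).
have cP i : ract rH w P`_i = P`_i.
  by apply: fixw => g gK; exact: (galois_poly_coef_inv (ractM rH sKH) (lin b) i gK).
have mP : map_poly (ract rH w) P = P by apply/polyP => i; rewrite coef_map; exact: cP.
have : P.[ract rH w (lin b)] = 0.
  by rewrite -mP horner_map galois_poly_root1 ?raddf0 //; apply: ract1.
move/eqP; rewrite /P /galois_poly horner_prod; apply/negP/prodf_neq0 => g gK.
rewrite hornerXsubC /ract /= !pullback_lin -raddfB lin_eq0 -mulmxBr -submx_row0.
exact: (bP (Sub g gK)).
Qed.

Section SpanningSubset.
Variables (k : fieldType) (V : lmodType k) (Z : V -> Prop).
Hypothesis Z0 : Z 0.
Hypothesis ZD : forall x y, Z x -> Z y -> Z (x + y).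
Hypothesis ZZ : forall a x, Z x -> Z (a *: x).
Variables (T : finType) (S : T -> V) (c : nat) (gam : 'I_c -> V).
Hypothesis S_gam : forall t, exists a : 'I_c -> k, Z (S t - \sum_i a i *: gam i).

Let indep (J : {set T}) := forall a : T -> k, Z (\sum_(j in J) a j *: S j) -> forall j, j \in J -> a j = 0.

(** Exchange argument in the quotient by the subspace [Z]: a maximal independent subfamily spans,
    and it has at most [c] members because the family lies in the span of [c] vectors. *)
Lemma spanning_subset : exists J : {set T}, (#|J| <= c)%N /\
  forall t, exists a : T -> k, Z (S t - \sum_(j in J) a j *: S j).
Proof.
have [J [indJ maxJ]] : exists J, indep J /\ forall t, t \notin J -> ~ indep (t |: J).
  suff ext s : forall J : {set T}, (#|T| - #|J| <= s)%N -> indep J ->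
      exists J, indep J /\ forall t, t \notin J -> ~ indep (t |: J).
    by apply: (ext #|T| set0); [exact: leq_subr | move=> a _ j; rewrite inE].
  elim: s => [|s IH] J sJ indJ.
  - exists J; split=> // t tJ _; move: sJ; rewrite leqn0 subn_eq0 leqNgt => /negP; apply.
    by apply: leq_trans (max_card (t |: J)); rewrite cardsU1 tJ.
  - case: (classic (exists2 t, t \notin J & indep (t |: J))) => [[t tJ it]|no].
      by apply: IH it; rewrite cardsU1 tJ add1n subnS; move: sJ; case: (#|T| - #|J|)%N.
    by exists J; split=> // t tJ it; apply: no; exists t.
have [M ME] := fin_all_exists S_gam.
exists J; split.
  pose A := \matrix_(x < #|J|, i < c) M (enum_val x) i.
  apply: (left_cancel_leq (A := A)) => a aA; apply/rowP => x; rewrite mxE.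
  pose b t := \sum_(y < #|J|) (enum_val y == t)%:R * a 0 y.
  have bE y : b (enum_val y) = a 0 y.
    rewrite /b (bigD1 y) //= eqxx mul1r big1 ?addr0 // => z ne.
    by rewrite (inj_eq enum_val_inj) (negbTE ne) mul0r.
  rewrite -bE; apply: indJ; last exact: enum_valP.
  have -> : \sum_(j in J) b j *: S j = \sum_(j in J) b j *: (S j - \sum_i M j i *: gam i).
    under [RHS]eq_bigr do rewrite scalerBr.
    rewrite sumrB (_ : \sum_(i in J) _ *: (\sum_i _) = 0) ?subr0 //.
    under eq_bigr do rewrite scaler_sumr.
    rewrite exchange_big big1 // => i _ /=.
    under eq_bigr do rewrite scalerA.
    rewrite -scaler_suml (_ : \sum_(i0 in J) _ = 0) ?scale0r //.
    have /rowP/(_ i) := aA; rewrite !mxE => e; rewrite -[RHS]e big_enum_val /=.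
    by apply: eq_bigr => y _; rewrite bE !mxE.
  by apply: (big_ind Z) => // j _; apply: ZZ; apply: ME.
move=> t; have [tJ|tJ] := boolP (t \in J).
  exists (fun j => (j == t)%:R); rewrite (bigD1 t) //= eqxx scale1r big1 ?addr0 ?subrr //.
  by move=> j /andP[_ /negbTE->]; rewrite scale0r.
have [a na] := not_all_ex_not _ _ (maxJ t tJ).
have [Za nz] := imply_to_and _ _ na.
have at0 : a t != 0.
  apply/eqP => at0; apply: nz => j; rewrite in_setU1; case: eqP => [->//|_ /= jJ].
  apply: indJ jJ; move: Za; rewrite big_setU1 //= at0 scale0r add0r; exact.
exists (fun j => - (a t)^-1 * a j).
have := ZZ (a t)^-1 Za; rewrite big_setU1 //= scalerDr scalerA mulVf // scale1r.
rewrite scaler_sumr -sumrN.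
by under [in X in _ -> X]eq_bigr do rewrite -scaleNr mulNr opprK -scalerA.
Qed.

End SpanningSubset.

(** A generator of degree 0 would be a constant, contradicting algebraic independence. *)
Lemma polynomial_gens_degree (k : fieldType) n (d : 'I_n -> nat) (S : {mpoly k[n]} -> Prop) h :
  (forall i, (0 < d i)%N) -> is_polynomial_gens d S h ->
  exists D : 'I_n -> nat, forall i, (0 < D i)%N /\ tnth h i \is (D i).-homog for (wdeg d).
Proof.
move=> d_gt0 [_ hom ind _]; have [D DE] := fin_all_exists hom; exists D => i.
split; last exact: DE.
rewrite lt0n; apply/eqP => D0; have := DE i; rewrite /whomog D0 => /(homog0_const d_gt0) hi.
have := ind ('X_i - ((tnth h i)@_0)%:MP); rewrite raddfB /= comp_mpolyXt comp_mpolyC {1}hi subrr.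
move=> /(_ erefl) /(congr1 (mcoeff U_(i)%MM)); rewrite mcoeffB mcoeffX eqxx mcoeffC mcoeff0.
by rewrite mnm1_eq0 mulr0 subr0 => /eqP; rewrite oner_eq0.
Qed.

(** * Good subgroups *)

Section Splitting.
Variables (k : fieldType) (ch0 : [pchar k] =i pred0).
Variables (n : nat) (d : 'I_n -> nat) (d_gt0 : forall i, (0 < d i)%N).
Variables (gT : finGroupType) (Wt G : {group gT}) (rWt : mx_representation k Wt n).
Hypothesis Wt_faithful : mx_faithful rWt.
Hypothesis Wt_blocks : forall w, w \in Wt -> weight_blocks d (rWt w).
Hypothesis G_normal : (G <| Wt)%g.
Variables (m : nat) (e : 'I_m -> nat) (f : m.-tuple {mpoly k[n]}).
Hypothesis f_splitting : is_graded_splitting d rWt G e f.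
Let sGW : G \subset Wt := normal_sub G_normal.
Local Notation inv := (invariant_poly rWt G).

Lemma inv_posP p : inv_pos d rWt G p -> inv p /\ p@_0 = 0.
Proof.
move: p; apply: span_of_ind => [|p q [ip p0] [iq q0]|a p [ip [r r0 hp]]].
- by split; [apply: inv0 | rewrite mcoeff0].
- by split; [apply: invD | rewrite mcoeffD p0 q0 addr0].
- by split; [apply: invZ | rewrite mcoeffZ (homog_mcoeff0 r0 hp) mulr0].
Qed.

Lemma splitting_inv i : inv (tnth f i).
Proof. by have [/(_ i)[/inv_posP[]]] := f_splitting. Qed.

Lemma splitting_homog i : tnth f i \is (e i).-homog for (wdeg d).
Proof. by have [/(_ i)[]] := f_splitting. Qed.

Lemma splitting_homogU i : tnth f i \is (wdeg e U_(i)%MM).-homog for (wdeg d).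
Proof. by rewrite wdegU; apply: splitting_homog. Qed.

Lemma splitting_free (c : 'I_m -> k) : \sum_i c i *: tnth f i = 0 -> forall i, c i = 0.
Proof. by have [_ free _ _] := f_splitting => c0; apply: free; rewrite c0; apply: span_of0. Qed.

Lemma splitting_neq0 i : tnth f i != 0.
Proof.
apply/eqP => fi0; have /splitting_free/(_ i)/eqP : \sum_j (j == i)%:R *: tnth f j = 0.
  by rewrite (bigD1 i) //= fi0 scaler0 add0r big1 // => j /negbTE->; rewrite scale0r.
by rewrite eqxx oner_eq0.
Qed.

Lemma splitting_weight_gt0 i : (0 < e i)%N.
Proof.
rewrite lt0n; apply/eqP => ei0; have := splitting_homog i; rewrite ei0 => /(homog0_const d_gt0).
have [/(_ i)[/inv_posP[_ ->]]] := f_splitting => _ _ _ _ /eqP.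
by rewrite mpolyC0 (negbTE (splitting_neq0 i)).
Qed.

(** Induction on degree: modulo a combination of the [f i], an invariant is a sum of products of
    invariants without constant term, whose relevant components have smaller degree. *)
Lemma splitting_gens p : inv p -> exists P, p = P \mPo f.
Proof.
have inv_hom r q : inv q -> inv (pihomog (wdeg d) r q).
  by apply: inv_pihomog => g gG; apply/Wt_blocks/(subsetP sGW).
move: p; apply: (polynomial_in_gens_homog (h := f) d_gt0 inv_hom) => E p E0 ip hp IH.
have [_ _ /(_ p) dec0 _] := f_splitting; have [|c dec] := dec0.
  by apply: span_of_gen; split=> //; exists E.
suff [P PE] : exists P, pihomog (wdeg d) E (p - \sum_i c i *: tnth f i) = P \mPo f.
  have cf i : exists Q, pihomog (wdeg d) E (c i *: tnth f i) = Q \mPo f.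
    have [eE|ne] := eqVneq (e i) E.
      by exists (c i *: 'X_i); rewrite linearZ /= comp_mpolyZ comp_mpolyXt pihomog_dE // -eE splitting_homog.
    by exists 0; rewrite comp_mpoly0 linearZ /= (pihomog_ne0 ne) ?scaler0 // splitting_homog.
  have [Q QE] := fin_all_exists cf; exists (P + \sum_i Q i).
  rewrite comp_mpolyD -PE raddfB /= (raddf_sum (comp_mpoly f)) (raddf_sum (pihomog (wdeg d) E)).
  by rewrite (pihomog_dE hp) (eq_bigr (fun i => Q i \mPo f) (fun i _ => QE i)) subrK.
move: (p - _) dec; apply: span_of_ind => [|x y [P xE] [Q yE]|a _ [x [y [xp yp ->]]]].
- by exists 0; rewrite raddf0 comp_mpoly0.
- by exists (P + Q); rewrite raddfD /= xE yE comp_mpolyD.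
have [ix x0] := inv_posP xp; have [iy y0] := inv_posP yp.
have tP (r : 'I_E.+1) : exists P, pihomog (wdeg d) (E - r) x * pihomog (wdeg d) r y = P \mPo f.
  have [r0|r0] := posnP r.
    by exists 0; rewrite r0 (pihomog0_const d_gt0 y) y0 mpolyC0 mulr0 comp_mpoly0.
  have [rE|rE] := eqVneq (r : nat) E.
    by exists 0; rewrite rE subnn (pihomog0_const d_gt0 x) x0 mpolyC0 mul0r comp_mpoly0.
  have rE' : (r < E)%N by rewrite ltn_neqAle rE -ltnS ltn_ord.
  have [P ->] := IH r (pihomog (wdeg d) r y) rE' (inv_hom _ _ iy) (pihomogP _ _ _).
  have [|Q ->] := IH (E - r)%N (pihomog (wdeg d) (E - r) x) _ (inv_hom _ _ ix) (pihomogP _ _ _).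
    by rewrite ltn_subrL r0 E0.
  by exists (Q * P); rewrite rmorphM.
have [P PE] := fin_all_exists tP; exists (a *: \sum_r P r).
rewrite linearZ /= pihomogM comp_mpolyZ (raddf_sum (comp_mpoly f)); congr (_ *: _).
by apply: eq_bigr => r _; rewrite PE.
Qed.

Variable rV : mx_representation k (Wt / G)%G m.
Hypothesis rV_tangent : is_tangent_repr rWt f rV.

Lemma quotient_mem w : w \in Wt -> coset G w \in (Wt / G)%g.
Proof. exact: mem_quotient. Qed.

Lemma quotient_lift x : x \in (Wt / G)%g -> exists2 w, w \in Wt & x = coset G w.
Proof. by case/morphimP => w _ wW ->; exists w. Qed.

Lemma tangent_comp w P : w \in Wt ->
  pullback (rWt w) (P \mPo f) = pullback (rV (coset G w)) P \mPo f.
Proof.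
move=> wW; rewrite comp_pullback pullback_comp; apply: eq_comp_mpoly => i.
by rewrite !tnth_mktuple rV_tangent.
Qed.

Lemma tangent_blocks x : x \in (Wt / G)%g -> weight_blocks e (rV x).
Proof.
case/quotient_lift => w wW -> i j nz; apply/eqP/negPn/negP => ne.
have hw : pullback (rWt w) (tnth f i) \is (e i).-homog for (wdeg d).
  by apply: pullback_homog (splitting_homog i); apply: Wt_blocks.
have := pihomog_ne0 (b := e j) _ hw; rewrite eq_sym ne => /(_ isT).
rewrite rV_tangent // raddf_sum /= => sum0.
have /splitting_free/(_ j) : \sum_l (if e l == e j then rV (coset G w) i l else 0) *: tnth f l = 0.
  rewrite -[RHS]sum0; apply: eq_bigr => l _; rewrite linearZ /=.
  case: eqP => [el|/eqP nel]; first by rewrite pihomog_dE // -el splitting_homog.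
  by rewrite scale0r (pihomog_ne0 nel) ?scaler0 ?splitting_homog.
by rewrite eqxx => z; rewrite z eqxx in nz.
Qed.

(** An element acting trivially on V fixes all G-invariants, hence lies in G by [galois_fixed]. *)
Lemma tangent_faithful : mx_faithful rV.
Proof.
apply/subsetP => x; rewrite inE => /andP[/quotient_lift[w wW ->]]; rewrite mul1mx => /eqP x1.
rewrite inE; apply/eqP/coset_id; apply: (galois_fixed ch0 Wt_faithful sGW wW) => p.
case/splitting_gens => P ->; by rewrite tangent_comp // x1 pullback1.
Qed.

Lemma pihomog_splitting r P : pihomog (wdeg d) r (P \mPo f) = pihomog (wdeg e) r P \mPo f.
Proof. exact: pihomog_comp splitting_homogU _ _. Qed.

Lemma tangent_inv P : invariant_poly rV (Wt / G)%g P -> invariant_poly rWt Wt (P \mPo f).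
Proof. by move=> iP w wW; rewrite tangent_comp // iP // quotient_mem. Qed.

(** Averaging a lift does not change its image when that image is already invariant, so invariants
    can be lifted to invariants. *)
Lemma tangent_reyn P : invariant_poly rWt Wt (P \mPo f) -> reyn rV (Wt / G)%G P \mPo f = P \mPo f.
Proof.
move=> iP; rewrite /reyn /gsum comp_mpolyZ (raddf_sum (comp_mpoly f)) /= (eq_bigr (fun=> P \mPo f)); last first.
  by move=> x /quotient_lift[w wW ->]; rewrite -tangent_comp // iP.
by rewrite sumr_const -scaler_nat scalerA mulVf ?scale1r // natr_eq0 // -lt0n cardG_gt0.
Qed.

End Splitting.

Section GoodSubgroup.
Variables (k : fieldType) (ch0 : [pchar k] =i pred0).
Variables (n : nat) (d : 'I_n -> nat) (d_gt0 : forall i, (0 < d i)%N).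
Variables (gT : finGroupType) (Wt G : {group gT}) (rWt : mx_representation k Wt n).
Hypothesis Wt_faithful : mx_faithful rWt.
Hypothesis Wt_blocks : forall w, w \in Wt -> weight_blocks d (rWt w).
Hypothesis G_normal : (G <| Wt)%g.
Variables (m : nat) (e : 'I_m -> nat) (f : m.-tuple {mpoly k[n]}).
Hypothesis f_splitting : is_graded_splitting d rWt G e f.
Variable rV : mx_representation k (Wt / G)%G m.
Hypothesis rV_tangent : is_tangent_repr rWt f rV.
Local Notation W := (Wt / G)%G.
Local Notation I := (relation_ideal f).

Let e_gt0 : forall i, (0 < e i)%N := splitting_weight_gt0 d_gt0 f_splitting.
Let rV_blocks : forall x, x \in W -> weight_blocks e (rV x) := tangent_blocks Wt_blocks f_splitting rV_tangent.
Local Notation AI := (prod_of (pos_part e (fun _ => True)) I).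

Lemma pos_part_True (p : {mpoly k[m]}) : p@_0 = 0 -> pos_part e (fun _ => True) p.
Proof.
move=> p0; rewrite [p](homog_split (leqnn (mmeasure (wdeg e) p))); apply: span_of_sum => r _.
have [r0|r0] := posnP r; last by apply: span_of_gen; split=> //; exists r => //; apply: pihomogP.
by rewrite r0 (pihomog0_const e_gt0) p0 mpolyC0; apply: span_of0.
Qed.

Lemma pos_part_mcoeff0 (p : {mpoly k[m]}) : pos_part e (fun _ => True) p -> p@_0 = 0.
Proof.
move: p; apply: span_of_ind => [|p q p0 q0|a p [_ [r r0 hp]]]; first by rewrite mcoeff0.
  by rewrite mcoeffD p0 q0 addr0.
by rewrite mcoeffZ (homog_mcoeff0 r0 hp) mulr0.
Qed.

Lemma relD p q : I p -> I q -> I (p + q).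
Proof. by rewrite /relation_ideal comp_mpolyD => -> ->; rewrite addr0. Qed.
Lemma relM a p : I p -> I (a * p).
Proof. by rewrite /relation_ideal rmorphM /= => ->; rewrite mulr0. Qed.
Lemma rel_pihomog r p : I p -> I (pihomog (wdeg e) r p).
Proof. by rewrite /relation_ideal -(pihomog_splitting f_splitting) => ->; rewrite raddf0. Qed.
Lemma rel_act x p : x \in W -> I p -> I (pullback (rV x) p).
Proof.
rewrite /relation_ideal => /quotient_lift[w wW ->] p0.
by rewrite -(tangent_comp rV_tangent _ wW) p0 raddf0.
Qed.

Lemma AI_mem a b : a@_0 = 0 -> I b -> AI (a * b).
Proof. by move=> a0 Ib; apply: span_of_gen; exists a, b; split=> //; apply: pos_part_True. Qed.

Hypothesis G_good : is_good f rV e.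

(** Averaging minimal generators over [W] changes them only modulo A_+ I, by goodness. At most [c]
    of the homogeneous components of the averages span I/A_+ I; graded Nakayama shows that they
    generate I, and minimality of [c] forces their number to be [c]. *)
Lemma good_relations : exists c (g : 'I_c -> {mpoly k[m]}), [/\ m = (n + c)%N,
  forall i, invariant_poly rV W (g i),
  forall i, exists2 r, (0 < r)%N & g i \is r.-homog for (wdeg e),
  forall i, g i \mPo f = 0 &
  forall p, p \mPo f = 0 -> exists u, p = \sum_i u i * g i].
Proof.
have [[c [[gam gamP] cmin] mE] triv] := G_good.
have I_gam i : I (gam i) by apply/gamP; apply: ideal_of_gen; exists i.
pose gam' i := reyn rV W (gam i).
have triv_gam i : AI (gam' i - gam i).
  have -> : gam' i - gam i = (#|W|%:R^-1 : k) *: \sum_(x in W) (pullback (rV x) (gam i) - gam i).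
    rewrite sumrB sumr_const scalerBr -[gam i *+ _]scaler_nat scalerA mulVf ?scale1r //.
    exact: card_neq0.
  by apply: span_ofZ; apply: span_of_sum => x xW; apply: triv => //; apply: I_gam.
have I_gam' i : I (gam' i).
  rewrite /gam' /reyn /gsum -mul_mpolyC; apply: relM.
  apply: (big_ind I) => [||x xW]; [exact: comp_mpoly0 | exact: relD | exact: rel_act].
pose N := (\max_i mmeasure (wdeg e) (gam' i))%N.
pose T := ('I_c * 'I_N)%type.
pose S (t : T) := pihomog (wdeg e) t.2 (gam' t.1).
have I_S t : I (S t) by apply: rel_pihomog.
have gam'E i : gam' i = \sum_(r < N) S (i, r) by apply: homog_split; apply: (bigmax_sup i).
have S_gam t : exists a : 'I_c -> k, AI (S t - \sum_i a i *: gam i).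
  have /gamP/ideal_of_fin[a ->] := I_S t; exists (fun i => (a i)@_0).
  rewrite -sumrB; apply: span_of_sum => i _; rewrite -mul_mpolyC -mulrBl.
  by apply: AI_mem => //; rewrite mcoeffB mcoeffC eqxx mulr1 subrr.
have [J [Jc JS]] := spanning_subset (span_of0 _) (@span_ofD _ _ _) (@span_ofZ _ _ _) S_gam.
pose R x := exists a : T -> k, AI (x - \sum_(j in J) a j *: S j).
have RD x y : R x -> R y -> R (x + y).
  move=> [a xa] [b yb]; exists (fun j => a j + b j); under eq_bigr do rewrite scalerDl.
  by rewrite big_split /= opprD addrACA; apply: span_ofD.
have RZ a x : R x -> R (a *: x).
  move=> [b xb]; exists (fun j => a * b j); under eq_bigr do rewrite -scalerA.
  by rewrite -scaler_sumr -scalerBr; apply: span_ofZ.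
have RAI x : AI x -> R x.
  by move=> Ax; exists (fun=> 0); rewrite big1 ?subr0 // => j _; rewrite scale0r.
have R0 : R 0 by apply: RAI; apply: span_of0.
have R_gam i : R (gam i).
  rewrite -[gam i](subKr (gam' i)) -scaleN1r; apply: (RD); last by apply/RZ/RAI.
  by rewrite gam'E; apply: (big_ind R) => // r _; apply: JS.
have R_I x : I x -> R x.
  move/gamP/ideal_of_fin => [a ->]; apply: (big_ind R) => // i _.
  rewrite -[a i](subrK ((a i)@_0)%:MP) mulrDl; apply: (RD); last by rewrite mul_mpolyC; apply: RZ.
  by apply/RAI/AI_mem => //; rewrite mcoeffB mcoeffC eqxx mulr1 subrr.
pose g (i : 'I_#|J|) := S (enum_val i).
have S_J t : t \in J -> ideal_of (fun y => exists i, y = g i) (S t).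
  move=> tJ; apply: ideal_of_gen; exists (enum_rank_in tJ t); by rewrite /g enum_rankK_in.
(* Graded Nakayama: a homogeneous element of [AI] only involves relations of    *)
(* smaller degree.                                                               *)
have nak E : forall p, I p -> p \is E.-homog for (wdeg e) -> ideal_of (fun y => exists i, y = g i) p.
  elim/ltn_ind: E => E IH p Ip hp.
  have [a] := R_I p Ip; set x := p - _ => Ax.
  have pE : p = x + \sum_(j in J) a j *: S j by rewrite subrK.
  rewrite -(pihomog_dE hp) pE raddfD /= raddf_sum; apply: ideal_ofD; last first.
    apply: ideal_of_sum => j jJ; rewrite /= linearZ /= -mul_mpolyC; apply: ideal_ofM.
    have [jE|ne] := eqVneq (j.2 : nat) E; last first.
      by rewrite (pihomog_ne0 ne (pihomogP _ _ _)); apply: ideal_of0.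
    by rewrite -jE pihomog_id; apply: S_J.
  move: (x) Ax; apply: span_of_ind => [|y z Iy Iz|c' _ [b [q [b_pos Iq ->]]]].
  - by rewrite raddf0; apply: ideal_of0.
  - by rewrite raddfD; apply: ideal_ofD.
  rewrite linearZ /= -mul_mpolyC pihomogM; apply/ideal_ofM/ideal_of_sum => r _.
  have [rE|rE] := eqVneq (r : nat) E.
    rewrite rE subnn (pihomog0_const e_gt0) (pos_part_mcoeff0 b_pos) mpolyC0 mul0r.
    exact: ideal_of0.
  apply/ideal_ofM/(IH r); [by rewrite ltn_neqAle rE -ltnS ltn_ord | exact: rel_pihomog | exact: pihomogP].
have gens p : I p -> ideal_of (fun y => exists i, y = g i) p.
  move=> Ip; rewrite [p](homog_split (leqnn (mmeasure (wdeg e) p))).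
  by apply: ideal_of_sum => r _; apply: (nak r); [apply: rel_pihomog | apply: pihomogP].
have cJ : (c <= #|J|)%N.
  apply: cmin; exists g => x; split; first exact: gens.
  by move/ideal_of_fin => [u ->]; apply: (big_ind I) => [||i _]; [exact: comp_mpoly0 | exact: relD | exact/relM/I_S].
have cE : #|J| = c by apply/eqP; rewrite eqn_leq Jc.
exists #|J|, g; split=> [|i|i|i|p Ip]; first by rewrite cE.
- by apply: inv_pihomog => //; apply: reyn_inv.
- have [r0|r0] := posnP (enum_val i).2; last by exists (enum_val i).2 => //; apply: pihomogP.
  (* A component of degree 0 is a constant lying in [I], hence zero, and zero may be assigned degree
     1. *)
  exists 1%N => //; rewrite (_ : g i = 0) ?rpred0 //.
  have gi0 : g i = ((g i)@_0)%:MP.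
    apply: (homog0_const e_gt0).
    have : g i \is ((enum_val i).2 : nat).-homog for (wdeg e) by apply: pihomogP.
    by rewrite r0.
  have : g i \mPo f = 0 by apply: I_S.
  by rewrite gi0 comp_mpolyC => /eqP; rewrite mpolyC_eq0 => /eqP->; rewrite mpolyC0.
- exact: I_S.
- exact: ideal_of_fin (gens p Ip).
Qed.

End GoodSubgroup.

(** By the chain rule, the Jacobian determinants of two systems of generators divide each other. *)
Lemma jacobian_dvd (k : fieldType) n (d : 'I_n -> nat) S (h h' : n.-tuple {mpoly k[n]}) :
  is_polynomial_gens d S h -> is_polynomial_gens d S h' -> dvdm (jacobian h) (jacobian h').
Proof.
move=> [_ _ _ gens] [Sh' _ _ _].
have [P PE] := fin_all_exists (fun i => gens _ (Sh' i)).
exists (\det (\matrix_(i, l) ((P i)^`M(l) \mPo h))); rewrite /jacobian -det_mulmx; congr (\det _).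
apply/matrixP => i j; rewrite !mxE PE mderiv_comp; apply: eq_bigr => l _; by rewrite !mxE.
Qed.

Lemma dvdm_antisym_const (k : fieldType) n (p q : {mpoly k[n]}) :
  p != 0 -> dvdm p q -> dvdm q p -> exists2 c, c != 0 & q = c *: p.
Proof.
move=> p0 [a qE] [b pE]; have ba : b * a = 1.
  by apply: (mulIf p0); rewrite -mulrA -qE -pE mul1r.
have a0 : a != 0 by apply: contra_eq_neq ba => ->; rewrite mulr0 eq_sym oner_eq0.
have b0 : b != 0 by apply: contra_eq_neq ba => ->; rewrite mul0r eq_sym oner_eq0.
have : (msize a <= 1)%N.
  have := msizeM b0 a0; rewrite ba msize1.
  have : (0 < msize b)%N by rewrite lt0n msize_poly_eq0.
  by case: (msize b) => // s _; rewrite addSn /= => ->; apply: leq_addl.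
move/msize1_polyC => aE; exists a@_0; first by apply: contra a0 => /eqP z; rewrite aE z mpolyC0.
by rewrite qE {1}aE mul_mpolyC.
Qed.

(** * Comparison of the Jacobians *)

Section JacobianComparison.
Variables (k : fieldType) (ch0 : [pchar k] =i pred0).
Variables (n : nat) (d : 'I_n -> nat) (d_gt0 : forall i, (0 < d i)%N).
Variables (gT : finGroupType) (Wt G : {group gT}) (rWt : mx_representation k Wt n).
Hypothesis Wt_faithful : mx_faithful rWt.
Hypothesis Wt_blocks : forall w, w \in Wt -> weight_blocks d (rWt w).
Hypothesis G_normal : (G <| Wt)%g.
Variables (c : nat) (e : 'I_(n + c) -> nat) (f : (n + c).-tuple {mpoly k[n]}).
Hypothesis f_splitting : is_graded_splitting d rWt G e f.
Variable rV : mx_representation k (Wt / G)%G (n + c).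
Hypothesis rV_tangent : is_tangent_repr rWt f rV.
Variable g : 'I_c -> {mpoly k[n + c]}.
Hypothesis g_inv : forall i, invariant_poly rV (Wt / G)%g (g i).
Hypothesis g_homog : forall i, exists2 r, (0 < r)%N & g i \is r.-homog for (wdeg e).
Hypothesis g_rel : forall i, g i \mPo f = 0.
Hypothesis g_gens : forall p, p \mPo f = 0 -> exists u, p = \sum_i u i * g i.
Hypothesis G_norefl : forall x, x \in G -> \rank (rWt x - 1%:M) != 1%N.
Variable F : n.-tuple {mpoly k[n]}.
Hypothesis F_gens : is_polynomial_gens d (invariant_poly rWt Wt) F.
Local Notation W := (Wt / G)%G.

Let sGW : G \subset Wt := normal_sub G_normal.
Let e_gt0 : forall i, (0 < e i)%N := splitting_weight_gt0 d_gt0 f_splitting.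
Let rV_blocks : forall x, x \in W -> weight_blocks e (rV x) := tangent_blocks Wt_blocks f_splitting rV_tangent.
Let f_gens := splitting_gens d_gt0 Wt_blocks G_normal f_splitting.
Let f_inv := splitting_inv f_splitting.
Let rV_faithful := tangent_faithful ch0 d_gt0 Wt_faithful Wt_blocks G_normal f_splitting rV_tangent.
Local Notation phi := (comp_mpoly f).

Lemma lifted_invariants : exists h : 'I_n -> {mpoly k[n + c]}, forall i,
  [/\ invariant_poly rV W (h i), h i \mPo f = tnth F i &
    exists2 r, (0 < r)%N & h i \is r.-homog for (wdeg e)].
Proof.
have [D DF] := polynomial_gens_degree d_gt0 F_gens; have [F_inv _ _ _] := F_gens.
suff hP i : exists h, [/\ invariant_poly rV W h, h \mPo f = tnth F i &
    exists2 r, (0 < r)%N & h \is r.-homog for (wdeg e)].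
  by have [h hE] := fin_all_exists hP; exists h.
have [D0 homF] := DF i.
have [|Q QE] := f_gens (p := tnth F i); first by move=> x xG; apply/F_inv/(subsetP sGW).
have Q'E : pihomog (wdeg e) (D i) Q \mPo f = tnth F i.
  by rewrite -(pihomog_splitting f_splitting) -QE pihomog_dE.
exists (reyn rV W (pihomog (wdeg e) (D i) Q)); split; first exact: reyn_inv.
  by rewrite (tangent_reyn ch0 rV_tangent) Q'E.
by exists (D i) => //; apply: reyn_homog (pihomogP _ _ _).
Qed.

Section Lift.
Variable h : 'I_n -> {mpoly k[n + c]}.
Hypothesis h_inv : forall i, invariant_poly rV W (h i).
Hypothesis h_lift : forall i, h i \mPo f = tnth F i.
Hypothesis h_homog : forall i, exists2 r, (0 < r)%N & h i \is r.-homog for (wdeg e).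

Definition lifted_gens : (n + c).-tuple {mpoly k[n + c]} :=
  [tuple match split i with inl j => h j | inr j => g j end | i < n + c].

Lemma lifted_gens_l j : tnth lifted_gens (lshift c j) = h j.
Proof. by rewrite tnth_mktuple (unsplitK (inl _ j)). Qed.
Lemma lifted_gens_r j : tnth lifted_gens (rshift n j) = g j.
Proof. by rewrite tnth_mktuple (unsplitK (inr _ j)). Qed.

Lemma lifted_gens_homog i : exists2 r, (0 < r)%N & tnth lifted_gens i \is r.-homog for (wdeg e).
Proof. by rewrite tnth_mktuple; case: split. Qed.

Lemma lifted_gens_inv i : invariant_poly rV W (tnth lifted_gens i).
Proof. by rewrite tnth_mktuple; case: split. Qed.

(** The image of [p] is a polynomial Q in [F], and p - Q(h) is a relation, hence a combination of
    the [g i]. In positive degree [p] thus lies in the ideal of the lifted generators; averaging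
    makes the coefficients invariant. *)
Lemma lifted_gens_gens p : invariant_poly rV W p -> exists P, p = P \mPo lifted_gens.
Proof.
have [D DP] := fin_all_exists (fun i => let: ex_intro2 r r0 hr := lifted_gens_homog i in ex_intro (fun r => (0 < r)%N /\ tnth lifted_gens i \is r.-homog for (wdeg e)) r (conj r0 hr)).
move: p; apply: (polynomial_in_gens e_gt0 _ (fun i => (DP i).1) (fun i => (DP i).2)) => [r p ip|E p E0 ip hp].
  exact: inv_pihomog.
have [_ _ _ F_gen] := F_gens.
have [Q QE] := F_gen _ (tangent_inv rV_tangent ip).
pose ht := [tuple h i | i < n].
have [u uE] : exists u, p - (Q \mPo ht) = \sum_i u i * g i.
  apply: g_gens; rewrite comp_mpolyB comp_mpolyA QE; apply/eqP; rewrite subr_eq0; apply/eqP.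
  by apply: eq_comp_mpoly => i; rewrite !tnth_mktuple.
have [v vE] := comp_mpoly_sub Q ht [tuple 0 | i < n].
have Q0 : exists q0, Q \mPo [tuple (0 : {mpoly k[n + c]}) | i < n] = q0%:MP.
  elim/mpoly_alg_ind: (Q) => [x|i|p1 p2 [x e1] [y e2]|p1 p2 [x e1] [y e2]].
  - by exists x; rewrite comp_mpolyC.
  - by exists 0; rewrite comp_mpolyXt tnth_mktuple.
  - by exists (x + y); rewrite comp_mpolyD e1 e2 mpolyCD.
  - by exists (x * y); rewrite rmorphM /= e1 e2 mpolyCM.
have [q0 q0E] := Q0.
pose w (i : 'I_(n + c)) := match split i with inl j => v j | inr j => u j end.
have pE : p = q0%:MP + \sum_i w i * tnth lifted_gens i.
  rewrite -[LHS](subrK (Q \mPo ht)) uE -[Q \mPo ht](subrK q0%:MP) -{1}q0E vE.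
  rewrite big_split_ord /=.
  under [X in _ = _ + (X + _)]eq_bigr do rewrite lifted_gens_l /w (unsplitK (inl _ _)).
  under [X in _ = _ + (_ + X)]eq_bigr do rewrite lifted_gens_r /w (unsplitK (inr _ _)).
  under [X in _ + (X + _)]eq_bigr do rewrite !tnth_mktuple subr0.
  by rewrite [LHS]addrC [X in X + _ = _]addrC -addrA.
have q00 : q0 = 0.
  have := congr1 (mcoeff 0%MM) pE; rewrite mcoeffD mcoeffC eqxx mulr1 (homog_mcoeff0 E0 hp).
  rewrite raddf_sum big1 ?addr0 // => i _ /=.
  by rewrite rmorphM /= (homog_mcoeff0 (DP i).1 (DP i).2) mulr0.
exists (fun i => reyn rV W (w i)); split=> [i|]; first exact: reyn_inv.
rewrite -(reyn_id ch0 ip) pE q00 mpolyC0 add0r raddf_sum; apply: eq_bigr => i _ /=.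
by rewrite reynMr //; apply: lifted_gens_inv.
Qed.

Lemma lifted_gens_jacobian : jacobian lifted_gens != 0.
Proof. exact: (polynomial_gens_jacobian ch0 rV_faithful lifted_gens_gens). Qed.

Lemma lifted_gens_polynomial_gens : is_polynomial_gens e (invariant_poly rV W) lifted_gens.
Proof.
split; [exact: lifted_gens_inv | | exact/(jacobian_alg_indep ch0)/lifted_gens_jacobian | exact: lifted_gens_gens].
by move=> i; have [r _ hr] := lifted_gens_homog i; exists r.
Qed.

(** The Jacobian divides a nonzero scalar times a product of nonzero linear forms of V. None of
    these vanishes on the quotient, since the [f i] are linearly independent. *)
Lemma lifted_gens_jacobian_comp : jacobian lifted_gens \mPo f != 0.
Proof.
have [u uu u0] := lin_disc_avoid ch0 rV_faithful (subxx W).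
have [U /(congr1 (fun M => phi (\det M)))] := galois_disc_mx (subxx W) lifted_gens_gens u.
rewrite !det_mulmx det_diag det_map_mx !rmorphM /= comp_mpolyC rmorph_prod => E1.
apply/eqP => J0; move: E1; rewrite (_ : \det (jac_mx lifted_gens) = jacobian lifted_gens) // J0 mulr0.
move/eqP; rewrite mulf_eq0 mpolyC_eq0 => /orP[|/eqP d0]; last by move: uu; rewrite unitmxE unitfE d0 eqxx.
apply/negP/prodf_neq0 => i _; rewrite mxE /= rmorph_prod; apply/prodf_neq0 => x xP /=.
have /prodf_neq0/(_ x xP) := u0 i; rewrite lin_eq0; apply: contra; rewrite comp_lin => /eqP z.
by apply/eqP/rowP => j; rewrite [RHS]mxE; apply: (splitting_free f_splitting z).
Qed.

Let C : 'M_(c, n + c) := \matrix_(i, l) ((g i)^`M(l) \mPo f).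
Let N : 'M_(n + c, n) := jac_mx f.
Let Mf : 'M_(n + c) := map_mx phi (jac_mx lifted_gens).

Let det_Mf : \det Mf = jacobian lifted_gens \mPo f.
Proof. by rewrite det_map_mx. Qed.

Let dsub_Mf : dsubmx Mf = C.
Proof. by apply/matrixP => i l; rewrite !mxE lifted_gens_r. Qed.

Lemma conormal_N : C *m N = 0.
Proof.
apply/matrixP => i j; have := mderiv_comp (g i) f j; rewrite g_rel mderiv0 !mxE => E1.
by rewrite [RHS]E1; apply: eq_bigr => l _; rewrite !mxE.
Qed.

Let usub_Mf_N : usubmx Mf *m N = jac_mx F.
Proof.
apply/matrixP => i j; rewrite !mxE -h_lift mderiv_comp; apply: eq_bigr => l _.
by rewrite !mxE lifted_gens_l.
Qed.

Lemma conormal_cancel (a : 'rV_c) : a *m C = 0 -> a = 0.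
Proof.
move=> aC; have : row_mx 0 a *m Mf = 0.
  by rewrite -[Mf]vsubmxK mul_row_col mul0mx add0r dsub_Mf.
move/left_cancel_det; rewrite det_Mf => /(_ lifted_gens_jacobian_comp) /(congr1 rsubmx).
by rewrite row_mxKr raddf0.
Qed.

Lemma conormal_section b : lin_disc rWt G b != 0 ->
  exists M (R : 'M_(n + c, c)), C *m R = (lin_disc rWt G b ^+ M)%:M.
Proof.
rewrite -lin_discE => D0.
exact: (conormal_splitting sGW f_inv f_gens g_rel g_gens D0 conormal_cancel).
Qed.

(* With [U N = diag(D_i) u] and [C R = D^M], the matrix [(N | R)] is inverted by  *)
(* [(U / C)] up to these discriminants, while [M (N | R)] is block triangular     *)
(* with diagonal blocks [jac F] and [D^M], where [M] is the Jacobian matrix of    *)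
(* the generators [lifted_gens] evaluated at [f].                                 *)
Lemma jacobian_relations (u : 'M[k]_n) b : lin_disc rWt G b != 0 ->
  exists M x y, (jacobian lifted_gens \mPo f) * x = jacobian F * lin_disc rWt G b ^+ M /\
   (jacobian lifted_gens \mPo f) * ((\prod_i lin_disc rWt G (row i u)) * (\det u)%:MP) = y * jacobian F.
Proof.
move=> D0; have [M [R CR]] := conormal_section D0.
have [U UE] := galois_disc_mx sGW f_gens u.
set D := lin_disc rWt G b in D0 CR *.
have MNR : Mf *m row_mx N R = block_mx (jac_mx F) (usubmx Mf *m R) 0 (D ^+ M)%:M.
  by rewrite -{1}[Mf]vsubmxK mul_col_row dsub_Mf usub_Mf_N conormal_N CR.
have UNR : col_mx U C *m row_mx N R =
    block_mx (diag_mx (\row_i lin_disc rWt G (row i u)) *m map_mx (@mpolyC n k) u) (U *m R) 0 (D ^+ M)%:M.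
  by rewrite mul_col_row conormal_N CR UE.
have e1 := congr1 determinant MNR; have e2 := congr1 determinant UNR.
rewrite det_mulmx det_ublock det_scalar -exprM det_Mf in e1.
rewrite !det_mulmx det_ublock det_scalar -exprM det_mulmx det_diag det_map_mx in e2.
rewrite (eq_bigr (fun i => lin_disc rWt G (row i u))) in e2; last by move=> i _; rewrite mxE.
exists (M * c)%N, (\det (row_mx N R)), (\det (col_mx U C)); split=> //.
apply: (@mulIf _ (D ^+ (M * c))); first by rewrite expf_neq0.
by rewrite -mulrA -e2 -[RHS]mulrA -e1 mulrCA.
Qed.

(** This is where the absence of reflections enters: a nonzero 1 - x of rank other than 1 cannot
    have its row space inside a line. *)
Lemma norefl_rank2 x a : x \in G -> x != 1%g -> ~~ (1%:M - rWt x <= (a : 'rV_n))%MS.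
Proof.
move=> xG x1; apply/negP => /mxrankS le; have := G_norefl xG.
have : 1%:M - rWt x != 0.
  by rewrite -(repr_mx1 rWt); apply: faithful_neq => //; [apply: (subsetP sGW) | rewrite eq_sym].
rewrite -mxrank_eq0 -lt0n => r0 /negP; apply; rewrite -mxrank_opp opprB eqn_leq r0 andbT.
exact: leq_trans le (rank_leq_row _).
Qed.

Definition discs (b : 'rV[k]_n) := [seq b *m (1%:M - rWt x) | x <- enum (G :\ 1%g)].

Lemma prod_discs b : \prod_(a <- discs b) lin a = lin_disc rWt G b.
Proof.
rewrite /discs big_map big_enum /=; apply: eq_bigl => x; by rewrite in_setD1 andbC.
Qed.

Lemma discs_basis a : exists2 u : 'M[k]_n, u \in unitmx &
  forall i, all (fun b => ~~ (b <= (a : 'rV_n))%MS) (discs (row i u)).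
Proof.
have [|u uu uP] := @avoid_basis_sub k n {x | x \in G :\ 1%g} (fun x => 1%:M - rWt (val x)) (fun=> a) ch0.
  by case=> x xP; have := xP; rewrite in_setD1 => /andP[x1 xG]; apply: norefl_rank2.
exists u => // i; apply/allP => _ /mapP[x xG ->]; rewrite mem_enum in xG.
exact: (uP i (Sub x xG)).
Qed.

Lemma discs_vector a : exists b, all (fun b => ~~ (b <= (a : 'rV_n))%MS) (discs b).
Proof.
have [|u uP] := @avoid_vector_sub k n {x | x \in G :\ 1%g} (fun x => 1%:M - rWt (val x)) (fun=> a) ch0.
  by case=> x xP; have := xP; rewrite in_setD1 => /andP[x1 xG]; apply: norefl_rank2.
exists u; apply/allP => _ /mapP[x xG ->]; rewrite mem_enum in xG.
exact: (uP (Sub x xG)).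
Qed.

Lemma discs_neq0 b : all (fun a => ~~ (a <= (0 : 'rV_n))%MS) (discs b) -> lin_disc rWt G b != 0.
Proof.
rewrite -prod_discs => /allP nz; rewrite prodf_seq_neq0; apply/allP => a /nz /=.
by rewrite lin_eq0 submx_row0.
Qed.

Let all_neq0 s : all (fun a => ~~ (a <= (0 : 'rV_n))%MS) s = all (fun a : 'rV[k]_n => a != 0) s.
Proof. by apply: eq_all => a; rewrite submx_row0. Qed.

Let jacF0 : jacobian F != 0.
Proof.
by apply: (polynomial_gens_jacobian ch0 Wt_faithful) => p; have [_ _ _] := F_gens; apply.
Qed.

(** Varying the basis [u] in [jacobian_relations] makes the product of discriminants prime to any
    given linear form. *)
Lemma jacobian_dvd_comp : dvdm (jacobian F) (jacobian lifted_gens \mPo f).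
Proof.
have [b /discs_neq0 b0] := discs_vector 0.
pose T := {u : 'M[k]_n | u \in unitmx}.
apply: (@dvdm_lin_coprime k n _ _ T (fun u => flatten [seq discs (row i (val u)) | i <- enum 'I_n])) => //.
- have [u uu uP] := discs_basis 0; exists (Sub u uu).
  rewrite -all_neq0; apply/allP => x /flattenP[s /mapP[i _ ->]]; exact: (allP (uP i)).
- case=> u uu; have [M [_ [y [_ e2]]]] := jacobian_relations u b0.
  have d0 : (\det u)%:MP * ((\det u)^-1)%:MP = 1 :> {mpoly k[n]}.
    by rewrite -mpolyCM mulfV ?mpolyC1 // -unitfE -unitmxE.
  exists (y * ((\det u)^-1)%:MP); rewrite mulrAC -e2 -mulrA -[_ * _%:MP * _]mulrA d0 mulr1.
  congr (_ * _); rewrite big_flatten big_map big_enum /=; apply: eq_bigr => i _; exact: prod_discs.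
- move=> a _; have [u uu uP] := discs_basis a; exists (Sub u uu).
  apply/allP => x /flattenP[s /mapP[i _ ->]]; exact: (allP (uP i)).
Qed.

Lemma comp_dvd_jacobian : dvdm (jacobian lifted_gens \mPo f) (jacobian F).
Proof.
(* The exponent [M] depends on [b], so the family is indexed by the pairs for which the divisibility
   holds. *)
pose T := {bM : 'rV[k]_n * nat | dvdm (jacobian lifted_gens \mPo f) (jacobian F * lin_disc rWt G bM.1 ^+ bM.2)}.
have mkT b : lin_disc rWt G b != 0 -> exists M, dvdm (jacobian lifted_gens \mPo f) (jacobian F * lin_disc rWt G b ^+ M).
  move=> b0; have [M [x [_ [e1 _]]]] := jacobian_relations 1%:M b0.
  by exists M, x; rewrite -e1 mulrC.
have all_nseq_disc (P : pred 'rV[k]_n) M s : all P s -> all P (flatten (nseq M s)).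
  by move=> Ps; elim: M => //= M IH; rewrite all_cat Ps.
apply: (@dvdm_lin_coprime k n _ _ T (fun t => flatten (nseq (sval t).2 (discs (sval t).1)))).
- exact: lifted_gens_jacobian_comp.
- have [b bP] := discs_vector 0; have [M dM] := mkT b (discs_neq0 bP).
  by exists (exist _ (b, M) dM); apply: all_nseq_disc; rewrite -all_neq0.
- case=> -[b M] /= dM; rewrite big_flatten big_nseq /= prod_discs.
  by rewrite -[iter _ _ _]/(iter M (fun x => _ * x) 1) iter_mulr_1.
- move=> a a0; have [b bP] := discs_vector a.
  have b0 : all (fun x => ~~ (x <= (0 : 'rV_n))%MS) (discs b).
    apply: sub_all bP => x; apply: contra; rewrite submx_row0 => /eqP->; exact: sub0mx.
  have [M dM] := mkT b (discs_neq0 b0).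
  by exists (exist _ (b, M) dM); apply: all_nseq_disc.
Qed.

End Lift.
End JacobianComparison.

Lemma jacobian_pullback (k : fieldType) n (M : 'M[k]_n) (F : n.-tuple {mpoly k[n]}) :
  (forall i, pullback M (tnth F i) = tnth F i) ->
  jacobian F = pullback M (jacobian F) * (\det M)%:MP.
Proof.
move=> inv; rewrite /jacobian -(det_map_mx (pullback M)) -(det_map_mx (@mpolyC n k)) -det_mulmx.
congr (\det _); apply/matrixP => i j; rewrite !mxE -{1}inv mderiv_pullback.
by apply: eq_bigr => l _; rewrite !mxE mulrC mul_mpolyC.
Qed.

(** * Automorphisms of finite order *)

Section FiniteOrder.
Variables (k : fieldType) (ch0 : [pchar k] =i pred0) (n : nat).
Variables (gT : finGroupType) (H : {group gT}) (rH : mx_representation k H n).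

Lemma repr_expg_sub1 x i : x \in H -> exists Z, rH (x ^+ i)%g - 1%:M = (rH x - 1%:M) *m Z.
Proof.
move=> xH; elim: i => [|i [Z IH]]; first by exists 0; rewrite expg0 repr_mx1 subrr mulmx0.
exists (rH (x ^+ i)%g + Z); rewrite expgS repr_mxM ?groupX // mulmxDr -IH mulmxBl mul1mx.
by rewrite addrA subrK.
Qed.

(* An automorphism of finite order is semisimple in characteristic 0. *)
Lemma rank_sqr_sub1 x : x \in H ->
  (\rank (rH x - 1%:M)%R <= \rank ((rH x - 1%:M) *m (rH x - 1%:M))%R)%N.
Proof.
move=> xH; set Y := rH x - 1%:M; pose o := #[x]%g.
have xE : rH x = 1%:M + Y by rewrite addrC subrK.
(* The binomial expansion of (1 + Y)^o modulo Y^2; since x^o = 1 and o is invertible, Y becomes a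
   multiple of Y^2. *)
have [Z ZE] : exists Z, rH (x ^+ o)%g = 1%:M + o%:R *: Y + Y *m Y *m Z.
  elim: o => [|i [Z IH]]; first by exists 0; rewrite expg0 repr_mx1 scale0r mulmx0 !addr0.
  exists (i%:R%:M + Z + Z *m Y); rewrite expgSr repr_mxM ?groupX //.
  rewrite xE IH; clearbody Y.
  rewrite mulmxDr mulmx1 !mulmxDl mul1mx -scalemxAl.
  rewrite !mulmxDr mul_mx_scalar -natr1 scalerDl scale1r !mulmxA.
  by rewrite -!addrA; congr (_ + (_ + _)); rewrite addrCA [X in Y + X]addrCA.
rewrite expg_order repr_mx1 in ZE; have o0 : o%:R != 0 :> k by rewrite natr_eq0 // -lt0n order_gt0.
have YE : Y = - (o%:R^-1) *: (Y *m Y *m Z).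
  apply: (scalerI o0).
  rewrite scalerA mulrN mulfV // scaleN1r; apply/eqP.
  by rewrite -addr_eq0; apply/eqP/(addrI 1%:M); rewrite addr0 addrA -ZE.
rewrite {1}YE; apply: leq_trans (mxrank_scale _ _) _; exact: mxrankM_maxl.
Qed.

End FiniteOrder.

(** * Images of reflections *)

Section Reflections.
Variables (k : fieldType) (ch0 : [pchar k] =i pred0) (n : nat).
Variables (gT : finGroupType) (Wt G : {group gT}) (rWt : mx_representation k Wt n).
Hypothesis Wt_faithful : mx_faithful rWt.
Hypothesis G_normal : (G <| Wt)%g.
Variables (c : nat) (f : (n + c).-tuple {mpoly k[n]}).
Hypothesis f_gens : forall p, invariant_poly rWt G p -> exists P, p = P \mPo f.
Variable rV : mx_representation k (Wt / G)%G (n + c).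
Hypothesis rV_faithful : mx_faithful rV.
Hypothesis rV_tangent : is_tangent_repr rWt f rV.
Variable g : 'I_c -> {mpoly k[n + c]}.
Hypothesis g_inv : forall i, invariant_poly rV (Wt / G)%g (g i).
Hypothesis g_rel : forall i, g i \mPo f = 0.
Let C : 'M_(c, n + c) := \matrix_(i, l) ((g i)^`M(l) \mPo f).
Let N : 'M_(n + c, n) := jac_mx f.
Hypothesis conormal_sec : forall b, lin_disc rWt G b != 0 ->
  exists M (R : 'M_(n + c, c)), C *m R = (lin_disc rWt G b ^+ M)%:M.
Hypothesis rank2 : forall x, x \in G -> x != 1%g -> (1 < \rank (rWt x - 1%:M)%R)%N.
Let sGW : G \subset Wt := normal_sub G_normal.

Variable s : gT.
Hypothesis sW : s \in Wt.
Hypothesis s_refl : \rank (rWt s - 1%:M) = 1%N.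

(** The hyperplane of [s] lies in no fixed space of an x <> 1 in G, because such a space has
    codimension at least 2. A vector of the hyperplane then avoids these finitely many subspaces. *)
Lemma generic_fixed_point : exists v : 'cV[k]_n, rWt s *m v = v /\
  forall x, x \in G -> x != 1%g -> (1%:M - rWt x) *m v != 0.
Proof.
have [u [a [_ a0 sE]]] := rank1_factor s_refl.
pose Kt : 'M_n := (kermx a^T)^T.
have aK : a *m Kt = 0 by apply: trmx_inj; rewrite trmx_mul trmxK mulmx_ker trmx0.
have [|z zP] := @avoid_vector_sub k n {x | x \in (G :\ 1)%g}
    (fun x => ((1%:M - rWt (val x)) *m Kt)^T) (fun=> 0) ch0.
  case=> x xP; have := xP; rewrite in_setD1 submx_row0 /= => /andP[x1 xG].
  apply/eqP => /(congr1 trmx); rewrite trmxK trmx0 => z.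
  have /mxrankS : (kermx a^T <= kermx (1%:M - rWt x)^T)%MS.
    by apply/sub_kermxP; apply: trmx_inj; rewrite trmx_mul trmxK z trmx0.
  rewrite !mxrank_ker !mxrank_tr leq_sub2lE ?rank_leq_row // => le.
  have := rank2 xG x1; rewrite -mxrank_opp opprB ltnNge => /negP; apply.
  exact: leq_trans le (rank_leq_row _).
exists (Kt *m z^T); split=> [|x xG x1].
  by apply/eqP; rewrite -subr_eq0 -{2}(mul1mx (Kt *m _)) -mulmxBl sE -mulmxA (mulmxA a) aK mul0mx mulmx0.
have xP : x \in (G :\ 1)%g by rewrite in_setD1 x1.
have := zP (Sub x xP); rewrite submx_row0; apply: contra => /eqP z0.
by apply/eqP/trmx_inj; rewrite trmx_mul trmxK /= -mulmxA z0 trmx0.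
Qed.

(* At a fixed point [v] of [s] with trivial stabilizer in [G], [im N(v)] is the    *)
(* kernel of [C(v)]; it carries the action of [s], and [coset G s] acts trivially  *)
(* on the quotient because the [g_i] are invariant.                                *)
Lemma tangent_reflection : \rank (rV (coset G s) - 1%:M) = 1%N.
Proof.
have [v [sv vG]] := generic_fixed_point.
pose ev : {rmorphism {mpoly k[n]} -> k} := meval (fun i => v i 0).
have [|u uu uP] := @avoid_basis k n {x | x \in (G :\ 1)%g} (fun x => (1%:M - rWt (val x)) *m v) ch0.
  by case=> x xP; have := xP; rewrite in_setD1 => /andP[x1 xG]; apply: vG.
have [|b bP] := @avoid_vector k n {x | x \in (G :\ 1)%g} (fun x => (1%:M - rWt (val x)) *m v) ch0.
  by case=> x xP; have := xP; rewrite in_setD1 => /andP[x1 xG]; apply: vG.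
have ev_disc (a : 'rV_n) : (forall x, x \in (G :\ 1)%g -> a *m ((1%:M - rWt x) *m v) != 0) ->
    ev (lin_disc rWt G a) != 0.
  move=> aP; rewrite rmorph_prod; apply/prodf_neq0 => x xP.
  rewrite /= meval_lin; have xG1 : x \in (G :\ 1)%g by rewrite in_setD1 andbC.
  apply: contra (aP x xG1) => /eqP z; apply/eqP/matrixP => i j; rewrite !ord1 mulmxA !mxE -[RHS]z.
  by apply: eq_bigr => l _; rewrite !mxE.
have Db : ev (lin_disc rWt G b) != 0 by apply: ev_disc => x xP; exact: (bP (Sub x xP)).
have D0 : lin_disc rWt G b != 0 by apply: contraNneq Db => ->; rewrite rmorph0.
have [M [R CR]] := conormal_sec D0; have [U UE] := galois_disc_mx sGW f_gens u.
pose Cv := map_mx ev C; pose Nv := map_mx ev N; pose Rv := map_mx ev R; pose Uv := map_mx ev U.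
have CRv : Cv *m Rv = (ev (lin_disc rWt G b) ^+ M)%:M.
  by rewrite -map_mxM CR map_scalar_mx rmorphXn.
have CNv : Cv *m Nv = 0.
  rewrite -map_mxM; apply/matrixP => i j; rewrite !mxE -[RHS](rmorph0 ev); congr (ev _).
  have := mderiv_comp (g i) f j; rewrite g_rel mderiv0 => E1.
  by rewrite [RHS]E1; apply: eq_bigr => l _; rewrite !mxE.
have UNv : Uv *m Nv \in unitmx.
  rewrite -map_mxM -UE map_mxM map_diag_mx -map_mx_comp unitmx_mul; apply/andP; split.
    rewrite unitmxE det_diag unitfE; apply/prodf_neq0 => i _; rewrite !mxE; apply: ev_disc => x xP.
    exact: (uP i (Sub x xP)).
  rewrite (_ : map_mx _ u = u) //; apply/matrixP => i j; by rewrite mxE /= mevalC.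
(* At [v], the tangent space of V is the direct sum of the images of [Nv] and [Rv], and [Cv] kills
   the first. *)
have NRv : row_mx Nv Rv \in unitmx.
  have : \det (col_mx Uv Cv *m row_mx Nv Rv) != 0.
    rewrite mul_col_row CNv CRv det_ublock mulf_neq0 //; first by rewrite -unitfE -unitmxE.
    by rewrite det_scalar !expf_neq0.
  by rewrite det_mulmx mulf_eq0 negb_or => /andP[_]; rewrite -unitfE -unitmxE.
set x := coset G s; have xW : x \in (Wt / G)%g by apply: mem_quotient.
have ev_s p : ev (pullback (rWt s) p) = ev p.
  by rewrite /ev /= meval_pullback sv.
have CY : Cv *m (rV x - 1%:M) = 0.
  rewrite mulmxBr mulmx1; apply/eqP; rewrite subr_eq0; apply/eqP/matrixP => i l; rewrite !mxE.
  rewrite -[in RHS](g_inv i xW) mderiv_pullback (raddf_sum (comp_mpoly f)) rmorph_sum.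
  apply: eq_bigr => l' _; rewrite !mxE /= linearZ /= -(tangent_comp rV_tangent _ sW).
  by rewrite mevalZ mulrC; congr (_ * _); apply/esym/ev_s.
have YN : (rV x - 1%:M) *m Nv = Nv *m (rWt s - 1%:M).
  rewrite mulmxBr mulmxBl mul1mx mulmx1; congr (_ - _); apply/matrixP => i j; rewrite !mxE.
  have := congr1 (mderiv j) (rV_tangent sW i); rewrite mderiv_pullback raddf_sum.
  move/(congr1 ev); rewrite !rmorph_sum => E1.
  transitivity (\sum_l ev (mderiv j (rV (coset G s) i l *: tnth f l))).
    by apply: eq_bigr => l _; rewrite /= mderivZ mevalZ !mxE.
  rewrite -E1; apply: eq_bigr => l _; rewrite /= mevalZ !mxE mulrC; congr (_ * _); exact: ev_s.
set Y := rV x - 1%:M in CY YN *.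
pose Z := invmx (row_mx Nv Rv) *m Y.
have YE : Y = Nv *m usubmx Z + Rv *m dsubmx Z.
  by rewrite -mul_row_col vsubmxK mulKVmx.
have Zd : dsubmx Z = 0.
  have := CY; rewrite YE mulmxDr !mulmxA CNv mul0mx add0r CRv mul_scalar_mx => /eqP.
  by rewrite scaler_eq0 expf_eq0 (negbTE Db) andbF /= => /eqP.
rewrite Zd mulmx0 addr0 in YE.
(* [Y] has image in that of [Nv], where it acts as s - 1, so Y^2 factors through a matrix of rank 1;
   semisimplicity bounds the rank of [Y] itself. *)
apply/eqP; rewrite eqn_leq; apply/andP; split.
  apply: leq_trans (rank_sqr_sub1 ch0 rV xW) _; rewrite -/Y {2}YE mulmxA YN -!mulmxA.
  apply: leq_trans (mxrankM_maxr _ _) _; apply: leq_trans (mxrankM_maxl _ _) _.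
  by rewrite s_refl.
rewrite lt0n mxrank_eq0 /Y -(repr_mx1 rV); apply: faithful_neq => //.
apply/eqP => /coset_idr; rewrite (subsetP (normal_norm G_normal)) // => /(_ isT) sG.
have [s1|s1] := eqVneq s 1%g; first by move: s_refl; rewrite s1 repr_mx1 subrr mxrank0.
by have := rank2 sG s1; rewrite s_refl.
Qed.

(** A power of [s] lying in G differs from 1 by a matrix of rank at most 1, hence is trivial. *)
Lemma coset_reflection_order : #[coset G s]%g = #[s]%g.
Proof.
have sN : s \in 'N(G)%g by rewrite (subsetP (normal_norm G_normal)).
apply/eqP; rewrite eqn_dvd; apply/andP; split; first by rewrite morph_order.
rewrite order_dvdn; set i := #[coset G s]%g; have siG : (s ^+ i)%g \in G.
  by apply: coset_idr; rewrite ?groupX // morphX // expg_order.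
apply/negPn/negP => si1; have := rank2 siG si1; have [Z ->] := repr_expg_sub1 rWt i sW.
by rewrite ltnNge (leq_trans (mxrankM_maxl _ _)) // s_refl.
Qed.

End Reflections.

(** * Generation by double reflections *)

Lemma lin_prod_dvd (k : fieldType) n (T : eqType) (r : seq T) (F : T -> 'rV[k]_n) y :
  uniq r -> (forall t, t \in r -> F t != 0) -> (forall t, t \in r -> dvdm (lin (F t)) y) ->
  (forall t t', t \in r -> t' \in r -> t != t' -> ~~ (F t' <= F t)%MS) ->
  dvdm (\prod_(t <- r) lin (F t)) y.
Proof.
elim: r => [|t r IH] /=; first by rewrite big_nil => *; exists y; rewrite mulr1.
case/andP=> tr ur nz dv np; rewrite big_cons.
have [|||q qE] := IH ur.
- by move=> u ur'; apply: nz; rewrite in_cons ur' orbT.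
- by move=> u ur'; apply: dv; rewrite in_cons ur' orbT.
- by move=> u u' ur1 ur2; apply: np; rewrite in_cons ?ur1 ?ur2 orbT.
have t0 := nz t (mem_head _ _).
have nd : ~ dvdm (lin (F t)) (\prod_(u <- r) lin (F u)).
  rewrite big_seq; apply: (big_ind (fun x => ~ dvdm (lin (F t)) x)) => [|x x' nx nx'|u ur'].
  - exact: lin_ndvd1.
  - by case/(lin_prime t0).
  move/(lin_dvd_lin t0); apply/negP; apply: np; rewrite ?in_cons ?eqxx ?ur' ?orbT //.
  by apply: contraNneq tr => ->.
have := dv t (mem_head _ _); rewrite qE => /(lin_prime t0)[[q' ->]|//].
by exists q'; rewrite mulrA.
Qed.

Section DoubleReflections.
Variables (k : fieldType) (ch0 : [pchar k] =i pred0) (n m : nat).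
Variables (gT : finGroupType) (Wt G : {group gT}) (rWt : mx_representation k Wt n).
Hypothesis Wt_faithful : mx_faithful rWt.
Hypothesis G_normal : (G <| Wt)%g.
Variables (f : m.-tuple {mpoly k[n]}).
Hypothesis f_gens : forall p, invariant_poly rWt G p -> exists P, p = P \mPo f.
Hypothesis f_inv : forall i, invariant_poly rWt G (tnth f i).
Hypothesis f_free : forall c : 'I_m -> k, \sum_i c i *: tnth f i = 0 -> forall i, c i = 0.
Hypothesis f_mcoeff0 : forall i, (tnth f i)@_0 = 0.
Variable rV : mx_representation k (Wt / G)%G m.
Hypothesis rV_tangent : is_tangent_repr rWt f rV.
Hypothesis rank2 : forall x, x \in G -> x != 1%g -> (1 < \rank (rWt x - 1%:M)%R)%N.
Variable A : {set gT}.
Hypothesis A_sub : A \subset Wt.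
Hypothesis A_gen : <<A>>%g = Wt.
Hypothesis A_refl : forall s, s \in A -> \rank (rWt s - 1%:M) = 1%N.
Hypothesis A_tangent : forall s, s \in A -> \rank (rV (coset G s) - 1%:M) = 1%N.
Let sGW : G \subset Wt := normal_sub G_normal.

Definition double_refl : {set gT} := [set x in G | \rank (rWt x - 1%:M)%R == 2%N].
Local Notation G' := <<double_refl>>%G.

Let sG'G : G' \subset G.
Proof. by rewrite gen_subG; apply/subsetP => x; rewrite inE => /andP[]. Qed.
Let sG'W : G' \subset Wt := subset_trans sG'G sGW.

Lemma double_refl_norm : Wt \subset 'N(G')%g.
Proof.
apply: subset_trans (norm_gen _); apply/subsetP => w wW; rewrite inE.
apply/subsetP => y /imsetP[x xD ->]; move: xD; rewrite !inE => /andP[xG /eqP x2].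
have xwG : (x ^ w)%g \in G by rewrite memJ_norm ?(subsetP (normal_norm G_normal)).
have xW := subsetP sGW x xG; rewrite xwG /= eqn_leq; apply/andP; split.
  have -> : rWt (x ^ w)%g - 1%:M = rWt w^-1%g *m (rWt x - 1%:M) *m rWt w.
    by rewrite mulmxBr mulmxBl mulmx1 -!repr_mxM ?groupM ?groupV // mulVg repr_mx1 conjgE mulgA.
  by apply: leq_trans (mxrankM_maxl _ _) _; apply: leq_trans (mxrankM_maxr _ _) _; rewrite x2.
apply: rank2 => //; rewrite conjg_eq1; apply: contra_eq_neq x2 => ->.
by rewrite repr_mx1 subrr mxrank0.
Qed.

Lemma rank_sub_repr x y : x \in Wt -> y \in Wt ->
  \rank (rWt (x * y^-1)%g - 1%:M) = \rank (rWt x - rWt y).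
Proof.
move=> xW yW; have <- : (rWt (x * y^-1)%g - 1%:M) *m rWt y = rWt x - rWt y.
  by rewrite mulmxBl mul1mx -repr_mxM ?groupM ?groupV // mulgKV.
by rewrite mxrankMfree // row_free_unit repr_mx_unit.
Qed.

Section OneReflection.
Variable s : gT.
Hypothesis sA : s \in A.
Let sW : s \in Wt := subsetP A_sub s sA.

(** The elements of G agreeing with [s] on a hyperplane. They give the factors of the product in
    [tangent_form_prod] that no choice of b moves, and they all lie in G' ([S_double]). *)
Let Sset : {set gT} := [set x in G | \rank (rWt s - rWt x)%R == 1%N].

Let rank_gt1 x : x \in G -> x \notin Sset -> (1 < \rank (rWt s - rWt x)%R)%N.
Proof.
move=> xG; rewrite inE xG /= => ne1; rewrite ltn_neqAle eq_sym ne1 lt0n mxrank_eq0.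
apply: faithful_neq => //; first exact: (subsetP sGW).
apply: contraTneq xG => <-; apply/negP => sG.
have [s1|s1] := eqVneq s 1%g; first by have := A_refl sA; rewrite s1 repr_mx1 subrr mxrank0.
by have := rank2 sG s1; rewrite A_refl.
Qed.

Let S_double x : x \in Sset -> x \in G'.
Proof.
rewrite inE => /andP[xG /eqP r1]; have [->|x1] := eqVneq x 1%g; first exact: group1.
apply: mem_gen; rewrite inE xG eqn_leq rank2 // andbT.
have -> : rWt x - 1%:M = - (rWt s - rWt x) + (rWt s - 1%:M) by rewrite opprB addrA subrK.
by apply: leq_trans (mxrank_add _ _) _; rewrite mxrank_opp r1 A_refl.
Qed.

(** [al] is the image in B of the linear form of V that defines the hyperplane of [coset G s]. *)
Lemma tangent_form : exists al : {mpoly k[n]}, [/\ al != 0, invariant_poly rWt G al, al@_0 = 0 &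
  forall p, invariant_poly rWt G p -> dvdm al (pullback (rWt s) p - p)].
Proof.
have [u [a [_ a0 sE]]] := rank1_factor (A_tangent sA).
exists (lin a \mPo f); split.
- rewrite comp_lin; apply: contra a0 => /eqP/f_free z; apply/eqP/rowP => i; by rewrite z mxE.
- rewrite comp_lin; apply: inv_sum => i _; exact: invZ.
- by rewrite comp_lin raddf_sum big1 // => i _; rewrite /= mcoeffZ f_mcoeff0 mulr0.
move=> p /f_gens[P ->]; rewrite (tangent_comp rV_tangent) // -comp_mpolyB.
rewrite -{2}(pullback1 P); have [|q ->] := @pullback_sub_dvd _ _ (rV (coset G s)) 1%:M a P.
  by rewrite sE submxMl.
by exists (q \mPo f); rewrite rmorphM.
Qed.

(* Modulo [al], the polynomial [galois_poly G b] is fixed by [s], hence has the    *)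
(* root [s b].                                                                     *)
Lemma tangent_form_prod (al : {mpoly k[n]}) :
  (forall p, invariant_poly rWt G p -> dvdm al (pullback (rWt s) p - p)) ->
  forall b, dvdm al (\prod_(x in G) lin (b *m (rWt s - rWt x))).
Proof.
move=> al_dvd b; pose B := lin b; pose P := galois_poly G (ract rWt) B.
have -> : \prod_(x in G) lin (b *m (rWt s - rWt x)) = P.[ract rWt s B] - (map_poly (ract rWt s) P).[ract rWt s B].
  rewrite horner_map galois_poly_root1; last exact: ract1.
  rewrite raddf0 subr0 /P /galois_poly horner_prod; apply: eq_bigr => x _.
  by rewrite hornerXsubC /ract /= !pullback_lin -raddfB mulmxBr.
rewrite (@horner_coef_wide _ (size P) (map_poly _ _)) ?size_poly // horner_coef -sumrB.
apply: dvdm_sum => i _; rewrite coef_map -mulrBl; apply: dvdm_mulr.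
rewrite -opprB; apply/dvdmN/al_dvd => x xG; exact: (galois_poly_coef_inv (ractM rWt sGW) B i xG).
Qed.

(** By [tangent_form_prod], [al] divides a product of linear forms. Those with x outside [Sset] can
    be avoided by varying b, so [al] divides the product of the fixed forms [ell x]. Each [ell x]
    divides s p - p because x in G' fixes p, and they are pairwise non-proportional because G
    contains no reflection. *)
Lemma reflection_sub_dvd (al p : {mpoly k[n]}) : al != 0 ->
  (forall q, invariant_poly rWt G q -> dvdm al (pullback (rWt s) q - q)) ->
  invariant_poly rWt G' p -> dvdm al (pullback (rWt s) p - p).
Proof.
move=> al0 al_dvd ip.
have fac x : exists ul : 'cV[k]_n * 'rV[k]_n, x \in Sset -> ul.2 != 0 /\ rWt s - rWt x = ul.1 *m ul.2.
  case: (boolP (x \in Sset)) => [|_]; last by exists (0, 0).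
  by rewrite inE => /andP[_ /eqP/rank1_factor[u [a [_ a0 e]]]]; exists (u, a).
have [ul ulP] := fin_all_exists fac.
pose ell x := (ul x).2.
have beta_dvd : dvdm (\prod_(x <- enum Sset) lin (ell x)) (pullback (rWt s) p - p).
  apply: lin_prod_dvd => [|x|x|x y]; rewrite ?enum_uniq // !mem_enum.
  - by case/ulP.
  - move=> xS; have [_ e] := ulP x xS.
    rewrite -{2}(ip x (S_double xS)); apply: pullback_sub_dvd; by rewrite e submxMl.
  move=> xS yS xy; have [x0 ex] := ulP x xS; have [y0 ey] := ulP y yS.
  have [/andP[xG _] /andP[yG _]] : (x \in G) && true /\ (y \in G) && true.
    by move: xS yS; rewrite !inE => /andP[-> _] /andP[-> _].
  apply/negP => /sub_rVP[c cE].
  have xyG : (x * y^-1)%g \in G by rewrite groupM ?groupV.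
  have xy1 : (x * y^-1)%g != 1%g by rewrite -eq_mulgV1.
  have := rank2 xyG xy1; rewrite rank_sub_repr ?(subsetP sGW) // ltnNge => /negP; apply.
  have -> : rWt x - rWt y = (rWt s - rWt y) - (rWt s - rWt x) by rewrite opprB [RHS]addrC addrA subrK.
  rewrite ex ey -[(ul y).2]/(ell y) cE -scalemxAr -[X in _ - X]/(_ *m ell x) scalemxAl -mulmxBl.
  by apply: leq_trans (mxrankM_maxr _ _) (rank_leq_row _).
apply: dvdm_trans beta_dvd.
pose T := {b : 'rV[k]_n | forall x, x \in Sset -> b *m (rWt s - rWt x) != 0}.
have avoid (a : 'rV_n) : exists t : T, all (fun b => ~~ (b <= a)%MS) [seq sval t *m (rWt s - rWt x) | x <- enum (G :\: Sset)].
  have [|b bP] := @avoid_vector_sub k n {x | x \in G} (fun x => rWt s - rWt (val x))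
      (fun x => if val x \in Sset then 0 else a) ch0.
    case=> x xG /=; case: ifP => [xS|/negbT xS].
      by rewrite submx_row0 -mxrank_eq0; move: xS; rewrite inE => /andP[_ /eqP->].
    apply/negP => /mxrankS le; have := rank_gt1 xG xS; rewrite ltnNge => /negP; apply.
    exact: leq_trans le (rank_leq_row _).
  have bS x : x \in Sset -> b *m (rWt s - rWt x) != 0.
    move=> xS; have xG : x \in G by move: xS; rewrite inE => /andP[].
    by have := bP (Sub x xG); rewrite /= xS submx_row0.
  exists (exist _ b bS); apply/allP => y /mapP[x xE ->]; move: xE; rewrite mem_enum inE => /andP[xS xG] /=.
  by have := bP (Sub x xG); rewrite /= (negbTE xS).
apply: (@dvdm_lin_coprime k n _ _ T (fun t => [seq sval t *m (rWt s - rWt x) | x <- enum (G :\: Sset)])) => //.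
- have [t tP] := avoid 0; exists t; apply: sub_all tP => a; by rewrite submx_row0.
- case=> b bS; rewrite big_map [X in dvdm _ (_ * X)]big_enum /=.
  have := tangent_form_prod al_dvd b; rewrite (bigID (mem Sset)) /=.
  have -> : \prod_(x in G | x \notin Sset) lin (b *m (rWt s - rWt x)) =
            \prod_(x in G :\: Sset) lin (b *m (rWt s - rWt x)).
    by apply: eq_bigl => x; rewrite in_setD andbC.
  set E := \prod_(x in G :\: Sset) _.
  (* For x in [Sset] the form depends on b only through the scalar [lam x], nonzero by the choice of
     b. *)
  pose lam x := (b *m (ul x).1) 0 0.
  have -> : \prod_(x in G | x \in Sset) lin (b *m (rWt s - rWt x)) =
      (\prod_(x in Sset) lam x)%:MP * \prod_(x <- enum Sset) lin (ell x).
    rewrite big_enum /= rmorph_prod -big_split /=; apply: eq_big => [x|x /andP[_ xS]].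
      by rewrite andb_idl // inE => /andP[].
    have [_ ->] := ulP x xS; rewrite mulmxA [b *m _]mx11_scalar mul_scalar_mx linearZ /=.
    by rewrite mul_mpolyC.
  have lam0 : \prod_(x in Sset) lam x != 0.
    apply/prodf_neq0 => x xS; have := bS x xS; have [_ ->] := ulP x xS.
    by rewrite mulmxA [b *m _]mx11_scalar mul_scalar_mx; apply: contra => /eqP z; rewrite /lam in z; rewrite z scale0r.
  move=> [q qE]; exists ((\prod_(x in Sset) lam x)^-1%:MP * q).
  by rewrite -mulrA -qE !mulrA -mpolyCM mulVf // mpolyC1 mul1r.
Qed.

End OneReflection.

(* A nonzero [p] of least degree is fixed by every reflection [s], since [s p - p] *)
(* is divisible by an invariant form of positive degree.                           *)
Lemma double_refl_invariants N p : (msize p < N)%N ->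
  invariant_poly rWt G' p -> gsum rWt G p = 0 -> p = 0.
Proof.
elim: N p => // N IH p; rewrite ltnS => sp ip tr0.
have fixA s : s \in A -> pullback (rWt s) p = p.
  move=> sA; have sW := subsetP A_sub s sA.
  have [al [al0 ial alz al_dvd]] := tangent_form sA.
  have [q qE] := reflection_sub_dvd sA al0 al_dvd ip.
  apply/eqP; rewrite -subr_eq0 qE; have [->|q0] := eqVneq q 0; first by rewrite mul0r.
  rewrite (IH q) ?mul0r //.
  - apply: leq_trans sp; have : (msize (q * al) <= msize p)%N.
      rewrite -qE; apply: leq_trans (mmeasureD_le _ _ _) _.
      by rewrite mmeasureN geq_max msize_pullback leqnn.
    have al2 : (1 < msize al)%N.
      rewrite ltnNge; apply/negP => /msize1_polyC e; move: al0; by rewrite e alz mpolyC0 eqxx.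
    rewrite msizeM //; apply: leq_trans; move: al2; case: (msize al) => [|[|t]] // _.
    by rewrite !addnS /= ltnS leq_addr.
  (* The quotient [q] inherits invariance under G' because [s] normalizes G'. *)
  - move=> x xG'; have xW := subsetP sG'W x xG'; have xG := subsetP sG'G x xG'.
    apply: (mulIf al0); rewrite -{1}(ial x xG) -rmorphM -qE raddfB /= (ip x xG'); congr (_ - _).
    have xs : (x ^ s^-1)%g \in G' by rewrite memJ_norm // groupV (subsetP double_refl_norm).
    by rewrite (actM rWt p sW xW) conjgCV -(actM rWt p (subsetP sG'W _ xs) sW) ip.
  (* The trace of [q] vanishes because [al] is G-invariant and [s] normalizes G. *)
  - apply: (mulIf al0); rewrite mul0r -gsumMr // -qE /gsum.
    under eq_bigr do rewrite raddfB /=.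
    rewrite sumrB -/(gsum rWt G p) tr0 subr0.
    transitivity (pullback (rWt s) (gsum rWt G p)); last by rewrite tr0 raddf0.
    rewrite /gsum (raddf_sum (pullback (rWt s))) [LHS](reindex_inj (conjg_inj s)) /=.
    apply: eq_big => [x|x xG]; first by rewrite memJ_norm ?(subsetP (normal_norm G_normal)).
    have xW : x \in Wt by move: xG; rewrite memJ_norm ?(subsetP (normal_norm G_normal)) // => /(subsetP sGW).
    by rewrite !actM ?groupJ // -conjgC.
have fixW w : w \in Wt -> pullback (rWt w) p = p.
  move=> wW; have : w \in <<A>>%g by rewrite A_gen.
  move: w {wW}; apply: gen_ind => [|x s xA sA IHx]; first exact: act1.
  have xW : x \in Wt by rewrite -A_gen.
  by rewrite -(actM rWt) ?(subsetP A_sub s sA) // IHx fixA.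
have : gsum rWt G p = #|G|%:R *: p.
  by apply: gsum_id => x xG; apply/fixW/(subsetP sGW).
rewrite tr0 => /esym/eqP; rewrite scaler_eq0 natr_eq0 // -[_ == 0%N]negbK -lt0n cardG_gt0 /=.
by move/eqP.
Qed.

(** For p invariant under G', p minus its G-average has zero trace and so vanishes. Thus G' and G
    have the same invariants, and [galois_fixed] gives equality. *)
Lemma double_refl_gen : <<double_refl>>%g = G.
Proof.
apply/eqP; rewrite eqEsubset sG'G; apply/subsetP => w wG.
apply: (galois_fixed ch0 Wt_faithful sG'W (subsetP sGW w wG)) => p ip.
have /eqP : p - reyn rWt G p = 0.
  apply: (double_refl_invariants (ltnSn _)).
    by apply: invB => // x xG'; apply: reyn_inv => //; apply: (subsetP sG'G).
  rewrite /gsum; under eq_bigr do rewrite raddfB /=.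
  rewrite sumrB -/(gsum rWt G p) -/(gsum rWt G (reyn rWt G p)) (gsum_id (reyn_inv rWt sGW p)) /reyn scalerA.
  by rewrite mulfV ?scale1r ?subrr // card_neq0.
by rewrite subr_eq0 => /eqP->; apply: reyn_inv.
Qed.

End DoubleReflections.

(** * Assembly of the four assertions *)

Theorem mainTheorem6
  (k : fieldType) (k_char0 : [pchar k] =i pred0)
  (n : nat) (d : 'I_n -> nat) (d_gt0 : forall i, (0 < d i)%N)
  (gT : finGroupType) (Wt G : {group gT})
  (rWt : mx_representation k Wt n)
  (Wt_faithful : mx_faithful rWt)
  (Wt_graded : forall w, w \in Wt -> GL_grad d (rWt w))
  (Wt_refl : <<reflections rWt 1 Wt>>%g = Wt)
  (G_normal : (G <| Wt)%g)
  (m : nat) (e : 'I_m -> nat) (f : m.-tuple {mpoly k[n]})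
  (f_splitting : is_graded_splitting d rWt G e f)
  (rV : mx_representation k (Wt / G)%G m)
  (rV_tangent : is_tangent_repr rWt f rV)
  (G_good : is_good f rV e)
  (G_norefl : reflections rWt 1 G = set0) :
  [/\ <<reflections rWt 2 G>>%g = G,
      forall s, s \in reflections rWt 1 Wt ->
        coset G s \in reflections rV 1 (Wt / G)%g /\ #[coset G s]%g = #[s]%g,
      forall g, g \in G -> \det (rWt g) = 1
    & forall b : {mpoly k[n]},
        ideal_of (fun x => exists2 a, jacobian_ideal e (invariant_poly rV (Wt / G)%g) a
                                    & x = a \mPo f) b
        <-> jacobian_ideal d (invariant_poly rWt Wt) b].
Proof.
pose A := reflections rWt 1 Wt.
have A_sub : A \subset Wt by apply/subsetP => s; rewrite inE => /andP[].
have A_refl s : s \in A -> \rank (rWt s - 1%:M) = 1%N.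
  by rewrite inE fix_codimE => /andP[_ /eqP].
have Wt_blocks w : w \in Wt -> weight_blocks d (rWt w).
  by move=> wW; apply: GL_grad_blocks => //; apply: Wt_graded.
have norefl x : x \in G -> \rank (rWt x - 1%:M) != 1%N.
  move=> xG; have : x \notin reflections rWt 1 G by rewrite G_norefl inE.
  by rewrite inE xG fix_codimE.
have sGW := normal_sub G_normal.
have rank2 x : x \in G -> x != 1%g -> (1 < \rank (rWt x - 1%:M)%R)%N.
  move=> xG x1; rewrite ltn_neqAle eq_sym norefl // lt0n mxrank_eq0 -(repr_mx1 rWt).
  by apply: faithful_neq; rewrite ?(subsetP sGW).
have [c [g [mE g_inv g_homog g_rel g_gens]]] :=
  good_relations k_char0 d_gt0 Wt_blocks f_splitting rV_tangent G_good.
subst m.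
have [F F_gens] := chevalley_polynomial k_char0 d_gt0 Wt_faithful Wt_blocks A_refl Wt_refl.
have [h h_all] := lifted_invariants k_char0 d_gt0 Wt_blocks G_normal f_splitting rV_tangent F_gens.
have h_inv i : invariant_poly rV (Wt / G)%g (h i) by case: (h_all i).
have h_lift i : h i \mPo f = tnth F i by case: (h_all i).
have h_homog i : exists2 r, (0 < r)%N & h i \is r.-homog for (wdeg e) by case: (h_all i).
have f_gens := splitting_gens d_gt0 Wt_blocks G_normal f_splitting.
have rV_faithful := tangent_faithful k_char0 d_gt0 Wt_faithful Wt_blocks G_normal f_splitting rV_tangent.
have JJ := jacobian_dvd_comp k_char0 d_gt0 Wt_faithful Wt_blocks G_normal f_splitting rV_tangent
  g_inv g_homog g_rel g_gens norefl F_gens h_inv h_lift h_homog.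
have JJ' := comp_dvd_jacobian k_char0 d_gt0 Wt_faithful Wt_blocks G_normal f_splitting rV_tangent
  g_inv g_homog g_rel g_gens norefl F_gens h_inv h_lift h_homog.
have lifted_gens_poly := lifted_gens_polynomial_gens k_char0 d_gt0 Wt_faithful Wt_blocks G_normal f_splitting rV_tangent
  g_inv g_homog g_gens F_gens h_inv h_lift h_homog.
have J0 := lifted_gens_jacobian_comp k_char0 d_gt0 Wt_faithful Wt_blocks G_normal f_splitting rV_tangent
  g_inv g_homog g_gens F_gens h_inv h_lift h_homog.
have tangent s : s \in A -> \rank (rV (coset G s) - 1%:M) = 1%N.
  move=> sA; apply: (tangent_reflection k_char0 G_normal f_gens rV_faithful rV_tangent g_inv g_rel) => //.
  - exact: (conormal_section k_char0 d_gt0 Wt_faithful Wt_blocks G_normal f_splitting rV_tangent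
      g_inv g_homog g_rel g_gens F_gens h_inv h_lift h_homog).
  - exact: (subsetP A_sub).
  - exact: A_refl.
split.
- have -> : reflections rWt 2 G = double_refl G rWt.
    by apply/setP => x; rewrite !inE fix_codimE.
  apply: (double_refl_gen k_char0 Wt_faithful G_normal f_gens (splitting_inv f_splitting)
    (splitting_free f_splitting) _ rV_tangent rank2 A_sub Wt_refl A_refl tangent).
  by move=> i; apply: (homog_mcoeff0 (splitting_weight_gt0 d_gt0 f_splitting i) (splitting_homog f_splitting i)).
- move=> s sA; have sW := subsetP A_sub s sA; split.
    by rewrite inE mem_quotient // fix_codimE tangent.
  exact: (coset_reflection_order G_normal rank2 sW (A_refl s sA)).
- move=> x xG; have xW := subsetP sGW x xG.
  (* The Jacobian of [F] is a scalar multiple of a polynomial in [f], hence G-invariant; being also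
     semi-invariant for the inverse determinant, it forces the determinant to be 1. *)
  have [q q0 JE] := dvdm_antisym_const J0 JJ' JJ.
  have [F_inv _ _ _] := F_gens.
  have JF := jacobian_pullback (fun i => F_inv i x xW).
  have invJ : pullback (rWt x) (jacobian F) = jacobian F.
    rewrite JE linearZ /= comp_pullback; congr (_ *: _); apply: eq_comp_mpoly => i.
    by rewrite tnth_mktuple (splitting_inv f_splitting).
  have JF0 : jacobian F != 0 by rewrite JE scaler_eq0 negb_or q0.
  have : (\det (rWt x))%:MP = 1 :> {mpoly k[n]}.
    by apply: (mulfI JF0); rewrite mulr1 -{1}invJ -JF.
  by move/(congr1 (mcoeff 0%MM)); rewrite mcoeffC eqxx mulr1 mcoeff1 eqxx.
(* Both ideals are principal, so mutual divisibility of the Jacobians suffices; [jacobian_dvd]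
   changes the system of generators. *)
- move=> b; split=> [|[F' F'_gens /ideal_of_principal F'b]].
    move: b; apply: ideal_of_ind => [|b b' [F1 F1g /ideal_of_principal b1] [F2 F2g /ideal_of_principal b2]|r b].
    + by exists F => //; apply: ideal_of0.
    + exists F => //; apply/ideal_of_principal; apply: dvdmD.
        exact: dvdm_trans (jacobian_dvd F_gens F1g) b1.
      exact: dvdm_trans (jacobian_dvd F_gens F2g) b2.
    move=> [a [h' h'_gens /ideal_of_principal h'a] ->]; exists F => //; apply/ideal_of_principal.
    apply/dvdm_mull/(dvdm_trans JJ).
    have [q ->] := dvdm_trans (jacobian_dvd lifted_gens_poly h'_gens) h'a.
    by exists (q \mPo f); rewrite rmorphM.
  have [q ->] := dvdm_trans JJ' (dvdm_trans (jacobian_dvd F_gens F'_gens) F'b).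
  apply/ideal_ofM/ideal_of_gen; exists (jacobian (lifted_gens g h)) => //.
  by exists (lifted_gens g h) => //; apply/ideal_of_principal/dvdm_refl.
Qed.
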